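(* Let $m$ be a nonzero Borel measure on $\mathbb{R}$ with $m(\mathbb{R})<\infty$, and consider the Poisson point field on $\mathbb{R}\times\mathbb{R}$ with intensity $dt\times m(dx)$. With probability 1 the following holds: let $\gamma$ be the unique recurrent global minimizer. If $\tilde\gamma:(-\infty,0]\to\mathbb{R}$ is a one-sided infinite minimizer (a limit of finite-time minimizers, as defined in the context), then there is $\tau<0$ such that the restrictions of $\gamma$ and $\tilde\gamma$ to $(-\infty,\tau]$ coincide.
   Context: $(\Omega,\mathcal{F},\mathsf{P})$ is a complete probability space; $\Omega$ is identified with the space of locally finite point configurations $\omega=\{(s_i,x_i)\}$ in $\mathbb{R}\times\mathbb{R}$ (first coordinate time, second coordinate space), and $\mathsf{P}$ is the law of the Poisson point field with intensity $dt\times m(dx)$. For $t_0<t_1$ and a path $\gamma$, $N^{t_0,t_1}_\omega(\gamma)$ is the number of points of $\omega$ that $\gamma$ passes through between $t_0$ and $t_1$, and the action is $$\mathcal{A}^{t_0,t_1}_\omega(\gamma)=\frac12\int_{t_0}^{t_1}\dot\gamma^2(s)\,ds-N^{t_0,t_1}_\omega(\gamma).$$ For $A_0,A_1\subset\mathbb{R}$, $\Gamma_{t_0,A_0}^{t_1,A_1}$ is the set of continuous piecewise linear paths $\gamma$ on $[t_0,t_1]$ with $\gamma(t_0)\in A_0$, $\gamma(t_1)\in A_1$, whose switchings from one linear regime to another happen only at points of $\omega$, and $M_{t_0,A_0}^{t_1,A_1}$ is the set of minimizers of $\mathcal{A}^{t_0,t_1}_\omega$ over $\Gamma_{t_0,A_0}^{t_1,A_1}$;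 a singleton $\{x\}$ is written $x$. A path $\gamma:\mathbb{R}\to\mathbb{R}$ is a global minimizer if $\gamma|_{[t_0,t_1]}\in M_{t_0,\gamma(t_0)}^{t_1,\gamma(t_1)}$ for all $t_0<t_1$; it is recurrent if there are $R>0$ and a two-sided sequence $(t_k)_{k\in\mathbb{Z}}$ with $\lim_{k\to\pm\infty}t_k=\pm\infty$ and $\gamma(t_k)\in[-R,R]$ for all $k$. With probability 1 there is a unique recurrent global minimizer. One-sided infinite minimizers: with probability 1, for each $x\in\mathbb{R}$ and each $\sigma_0>0$ the sets of restrictions $M_{-t,\mathbb{R}}^{0,x}|_{[-\sigma_0,0]}$ do not depend on $t$ for all sufficiently large $t$. A one-sided infinite minimizer is a path $\tilde\gamma:(-\infty,0]\to\mathbb{R}$ such that, with $x=\tilde\gamma(0)$, for every $\sigma_0>0$ one has $\tilde\gamma|_{[-\sigma_0,0]}\in M_{-t,\mathbb{R}}^{0,x}|_{[-\sigma_0,0]}$ for all sufficiently large $t$. *)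

(* Defs.v *)
From HB Require Import structures.
From mathcomp Require Import all_boot all_order all_algebra.
From mathcomp Require Import finmap.
From mathcomp Require Import all_classical all_reals all_analysis.
From mathcomp Require Import measurable_realfun.

Set Implicit Arguments.
Unset Strict Implicit.
Unset Printing Implicit Defensive.

Import Order.TTheory GRing.Theory Num.Theory.
Import numFieldNormedType.Exports.

Local Open Scope classical_set_scope.
Local Open Scope ring_scope.

(* Space-time is R * R, with time as the first coordinate. *)

Definition locally_finite (R : realType) (A : set (R * R)) : Prop :=
  forall K : set (R * R), compact K -> finite_set (A `&` K).

Definition point_count (R : realType) (T : Type) (conf : T -> set (R * R))
    (B : set (measurableTypeR R * measurableTypeR R)) (w : T) : \bar R :=
  counting (conf w `&` B).

(* The probability mass function is written out because the library's
   [poisson_pmf rate k] is 1 for every [k] when [rate = 0]. *)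
Record poisson_field (R : realType) (d : measure_display)
    (Omega : measurableType d) (P : probability Omega R)
    (mu : set (measurableTypeR R * measurableTypeR R) -> \bar R)
    (conf : Omega -> set (R * R)) : Prop := PoissonField {
  poisson_field_locally_finite : forall w, locally_finite (conf w) ;
  poisson_field_measurable : forall B, measurable B ->
    measurable_fun [set: Omega] (point_count conf B) ;
  poisson_field_count : forall B (l : R) (k : nat),
    measurable B -> mu B = l%:E ->
    P [set w | point_count conf B w = k%:R%:E] =
      (l ^+ k / k`!%:R * expR (- l))%:E ;
  poisson_field_independent :
    forall (n : nat)
      (B : 'I_n -> set (measurableTypeR R * measurableTypeR R))
      (C : 'I_n -> set (\bar R)),
    (forall i, measurable (B i)) -> trivIset [set: 'I_n] B ->
    (forall i, measurable (C i)) ->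
    P [set w | forall i, C i (point_count conf (B i) w)] =
      (\prod_(i < n) P [set w | C i (point_count conf (B i) w)])%E
}.

(* A path on [t0, t1] is represented by a function on the whole line;
   [admissible], [action] and [minimizers] do not depend on its values outside
   [t0, t1]. *)

Definition affine_on (R : realType) (D : set R) (g : R -> R) : Prop :=
  exists a b : R, forall s, D s -> g s = a * s + b.

Definition piecewise_linear (R : realType) (t0 t1 : R) (g : R -> R) : Prop :=
  exists s : seq R,
    [/\ path <%R t0 s, last t0 s = t1 &
        forall i, (i < size s)%N ->
          affine_on `]nth t0 (t0 :: s) i, nth t0 s i[ g].

Definition switches_at (R : realType) (g : R -> R) (t : R) : Prop :=
  ~ exists2 e : R, 0 < e & affine_on `]t - e, t + e[ g.

(* Gamma_{t0,A0}^{t1,A1} *)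
Definition admissible (R : realType) (w : set (R * R))
    (t0 : R) (A0 : set R) (t1 : R) (A1 : set R) : set (R -> R) :=
  [set g | [/\ {within `[t0, t1], continuous g},
               piecewise_linear t0 t1 g,
               forall t, t0 < t < t1 -> switches_at g t -> w (t, g t),
               A0 (g t0) & A1 (g t1)]].

(* Finite when g is continuous and w is locally finite. *)
Definition points_on_path (R : realType) (w : set (R * R)) (t0 t1 : R)
    (g : R -> R) : nat :=
  #|` fset_set [set p : R * R | w p /\ t0 <= p.1 <= t1 /\ g p.1 = p.2] |%fset.

(* The derivative of a piecewise linear g may fail to exist at finitely many
   times, which does not affect the integral. *)
Definition action (R : realType) (w : set (R * R)) (t0 t1 : R)
    (g : R -> R) : R :=
  2^-1 * (\int[lebesgue_measure]_(s in `[t0, t1]) (derive1 g s) ^+ 2)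
    - (points_on_path w t0 t1 g)%:R.

(* M_{t0,A0}^{t1,A1} *)
Definition minimizers (R : realType) (w : set (R * R))
    (t0 : R) (A0 : set R) (t1 : R) (A1 : set R) : set (R -> R) :=
  [set g | admissible w t0 A0 t1 A1 g /\
     forall h, admissible w t0 A0 t1 A1 h ->
       action w t0 t1 g <= action w t0 t1 h].

Definition global_minimizer (R : realType) (w : set (R * R)) (g : R -> R) :
    Prop :=
  forall t0 t1, t0 < t1 -> minimizers w t0 [set g t0] t1 [set g t1] g.

Definition recurrent (R : realType) (g : R -> R) : Prop :=
  exists (r : R) (t : int -> R),
    [/\ 0 < r,
        t n%:Z @[n --> \oo] --> +oo,
        t (- n%:Z) @[n --> \oo] --> -oo &
        forall k, - r <= g (t k) <= r].

(* A path on (-oo, 0] is represented by a function on the whole line, of which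
   only the values at nonpositive times matter. *)
Definition one_sided_minimizer (R : realType) (w : set (R * R)) (g : R -> R) :
    Prop :=
  forall s0, 0 < s0 -> \forall t \near +oo,
    exists2 h, minimizers w (- t) [set: R] 0 [set g 0] h &
      forall s, - s0 <= s <= 0 -> g s = h s.

(* Main.v *)
Require Import Defs.
From HB Require Import structures.
From mathcomp Require Import all_boot all_order all_algebra.
From mathcomp Require Import finmap.
From mathcomp Require Import all_classical all_reals all_analysis.
From mathcomp Require Import measurable_realfun.
From mathcomp Require Import ring lra zify.
Set Implicit Arguments.
Unset Strict Implicit.
Unset Printing Implicit Defensive.
Import Order.TTheory GRing.Theory Num.Theory.
Import numFieldNormedType.Exports.
Local Open Scope classical_set_scope.
Local Open Scope ring_scope.

(** Why the theorem is true.  Cut time into cells of a large length L and fix a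
    height x0 near which the measure m has some mass.  Most cells contain a
    point of the configuration near height x0, and for a large radius rad only
    few cells contain points at heights beyond rad.  Collecting one point near
    x0 per cell costs little kinetic energy, of order 1/L, and gains 1 each
    time; so over long times this beats whatever can be collected far from the
    axis.  Call a cell good if near it the configuration consists of exactly one
    point per cell, near height x0, and if at every larger scale, on both sides,
    most cells can be harvested in this way and few far points exist.

    A minimizer on a time interval whose ends are moderately high, compared with
    their distance from a good cell, goes through the point of that cell
    ([good_cell_capture]).  Otherwise, follow the minimizer up to its last visit
    at a moderate height before the cell, harvest from there to the point of the
    cell and on to the first such visit after the cell: the detour loses at most
    1/4 on each side, up to the visits that it replaces, and gains the point
    itself.

    Minimizers with prescribed ends in the configuration are unique if there is
    no tie, that is no coincidence between the kinetic energies of two different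
    polygonal chains ([minimizers_unique]).  Suppose then that good cells occur
    arbitrarily far to the left and to the right.  Minimizers between the points
    of distant good cells pass through the points of the good cells in between,
    so they extend one another and define a global minimizer, which is
    recurrent.  Every other recurrent global minimizer passes through the points
    of all good cells, and every one-sided minimizer through the points of all
    good cells sufficiently far to the left; between two such points uniqueness
    makes them agree with the first one.  This is
    [recurrent_minimizer_of_good_cells].

    Two almost sure statements remain.  Good cells exist ([good_cells_ae]): among
    4^V well separated cells each has the right configuration up to distance V
    with a probability of order 2^-V at least, independently of the others,
    while the probability that a given cell is spoiled from a distance larger
    than V is at most 2^-5V.  There are no ties ([no_ties_ae]): given the other
    points, the kinetic energy is a strictly convex function of the time of a
    vertex, so that a tie determines this time up to two values. *)

(** * Piecewise linear paths *)

Section PiecewiseLinear.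
Context {R : realType}.
Implicit Types (g h : R -> R) (s : seq R) (a b c t u v : R).

(** The affine formula is required up to the ends, with the coefficients that
    the values at the ends dictate. *)
Definition linear_between u v g : Prop :=
  forall t, u <= t <= v -> g t = g u + (g v - g u) / (v - u) * (t - u).

Lemma affine_linear_between u v g : u < v -> affine_on `[u, v] g ->
  linear_between u v g.
Proof.
move=> uv [a [b H]] t /andP[ut tv].
have -> : g u = a * u + b by apply: H; rewrite /= in_itv /= lexx ltW.
have -> : g v = a * v + b by apply: H; rewrite /= in_itv /= lexx ltW.
have -> : g t = a * t + b by apply: H; rewrite /= in_itv /= ut tv.
have ne : v - u != 0 by rewrite subr_eq0 gt_eqF.
by field.
Qed.

Lemma linear_between_affine u v g : linear_between u v g ->
  affine_on `[u, v] g.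
Proof.
move=> H; exists ((g v - g u) / (v - u)), (g u - (g v - g u) / (v - u) * u).
move=> t; rewrite /= in_itv /= => tuv; rewrite {1}(H t tuv); ring.
Qed.

Lemma linear_between_sub u v u' v' g : u <= u' -> u' < v' -> v' <= v ->
  linear_between u v g -> linear_between u' v' g.
Proof.
move=> uu' u'v' v'v H; apply: affine_linear_between => //.
have [a [b Hab]] := linear_between_affine H; exists a, b => t /=.
rewrite in_itv /= => /andP[u't tv']; apply: Hab.
by rewrite /= in_itv /= (le_trans uu' u't) (le_trans tv' v'v).
Qed.

Lemma eq_linear_between u v g h : {in `[u, v], g =1 h} -> u <= v ->
  linear_between u v g -> linear_between u v h.
Proof.
move=> gh uv H t tuv.
have <- : g t = h t by apply: gh; rewrite in_itv.
have <- : g u = h u by apply: gh; rewrite in_itv /= lexx uv.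
have <- : g v = h v by apply: gh; rewrite in_itv /= lexx uv.
exact: H.
Qed.

Lemma open_affine_linear_between u v g : u < v ->
  {within `[u, v], continuous g} -> affine_on `]u, v[ g ->
  linear_between u v g.
Proof.
move=> uv /(continuous_within_itvP _ uv)[_ gu gv] [a [b H]].
have lim_at : forall c, (fun t => a * t + b) x @[x --> c] --> a * c + b.
  by move=> c; apply: cvgD; [apply: cvgM; [exact: cvg_cst|exact: cvg_id]|exact: cvg_cst].
have E1 : g u = a * u + b.
  apply: (cvg_unique _ gu) => //=.
  apply: cvg_trans (cvg_at_right_filter (lim_at u)).
  apply: near_eq_cvg; near=> t; rewrite H //= in_itv /=.
  by apply/andP; split; near: t; [exact: nbhs_right_gt|exact: nbhs_right_lt].
have E2 : g v = a * v + b.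
  apply: (cvg_unique _ gv) => //=.
  apply: cvg_trans (cvg_at_left_filter (lim_at v)).
  apply: near_eq_cvg; near=> t; rewrite H //= in_itv /=.
  by apply/andP; split; near: t; [exact: nbhs_left_gt|exact: nbhs_left_lt].
apply: affine_linear_between => //; exists a, b => t /=.
rewrite in_itv /= => /andP[]; rewrite le_eqVlt => /predU1P[<- //|ut].
rewrite le_eqVlt => /predU1P[-> //|tv].
by apply: H; rewrite /= in_itv /= ut tv.
Unshelve. all: by end_near. Qed.

Fixpoint pl_partition g t0 s : Prop :=
  if s is t :: s' then
    [/\ t0 < t, linear_between t0 t g & pl_partition g t s']
  else True.

Definition pl_path t0 t1 g : Prop :=
  exists2 s, pl_partition g t0 s & last t0 s = t1.

Lemma pl_partition_le g t0 s : pl_partition g t0 s -> t0 <= last t0 s.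
Proof.
elim: s t0 => [|t s IH] t0 //= [lt _ /IH]; apply: le_trans; exact: ltW.
Qed.

Lemma pl_partition_continuous g t0 s : pl_partition g t0 s ->
  {within `[t0, last t0 s], continuous g}.
Proof.
elim: s t0 => [|t s IH] t0 /=; first by move=> _; rewrite set_itv1; exact: continuous_subspace1.
move=> [lt L /[dup] /pl_partition_le le /IH C].
have -> : `[t0, last t s]%classic = `[t0, t] `|` `[t, last t s].
  apply/seteqP; split=> x /=; rewrite !in_itv /=.
    by move=> /andP[-> ->]; case: (leP x t) => [_|/ltW ->]; [left|right].
  by case=> /andP[h1 h2]; apply/andP; split; lra.
apply: withinU_continuous => //; first exact: itv_closed.
  exact: itv_closed.
apply: (@subspace_eq_continuous _ _ _ (fun x => g t0 + (g t - g t0) / (t - t0) * (x - t0))).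
  by move=> x; rewrite inE /= in_itv /= => /L xE; rewrite -xE.
apply: continuous_subspaceT => x.
apply: cvgD; first exact: cvg_cst.
apply: cvgM; first exact: cvg_cst.
by apply: cvgB; [exact: cvg_id|exact: cvg_cst].
Qed.

(** Recursive partitions, on which the arguments below do induction, describe
    the same paths as indexed ones: by continuity an affine formula extends to
    the ends of its interval. *)
Lemma pl_pathP t0 t1 g : pl_path t0 t1 g <->
  {within `[t0, t1], continuous g} /\ piecewise_linear t0 t1 g.
Proof.
split.
  move=> [s Hs <-]; split; first exact: pl_partition_continuous.
  exists s; split=> //.
    by elim: s t0 Hs => //= t s IH t0 [-> _ /IH ->].
  elim: s t0 Hs => //= t s IH t0 [lt L H] [_|i si] //=; last first.
    rewrite (set_nth_default t) ?(set_nth_default t t0 (n := i)) //=.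
      exact: IH.
    exact: ltnW.
  have [a [b Hab]] := linear_between_affine L; exists a, b => x /= xI.
  by apply: Hab; rewrite /=; apply: subset_itvW xI.
move=> [C [s [P E H]]]; rewrite -E in C *; exists s => // {E}.
elim: s t0 P H C => //= t s IH t0 /andP[lt P] H C; split => //.
- apply: open_affine_linear_between => //; last exact: (H 0%N).
  apply: continuous_subspaceW C; apply: subset_itvl; rewrite bnd_simp.
  elim: s t P {IH H lt} => //= t' s IH t /andP[/ltW l /IH]; exact: le_trans.
- apply: IH => //; last first.
    apply: continuous_subspaceW C; apply: subset_itvr; rewrite bnd_simp; exact: ltW.
  move=> i si.
  have si' : (i < size (t :: s))%N by exact: ltnW.
  by have := H i.+1 si; rewrite /= [nth t0 (t :: s) i](set_nth_default t t0 si') [nth t0 s i](set_nth_default t t0 si).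
Qed.
End PiecewiseLinear.

(** * Kinetic energy and polygonal chains *)

Section Energy.
Context {R : realType}.
Implicit Types (g h : R -> R) (s : seq R) (a b c t u v : R)
  (p q : R * R) (l : seq (R * R)).

Definition energy u v g : R :=
  \int[lebesgue_measure]_(s in `[u, v]) (derive1 g s) ^+ 2.

Definition slope u v g : R := (g v - g u) / (v - u).

Lemma derive1_linear_between u v g t : linear_between u v g -> u < t < v ->
  derive1 g t = slope u v g.
Proof.
move=> L /andP[ut tv]; rewrite derive1E.
pose h := fun x => g u + slope u v g * (x - u).
rewrite (@near_eq_derive _ _ _ _ h); last first.
  near=> x; apply: L; apply/andP; split; apply: ltW; near: x.
    exact: lt_nbhsr.
  exact: lt_nbhsl.
have H : is_derive t 1 h (slope u v g).
  apply: is_derive_eq.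
  by rewrite add0r mul1r subr0 /GRing.scale /= mulr1.
exact: derive_val.
Unshelve. all: by end_near. Qed.

(** Twice the kinetic cost of the uniform motion from [p] to [q]. *)
Definition link p q : R := (q.2 - p.2) ^+ 2 / (q.1 - p.1).

Fixpoint kinetic p l : R :=
  if l is q :: l' then link p q + kinetic q l' else 0.

Definition graph_seq g s : seq (R * R) := [seq (t, g t) | t <- s].

Lemma energy_linear_between u v g : u < v -> linear_between u v g ->
  measurable_fun `[u, v] (fun x => (derive1 g x) ^+ 2) /\
  (\int[lebesgue_measure]_(s in `[u, v]) ((derive1 g s) ^+ 2)%:E =
    (link (u, g u) (v, g v))%:E)%E.
Proof.
move=> uv L.
have E : {in `]u, v[, (fun x => (derive1 g x) ^+ 2) =1 cst (slope u v g ^+ 2)}.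
  by move=> x; rewrite in_itv /= => /(derive1_linear_between L) ->.
have mo : measurable_fun `]u, v[ (fun x => (derive1 g x) ^+ 2).
  apply: (eq_measurable_fun (cst (slope u v g ^+ 2))); last exact: measurable_cst.
  by move=> x; rewrite inE => /E ->.
split.
  apply/measurable_fun_itv_bndo_bndcP; exact/measurable_fun_itv_obnd_cbndP.
rewrite integral_itv_bndoo; last exact/measurable_EFinP.
rewrite (eq_integral (cst (slope u v g ^+ 2)%:E)); last first.
  by move=> x; rewrite inE => /E /= ->.
rewrite integral_cst //= lebesgue_measure_itv /= lte_fin uv -EFinB -EFinM.
congr EFin; rewrite /slope /link /=.
have ne : v - u != 0 by rewrite subr_eq0 gt_eqF.
by field.
Qed.

Lemma integral_derive_partition g t0 s : pl_partition g t0 s ->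
  measurable_fun `[t0, last t0 s] (fun x => (derive1 g x) ^+ 2) /\
  (\int[lebesgue_measure]_(x in `[t0, last t0 s]) ((derive1 g x) ^+ 2)%:E =
    (kinetic (t0, g t0) (graph_seq g s))%:E)%E.
Proof.
elim: s t0 => [|t s IH] t0 /=.
  by rewrite set_itv1 integral_set1; split => //; exact: measurable_fun_set1.
move=> [lt L P]; have [m1 I1] := energy_linear_between lt L.
have [m2 I2] := IH _ P; have le := pl_partition_le P.
have D : `[t0, last t s]%classic = `[t0, t] `|` `]t, last t s].
  by rewrite -itv_bndbnd_setU // bnd_simp ?ltW.
have m2' : measurable_fun `]t, last t s] (fun x => (derive1 g x) ^+ 2).
  exact/measurable_fun_itv_obnd_cbndP.
have m : measurable_fun (`[t0, t] `|` `]t, last t s]) (fun x => (derive1 g x) ^+ 2).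
  by apply/measurable_funU.
rewrite D; split => //.
rewrite ge0_integral_setU //=.
- by rewrite I1 integral_itv_obnd_cbnd ?I2 //; exact/measurable_EFinP.
- exact/measurable_EFinP.
- by move=> x _; rewrite lee_fin sqr_ge0.
- by apply/disj_setPS => x [] /=; rewrite !in_itv /= => /andP[_ xt] /andP[]; rewrite ltNge xt.
Qed.

Lemma energy_partition g t0 s : pl_partition g t0 s ->
  energy t0 (last t0 s) g = kinetic (t0, g t0) (graph_seq g s).
Proof. by move=> /integral_derive_partition[_]; rewrite /energy /Rintegral => ->. Qed.

Lemma kinetic_cat p l1 l2 :
  kinetic p (l1 ++ l2) = kinetic p l1 + kinetic (last p l1) l2.
Proof.
by elim: l1 p => [|q l IH] p /=; rewrite ?add0r // IH addrA.
Qed.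

Lemma pl_partition_cat g t0 s1 s2 : pl_partition g t0 (s1 ++ s2) <->
  pl_partition g t0 s1 /\ pl_partition g (last t0 s1) s2.
Proof.
elim: s1 t0 => [|t s IH] t0 /=; first by split=> [|[]].
by split=> [[h1 h2 /IH[]]//|[[h1 h2 h3] h4]]; split => //; apply/IH.
Qed.

Lemma eq_pl_partition g h t0 s : {in `[t0, last t0 s], g =1 h} ->
  pl_partition g t0 s -> pl_partition h t0 s.
Proof.
elim: s t0 => [|t s IH] t0 //= gh [lt L P]; have le := pl_partition_le P.
split => //.
  apply: (eq_linear_between _ (ltW lt) L) => x.
  by rewrite in_itv /= => /andP[h1 h2]; apply: gh; rewrite in_itv /= h1 (le_trans h2).
apply: IH => // x; rewrite in_itv /= => /andP[h1 h2]; apply: gh.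
by rewrite in_itv /= h2 andbT (le_trans _ h1) // ltW.
Qed.

Lemma eq_pl_path g h t0 t1 : {in `[t0, t1], g =1 h} ->
  pl_path t0 t1 g -> pl_path t0 t1 h.
Proof.
by move=> gh [s P E]; exists s => //; apply: eq_pl_partition P; rewrite E.
Qed.

Lemma pl_path_le g t0 t1 : pl_path t0 t1 g -> t0 <= t1.
Proof. by move=> [s /pl_partition_le + <-]. Qed.

Lemma pl_path_cat g a b c :
  pl_path a b g -> pl_path b c g -> pl_path a c g.
Proof.
move=> [s1 P1 E1] [s2 P2 E2]; exists (s1 ++ s2); last by rewrite last_cat E1.
by apply/pl_partition_cat; rewrite E1.
Qed.

Lemma energy_cat g a b c : pl_path a b g -> pl_path b c g ->
  energy a c g = energy a b g + energy b c g.
Proof.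
move=> [s1 P1 E1] [s2 P2 E2].
have P : pl_partition g a (s1 ++ s2) by apply/pl_partition_cat; rewrite E1.
have := energy_partition P; rewrite last_cat E1 E2 => ->.
rewrite /graph_seq map_cat kinetic_cat -/(graph_seq _ _) -(energy_partition P1) E1; congr (_ + _).
have -> : last (a, g a) [seq (t, g t) | t <- s1] = (b, g b).
  by rewrite (last_map (fun t => (t, g t))) E1.
by rewrite -/(graph_seq g s2) -(energy_partition P2) E2.
Qed.

Lemma pl_path_split g a b c : a <= b <= c -> pl_path a c g ->
  pl_path a b g /\ pl_path b c g.
Proof.
move=> /andP[ab bc] [s P E]; rewrite -E in bc *; move=> {E}.
elim: s a P ab bc => [|t s IH] a /=.
  move=> _ ab ba; have -> : b = a by apply/eqP; rewrite eq_le ab ba.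
  by split; exists [::].
move=> [at_ L P] ab bt; have [tb|bt'] := leP t b.
  have [P1 P2] := IH _ P tb bt; split => //.
  by apply: pl_path_cat P1; exists [:: t].
move: ab; rewrite le_eqVlt => /predU1P[ab|ab].
  by rewrite -ab; split; [exists [::]|exists (t :: s)].
split; first by exists [:: b] => //=; split => //; apply: linear_between_sub L => //; exact: ltW.
by exists (t :: s) => //=; split => //; apply: linear_between_sub L => //; exact: ltW.
Qed.

Definition before p q := p.1 < q.1.

Lemma link_ge0 p q : before p q -> 0 <= link p q.
Proof. by move=> pq; rewrite divr_ge0 ?sqr_ge0 // subr_ge0 ltW. Qed.

Lemma kinetic_ge0 p l : path before p l -> 0 <= kinetic p l.
Proof.
by elim: l p => //= q l IH p /andP[/link_ge0 h /IH]; exact: addr_ge0.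
Qed.

(** Cauchy-Schwarz: a detour costs kinetic energy. *)
Lemma link_triangle p q r : before p q -> before q r ->
  link p r <= link p q + link q r.
Proof.
rewrite /before /link => pq qr.
set x := q.2 - p.2; set y := r.2 - q.2.
have -> : r.2 - p.2 = x + y by rewrite /x /y; ring.
set a := q.1 - p.1; set b := r.1 - q.1.
have -> : r.1 - p.1 = a + b by rewrite /a /b; ring.
have a0 : 0 < a by rewrite subr_gt0.
have b0 : 0 < b by rewrite subr_gt0.
have ab0 : 0 < a + b by exact: addr_gt0.
rewrite -subr_ge0.
have -> : x ^+ 2 / a + y ^+ 2 / b - (x + y) ^+ 2 / (a + b) =
    (x * b - y * a) ^+ 2 / (a * b * (a + b)).
  by field; rewrite !gt_eqF.
by rewrite divr_ge0 ?sqr_ge0 // !mulr_ge0 // ltW.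
Qed.

Lemma path_before_last p l : path before p l -> l != [::] -> before p (last p l).
Proof.
elim: l p => //= q [|r l] IH p /andP[pq H] _ //.
by apply: lt_trans pq _; exact: IH.
Qed.

Lemma kinetic_ge_link p l : path before p l -> l != [::] ->
  link p (last p l) <= kinetic p l.
Proof.
elim: l p => //= q l IH p /andP[pq H] _.
case: l IH H => [|r l] IH H; first by rewrite /= addr0.
apply: (le_trans (link_triangle pq (path_before_last H isT))).
by rewrite lerD2l; exact: IH.
Qed.

Lemma path_graph_seq g t0 s : pl_partition g t0 s ->
  path before (t0, g t0) (graph_seq g s).
Proof. by elim: s t0 => //= t s IH t0 [lt _ /IH ->]; rewrite andbT. Qed.

Lemma energy_ge0 g a b : pl_path a b g -> 0 <= energy a b g.
Proof.
by move=> [s P <-]; rewrite energy_partition // kinetic_ge0 // path_graph_seq.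
Qed.

Lemma last_graph_seq g t0 s :
  last (t0, g t0) (graph_seq g s) = (last t0 s, g (last t0 s)).
Proof. by rewrite /graph_seq (last_map (fun t => (t, g t))). Qed.

Lemma energy_ge_link g a b : a < b -> pl_path a b g ->
  link (a, g a) (b, g b) <= energy a b g.
Proof.
move=> ab [s P E]; rewrite -E energy_partition //.
have /= := kinetic_ge_link (path_graph_seq P); rewrite last_graph_seq; apply.
by case: s P E => // _ E; rewrite /= in E; rewrite E ltxx in ab.
Qed.

(** By [link_triangle], each link is at most the energy of the path between its
    ends. *)
Lemma energy_ge_kinetic g a l : path before (a, g a) l ->
  (forall q, q \in l -> g q.1 = q.2) ->
  pl_path a (last (a, g a) l).1 g ->
  kinetic (a, g a) l <= energy a (last (a, g a) l).1 g.
Proof.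
elim: l a => [|q l IH] a /=; first by move=> _ _; exact: energy_ge0.
move=> /andP[aq H] gl P.
have qE : (q.1, g q.1) = q by rewrite gl ?mem_head // -surjective_pairing.
have ql : q.1 <= (last q l).1.
  by case: l H {IH gl P} => // r l H; apply/ltW; exact: path_before_last H isT.
have /pl_path_split /(_ P) [P1 P2] : a <= q.1 <= (last q l).1.
  by rewrite ql andbT; exact: ltW.
rewrite (energy_cat P1 P2) lerD //.
  by have := energy_ge_link aq P1; rewrite qE.
have := IH q.1; rewrite qE; apply => // r rl; apply: gl.
by rewrite inE rl orbT.
Qed.

Fixpoint polyline p l t : R :=
  if l is q :: l' then
    if t <= q.1 then p.2 + (q.2 - p.2) / (q.1 - p.1) * (t - p.1)
    else polyline q l' t
  else p.2.

Lemma polyline_start p l : path before p l -> polyline p l p.1 = p.2.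
Proof.
by case: l => //= q l /andP[/ltW pq _]; rewrite pq subrr mulr0 addr0.
Qed.

Lemma polyline_tail p q l t : q.1 <= t -> path before p (q :: l) ->
  polyline p (q :: l) t = polyline q l t.
Proof.
rewrite le_eqVlt => /predU1P[<-|qt] /andP[pq H] /=; last by rewrite leNgt qt.
rewrite lexx (polyline_start H).
have ne : q.1 - p.1 != 0 by rewrite subr_eq0 gt_eqF.
by rewrite /=; field.
Qed.

Lemma polyline_vertex p l q : path before p l -> q \in l ->
  polyline p l q.1 = q.2.
Proof.
elim: l p => // r l IH p H; rewrite inE.
have Hl : path before r l by case/andP: H.
move=> /predU1P[->|ql]; first by rewrite polyline_tail // polyline_start.
rewrite polyline_tail //; first exact: IH.
have tr : transitive before by move=> x y z; exact: lt_trans.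
by have := order_path_min tr Hl => /allP /(_ _ ql) /ltW.
Qed.

Lemma eq_graph_polyline p l : path before p l ->
  graph_seq (polyline p l) (map fst l) = l.
Proof.
move=> H; rewrite /graph_seq -map_comp; apply: map_id_in => q ql /=.
by rewrite polyline_vertex // -surjective_pairing.
Qed.

Lemma polyline_partition p l : path before p l ->
  pl_partition (polyline p l) p.1 (map fst l).
Proof.
elim: l p => //= q l IH p /[dup] H /andP[pq Hl]; split => //.
  apply: affine_linear_between => //.
  exists ((q.2 - p.2) / (q.1 - p.1)), (p.2 - (q.2 - p.2) / (q.1 - p.1) * p.1) => t.
  by rewrite /= in_itv /= => /andP[_ ->]; ring.
apply: eq_pl_partition (IH _ Hl) => t; rewrite in_itv /= => /andP[qt _].
by have /= -> := polyline_tail qt H.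
Qed.

Lemma pl_path_polyline p l : path before p l ->
  pl_path p.1 (last p l).1 (polyline p l).
Proof.
by move=> H; exists (map fst l); [exact: polyline_partition|rewrite last_map].
Qed.

Lemma energy_polyline p l : path before p l ->
  energy p.1 (last p l).1 (polyline p l) = kinetic p l.
Proof.
move=> H; have := energy_partition (polyline_partition H).
by rewrite last_map polyline_start // -surjective_pairing eq_graph_polyline.
Qed.

Lemma pl_partition_polyline g t0 s : pl_partition g t0 s ->
  {in `[t0, last t0 s], g =1 polyline (t0, g t0) (graph_seq g s)}.
Proof.
elim: s t0 => [|t s IH] t0 /=.
  by move=> _ x; rewrite in_itv /= => xE; congr g; apply/eqP; rewrite eq_le andbC.
move=> [lt L P] x; rewrite in_itv /= => /andP[tx xl].
case: leP => [xt|tx']; first by rewrite (L x) // tx xt.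
by apply: (IH _ P); rewrite in_itv /= xl ltW.
Qed.

(** Inside a linear piece a path is affine near every time. *)
Lemma switches_at_partition g t0 s t : pl_partition g t0 s ->
  t0 < t < last t0 s -> switches_at g t -> t \in s.
Proof.
elim: s t0 => [|r s IH] t0 /=.
  by move=> _ /andP[a b]; have := lt_trans a b; rewrite ltxx.
move=> [lt L P] /andP[t0t tl] sw; rewrite inE.
have [tr|rt|//] := ltgtP t r; last by rewrite (IH _ P) // rt tl.
exfalso; apply: sw; exists (Num.min (t - t0) (r - t)).
  by rewrite lt_min !subr_gt0 t0t tr.
have [a [b H]] := linear_between_affine L; exists a, b => x /=.
rewrite in_itv /= => /andP[h1 h2]; apply: H; rewrite /= in_itv /=.
have : Num.min (t - t0) (r - t) <= t - t0 by rewrite ge_min lexx.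
have : Num.min (t - t0) (r - t) <= r - t by rewrite ge_min lexx orbT.
by move=> ? ?; apply/andP; split; lra.
Qed.

End Energy.

(** * Actions, minimizers and their restrictions *)

Section Minimizers.
Context {R : realType}.
Implicit Types (g h : R -> R) (s : seq R) (a b c t u v : R)
  (p q e : R * R) (k l : seq (R * R)) (w : set (R * R)).

(** Local finiteness allows infinitely many points in a bounded time interval,
    at unbounded heights; then numbers of visited points could be infinite. *)
Definition strip_finite w : Prop :=
  forall a b, finite_set (w `&` [set p | a <= p.1 <= b]).

Definition visited w a b g : set (R * R) :=
  [set p | w p /\ a <= p.1 <= b /\ g p.1 = p.2].

Lemma visited_finite w a b g : strip_finite w -> finite_set (visited w a b g).
Proof. by move=> /(_ a b); apply: sub_finite_set => p [wp [pab _]]. Qed.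

Lemma visited_seq w a b g : strip_finite w ->
  exists l, [/\ uniq l, size l = points_on_path w a b g &
    forall p, p \in l <-> visited w a b g p].
Proof.
move=> /(visited_finite a b g) fin.
exists (enum_fset (fset_set (visited w a b g))); split => //.
  exact: fset_uniq.
by move=> p; rewrite in_fset_set // inE.
Qed.

Lemma points_on_path_ge w a b g l : strip_finite w -> uniq l ->
  (forall p, p \in l -> visited w a b g p) ->
  (size l <= points_on_path w a b g)%N.
Proof.
move=> sf ul lv; have [l' [_ <- l'P]] := visited_seq a b g sf.
by apply: uniq_leq_size => // p /lv /l'P.
Qed.

Lemma points_on_path_le w a b g m : strip_finite w ->
  (forall l, uniq l -> (forall p, p \in l -> visited w a b g p) ->
    (size l <= m)%N) ->
  (points_on_path w a b g <= m)%N.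
Proof.
move=> sf H; have [l [ul <- lP]] := visited_seq a b g sf.
by apply: H => // p /lP.
Qed.

Definition indicator w p : nat := `[< w p >].

Lemma eq_points_on_path w a b g h : {in `[a, b], g =1 h} ->
  points_on_path w a b g = points_on_path w a b h.
Proof.
move=> gh; rewrite /points_on_path; congr (#|` fset_set _|)%fset.
by apply/seteqP; split => p /= [wp [pab E]]; split => //; split => //;
  [rewrite -gh|rewrite gh] => //; rewrite in_itv.
Qed.

(** The two parts of the path share the point at time [b] and no other. *)
Lemma points_on_path_cat w g a b c : strip_finite w -> a <= b <= c ->
  (points_on_path w a c g + indicator w (b, g b) =
   points_on_path w a b g + points_on_path w b c g)%N.
Proof.
move=> sf /andP[ab bc].
have fab := visited_finite a b g sf.
have fbc := visited_finite b c g sf.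
rewrite /points_on_path -!/(visited _ _ _ _) -cardfsUI -fset_setU // -fset_setI //.
congr ((#|` fset_set _|)%fset + _)%N.
  apply/seteqP; split=> p /=.
    move=> [wp [/andP[h1 h2] E]]; have [pb|/ltW pb] := leP p.1 b; [left|right]; split => //.
      by rewrite h1.
    by rewrite pb.
  move=> [] [wp [/andP[h1 h2] E]]; split => //; split => //; apply/andP; split => //.
    exact: le_trans h2 bc.
  exact: le_trans ab h1.
have [wb|nwb] := pselect (w (b, g b)).
  rewrite /indicator asboolT //.
  have -> : visited w a b g `&` visited w b c g = [set (b, g b)].
    apply/seteqP; split=> p /=.
      move=> [[_ [/andP[_ h1] E]] [_ [/andP[h2 _] _]]].
      have pb : p.1 = b by apply/eqP; rewrite eq_le h1 h2.
      by rewrite [p]surjective_pairing -E pb.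
    by move=> ->; split; split => //=; rewrite ?ab ?bc lexx.
  by rewrite fset_set1 cardfs1.
rewrite /indicator asboolF //.
have -> : visited w a b g `&` visited w b c g = set0.
  rewrite -subset0 => p /= [[wp [/andP[_ h1] E]] [_ [/andP[h2 _] _]]].
  have pb : p.1 = b by apply/eqP; rewrite eq_le h1 h2.
  by apply: nwb; rewrite -pb E -surjective_pairing.
by rewrite fset_set0 cardfs0.
Qed.

Lemma actionE w a b g :
  action w a b g = 2^-1 * energy a b g - (points_on_path w a b g)%:R.
Proof. by []. Qed.

Lemma action_cat w g a b c : strip_finite w ->
  pl_path a b g -> pl_path b c g ->
  action w a c g =
    action w a b g + action w b c g + (indicator w (b, g b))%:R.
Proof.
move=> sf P1 P2; rewrite !actionE (energy_cat P1 P2).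
have := points_on_path_cat g sf (introT andP (conj (pl_path_le P1) (pl_path_le P2))).
move=> /(congr1 (fun n => n%:R : R)); rewrite !natrD => H.
by rewrite mulrDr; lra.
Qed.

Lemma eq_energy a b g h : {in `[a, b], g =1 h} -> pl_path a b g ->
  energy a b g = energy a b h.
Proof.
move=> gh P; have Q := eq_pl_path gh P; move: P => [s P E].
have Q' : pl_partition h a s by apply: eq_pl_partition P; rewrite E.
have le := pl_partition_le P.
rewrite -{1}E -{1}E (energy_partition P) (energy_partition Q').
have ga : g a = h a by apply: gh; rewrite in_itv /= lexx -E.
rewrite ga; congr kinetic; apply/eq_in_map => t ts; congr (_, _); apply: gh.
rewrite -E in_itv /=; apply/andP.
elim: s a P ts {E Q Q' le ga} => // r s IH a /= [lt L P].
have le := pl_partition_le P.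
rewrite inE => /predU1P[->|ts]; first by split => //; exact: ltW.
by have [h1 h2] := IH _ P ts; split => //; apply: le_trans h1; exact: ltW.
Qed.

Lemma eq_action w a b g h : {in `[a, b], g =1 h} -> pl_path a b g ->
  action w a b g = action w a b h.
Proof.
by move=> gh P; rewrite !actionE (eq_energy gh P) (eq_points_on_path w gh).
Qed.

Lemma before_trans : transitive (@before R).
Proof. by move=> x y z; exact: lt_trans. Qed.

Lemma before_irr : irreflexive (@before R).
Proof. by move=> x; exact: ltxx. Qed.

Lemma path_before_uniq p l : path before p l -> uniq (p :: l).
Proof. exact: (@sorted_uniq _ _ before_trans before_irr (p :: l)). Qed.

Lemma path_before_rcons p l e q : path before p (rcons l e) -> q \in l ->
  p.1 < q.1 < e.1.
Proof.
elim: l p => //= r l IH p /andP[pr H]; rewrite inE => /predU1P[->|/(IH _ H)].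
  apply/andP; split=> //.
  by have := path_before_last H; rewrite last_rcons; apply; case: (l).
by move=> /andP[h1 ->]; rewrite andbT (lt_trans pr).
Qed.

Lemma path_before_ends p l e : path before p (rcons l e) -> p.1 < e.1.
Proof.
by move=> /path_before_last; rewrite last_rcons; apply; case: (l).
Qed.

Lemma polyline_ends p l e : path before p (rcons l e) ->
  polyline p (rcons l e) p.1 = p.2 /\ polyline p (rcons l e) e.1 = e.2.
Proof.
move=> H; split; first exact: polyline_start.
by rewrite (polyline_vertex H) // mem_rcons mem_head.
Qed.

Lemma polyline_admissible w p l e (A0 A1 : set R) :
  path before p (rcons l e) -> {in l, forall q, w q} -> A0 p.2 -> A1 e.2 ->
  admissible w p.1 A0 e.1 A1 (polyline p (rcons l e)).
Proof.
move=> H lw Ap Ae; have [E0 E1] := polyline_ends H.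
have P := pl_path_polyline H; rewrite last_rcons in P.
have /pl_pathP[C L] := P; split; rewrite ?E0 ?E1 // => t tI sw.
have := switches_at_partition (polyline_partition H) _ sw.
rewrite last_map last_rcons => /(_ tI); rewrite map_rcons mem_rcons inE.
case/predU1P => [te|/mapP[q ql tq]].
  by move: tI; rewrite te ltxx andbF.
rewrite tq (polyline_vertex H) ?mem_rcons ?inE ?ql ?orbT //.
by rewrite -surjective_pairing; exact: lw.
Qed.

Lemma size_chain_points w p l e : {in l, forall q, w q} ->
  size [seq q <- p :: rcons l e | `[< w q >]] =
    (size l + indicator w p + indicator w e)%N.
Proof.
move=> lw; rewrite size_filter /= -cats1 count_cat /= addn0.
have -> : count (fun q => `[< w q >]) l = size l.
  by apply/eqP; rewrite -all_count; apply/allP => q /lw wq; apply/asboolP.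
by rewrite /indicator addnA [(_ + size l)%N]addnC.
Qed.

Lemma points_on_polyline w p l e : strip_finite w ->
  path before p (rcons l e) -> {in l, forall q, w q} ->
  (size l + indicator w p + indicator w e <=
    points_on_path w p.1 e.1 (polyline p (rcons l e)))%N.
Proof.
move=> sf H lw; have [E0 E1] := polyline_ends H.
have pe := path_before_ends H.
have U := path_before_uniq H.
rewrite -(size_chain_points p e lw).
apply: points_on_path_ge => //; first exact: filter_uniq.
move=> q; rewrite mem_filter inE mem_rcons inE.
move=> /andP[/asboolP wq qE]; split => //; move: qE.
move=> /predU1P[->|/predU1P[->|ql]].
- by rewrite lexx ltW.
- by rewrite lexx ltW.
- have /andP[h1 h2] := path_before_rcons H ql; rewrite !ltW //; split => //.
  by rewrite (polyline_vertex H) // mem_rcons inE ql orbT.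
Qed.

Lemma action_polyline_le w p l e : strip_finite w ->
  path before p (rcons l e) -> {in l, forall q, w q} ->
  action w p.1 e.1 (polyline p (rcons l e)) <=
    2^-1 * kinetic p (rcons l e)
      - (size l + indicator w p + indicator w e)%:R.
Proof.
move=> sf H lw; rewrite actionE.
have := energy_polyline H; rewrite last_rcons => ->.
by rewrite lerB // ler_nat; exact: points_on_polyline.
Qed.

(** A path is the graph of a function of time, so that the points which it
    visits have different times and form a chain once they are sorted. *)
Lemma visited_chain w a b g : strip_finite w -> a < b ->
  exists l, [/\ path before (a, g a) (rcons l (b, g b)),
    {in l, forall q, w q}, {in l, forall q, g q.1 = q.2} &
    (points_on_path w a b g <=
      size l + indicator w (a, g a) + indicator w (b, g b))%N].
Proof.
move=> sf ab; have [l0 [U S M]] := visited_seq a b g sf.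
pose leT p q : bool := p.1 <= q.1 :> R.
have tr : transitive leT by move=> x y z; exact: le_trans.
have tot : total leT by move=> x y; exact: le_total.
pose l := sort leT [seq q <- l0 | (q != (a, g a)) && (q != (b, g b))].
have lP q : q \in l -> [/\ w q, g q.1 = q.2 & a < q.1 < b].
  rewrite mem_sort mem_filter => /andP[/andP[qa qb] /M [wq [/andP[aq bq] E]]].
  split => //; rewrite !lt_neqAle aq bq !andbT; apply/andP; split.
    by apply: contra qa => /eqP qa; rewrite [q]surjective_pairing -E -qa.
  by apply: contra qb => /eqP qb; rewrite [q]surjective_pairing -E qb.
have lw : {in l, forall q, w q} by move=> q /lP[].
have ul : uniq l by rewrite sort_uniq filter_uniq.
exists l; split => //.
- rewrite -[path _ _ _]/(sorted before ((a, g a) :: rcons l (b, g b))).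
  rewrite sorted_pairwise; last exact: before_trans.
  rewrite pairwise_cons pairwise_rcons; apply/and3P; split.
  + apply/allP => q; rewrite mem_rcons inE => /predU1P[->|/lP[_ _ /andP[]]] //.
  + by apply/allP => q /lP[_ _ /andP[]].
  + have : pairwise leT l by rewrite -sorted_pairwise // sort_sorted.
    move: ul lP; elim: l {lw} => //= q r IH /andP[qr ur] lP /andP[/allP al pr].
    rewrite IH // ?andbT; last by move=> x xr; apply: lP; rewrite inE xr orbT.
    apply/allP => x xr; rewrite /before lt_neqAle (al x xr : q.1 <= x.1) andbT.
    apply: contra qr => /eqP qx.
    have [_ Eq _] := lP q (mem_head _ _).
    have [|_ Ex _] := lP x; first by rewrite inE xr orbT.
    by rewrite [q]surjective_pairing -Eq qx Ex -surjective_pairing.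
- by move=> q /lP[].
- rewrite -S -size_chain_points //; apply: uniq_leq_size => // q ql0.
  have [wq [_ Eq]] := (M q).1 ql0.
  rewrite mem_filter inE mem_rcons inE mem_sort mem_filter ql0 andbT asboolT //=.
  by case: eqP => //= _; case: eqP.
Qed.

(** Joining the visited points of a piecewise linear path by straight segments
    removes the switchings at other places without increasing the action. *)
Lemma inscribed_chain w a b g : strip_finite w -> a < b -> pl_path a b g ->
  exists l, [/\ path before (a, g a) (rcons l (b, g b)),
    {in l, forall q, w q} &
    2^-1 * kinetic (a, g a) (rcons l (b, g b))
      - (size l + indicator w (a, g a) + indicator w (b, g b))%:R
      <= action w a b g].
Proof.
move=> sf ab P; have [l [H lw lg N]] := visited_chain g sf ab.
exists l; split => //; rewrite actionE lerB ?ler_nat // ler_wpM2l ?invr_ge0 //.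
have := @energy_ge_kinetic _ g a (rcons l (b, g b)); rewrite last_rcons.
by apply => // q; rewrite mem_rcons inE => /predU1P[->|/lg].
Qed.

Lemma inscribed_admissible w a b g : strip_finite w -> a < b -> pl_path a b g ->
  exists h, [/\ forall A0 A1 : set R, A0 (g a) -> A1 (g b) ->
      admissible w a A0 b A1 h, h a = g a, h b = g b &
    action w a b h <= action w a b g].
Proof.
move=> sf ab P; have [l [H lw N]] := inscribed_chain sf ab P.
have [E0 E1] := polyline_ends H.
exists (polyline (a, g a) (rcons l (b, g b))); split => //.
- by move=> A0 A1 a0 a1; exact: (polyline_admissible H lw).
- by apply: le_trans N; exact: (action_polyline_le sf H lw).
Qed.

Lemma admissible_pl_path w t0 (A0 : set R) t1 (A1 : set R) g :
  admissible w t0 A0 t1 A1 g -> pl_path t0 t1 g.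
Proof. by case=> C P _ _ _; apply/pl_pathP. Qed.

(** Since inscribed chains are admissible, a minimizer also does better than the
    paths that switch outside the configuration, in particular than glued paths. *)
Lemma minimizer_le_pl_path w t0 A0 t1 A1 g h : strip_finite w -> t0 < t1 ->
  minimizers w t0 A0 t1 A1 g -> pl_path t0 t1 h -> A0 (h t0) -> A1 (h t1) ->
  action w t0 t1 g <= action w t0 t1 h.
Proof.
move=> sf t01 [_ M] P h0 h1.
have [h' [adm _ _]] := inscribed_admissible sf t01 P; apply: le_trans.
by apply: M; exact: adm.
Qed.

Lemma minimizer_le_chain w t0 A0 t1 A1 g x l : strip_finite w ->
  minimizers w t0 A0 t1 A1 g -> A0 x ->
  path before (t0, x) (rcons l (t1, g t1)) -> {in l, forall q, w q} ->
  2^-1 * energy t0 t1 g - (points_on_path w t0 t1 g)%:R <=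
    2^-1 * kinetic (t0, x) (rcons l (t1, g t1))
     - (size l + indicator w (t0, x) + indicator w (t1, g t1))%:R.
Proof.
move=> sf [[_ _ _ _ A1g] M] A0x H lw; rewrite -actionE.
apply: le_trans (action_polyline_le sf H lw).
exact/M/(polyline_admissible H lw).
Qed.

Lemma switches_at_near g h t a b : a < t < b -> {in `]a, b[, g =1 h} ->
  switches_at h t -> switches_at g t.
Proof.
move=> /andP[at_ tb] gh sw [e e0 [c [d H]]]; apply: sw.
exists (Num.min e (Num.min (t - a) (b - t))).
  by rewrite !lt_min e0 !subr_gt0 at_ tb.
exists c, d => x; rewrite /= in_itv /= => /andP[h1 h2].
set m := Num.min _ _ in h1 h2.
have m1 : m <= e by rewrite ge_min lexx.
have m2 : m <= t - a by rewrite !ge_min lexx orbT.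
have m3 : m <= b - t by rewrite !ge_min lexx !orbT.
rewrite -gh ?in_itv /=; last by apply/andP; split; lra.
by apply: H; rewrite /= in_itv /=; apply/andP; split; lra.
Qed.

Lemma admissible_sub w t0 A0 t1 A1 g u v (B0 B1 : set R) :
  t0 <= u -> u <= v -> v <= t1 -> B0 (g u) -> B1 (g v) ->
  admissible w t0 A0 t1 A1 g -> admissible w u B0 v B1 g.
Proof.
move=> tu uv vt b0 b1 /[dup] /admissible_pl_path P [_ _ S _ _].
have [|P1 _] := pl_path_split (a := t0) (b := v) (c := t1) _ P.
  by rewrite (le_trans tu uv).
have [|_ /pl_pathP[C L]] := pl_path_split (a := t0) (b := u) (c := v) _ P1.
  by rewrite tu uv.
split => // t /andP[ut tv]; apply: S.
by rewrite (le_lt_trans tu ut) (lt_le_trans tv vt).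
Qed.

Lemma eq_minimizers w t0 A0 t1 A1 g h : t0 <= t1 -> {in `[t0, t1], g =1 h} ->
  minimizers w t0 A0 t1 A1 g -> minimizers w t0 A0 t1 A1 h.
Proof.
move=> t01 gh [[C L S a0 a1] M].
have P : pl_path t0 t1 g by apply/pl_pathP.
have [C' L'] := (pl_pathP _ _ _).1 (eq_pl_path gh P).
have g0 : g t0 = h t0 by apply: gh; rewrite in_itv /= lexx.
have g1 : g t1 = h t1 by apply: gh; rewrite in_itv /= lexx t01.
split; last by move=> f /M; rewrite (eq_action w gh P).
split => //; rewrite -?g0 -?g1 // => t /[dup] tI /andP[h1 h2] sw.
rewrite -gh; last by rewrite in_itv /= !ltW.
apply: S => //; apply: switches_at_near tI _ sw => x; rewrite in_itv /= => /andP[? ?].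
by apply: gh; rewrite in_itv /= !ltW.
Qed.

Definition glue b g h t : R := if t <= b then g t else h t.

Lemma glue_left a b g h : {in `[a, b], g =1 glue b g h}.
Proof. by move=> t; rewrite in_itv /glue /= => /andP[_ ->]. Qed.

Lemma glue_right b c g h : g b = h b -> {in `[b, c], h =1 glue b g h}.
Proof.
move=> E t; rewrite in_itv /glue /= => /andP[bt _]; case: leP => // tb.
by have -> : t = b by apply/eqP; rewrite eq_le tb.
Qed.

(** A better path on the smaller interval could be glued to the rest of [g]; the
    joint is a switching that [minimizer_le_pl_path] tolerates. *)
Lemma minimizers_restrict_right w t0 A0 t1 A1 g v : strip_finite w ->
  t0 < v <= t1 -> minimizers w t0 A0 t1 A1 g ->
  minimizers w t0 A0 v [set g v] g.
Proof.
move=> sf /andP[t0v vt1] M; have [adm _] := M; have [_ _ _ a0 a1] := adm.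
have P := admissible_pl_path adm.
have [|P1 P2] := pl_path_split (a := t0) (b := v) (c := t1) _ P.
  by rewrite ltW.
split; first by apply: admissible_sub adm => //; exact: ltW.
move=> h admh; have [_ _ _ h0 /= hv] := admh.
have Ph := admissible_pl_path admh.
have Q1 := eq_pl_path (@glue_left t0 v h g) Ph.
have Q2 := eq_pl_path (@glue_right v t1 h g hv) P2.
have t01 : t0 < t1 by exact: lt_le_trans vt1.
have := minimizer_le_pl_path sf t01 M (pl_path_cat Q1 Q2).
have -> : glue v h g t0 = h t0 by rewrite /glue ltW.
have -> : glue v h g t1 = g t1.
  by rewrite -(@glue_right v t1 h g hv) // in_itv /= lexx vt1.
move=> /(_ h0) H; have {H} := H a1.
rewrite (action_cat sf P1 P2) (action_cat sf Q1 Q2).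
rewrite -(eq_action w (@glue_left t0 v h g) Ph).
rewrite -(eq_action w (@glue_right v t1 h g hv) P2).
have -> : glue v h g v = g v by rewrite /glue lexx.
lra.
Qed.

Lemma minimizers_restrict_left w t0 A0 t1 A1 g u : strip_finite w ->
  t0 <= u < t1 -> minimizers w t0 A0 t1 A1 g ->
  minimizers w u [set g u] t1 A1 g.
Proof.
move=> sf /andP[t0u ut1] M; have [adm _] := M; have [_ _ _ a0 a1] := adm.
have P := admissible_pl_path adm.
have [|P1 P2] := pl_path_split (a := t0) (b := u) (c := t1) _ P.
  by rewrite t0u ltW.
split; first by apply: admissible_sub adm => //; exact: ltW.
move=> h admh; have [_ _ _ /= hu h1] := admh.
have Ph := admissible_pl_path admh.
have Q1 := eq_pl_path (@glue_left t0 u g h) P1.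
have Q2 := eq_pl_path (@glue_right u t1 g h (esym hu)) Ph.
have t01 : t0 < t1 by exact: le_lt_trans ut1.
have := minimizer_le_pl_path sf t01 M (pl_path_cat Q1 Q2).
have -> : glue u g h t0 = g t0 by rewrite /glue t0u.
have -> : glue u g h t1 = h t1 by rewrite -(@glue_right u t1 g h (esym hu)) // in_itv /= lexx ltW.
move=> H; have {H} := H a0 h1.
rewrite (action_cat sf P1 P2) (action_cat sf Q1 Q2).
rewrite -(eq_action w (@glue_left t0 u g h) P1).
rewrite -(eq_action w (@glue_right u t1 g h (esym hu)) Ph).
have -> : glue u g h u = g u by rewrite /glue lexx.
lra.
Qed.

Lemma minimizers_restrict w t0 A0 t1 A1 g u v : strip_finite w ->
  t0 <= u -> u < v -> v <= t1 -> minimizers w t0 A0 t1 A1 g ->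
  minimizers w u [set g u] v [set g v] g.
Proof.
move=> sf tu uv vt M.
have t0v : t0 < v <= t1 by rewrite vt (le_lt_trans tu uv).
apply: minimizers_restrict_left (minimizers_restrict_right sf t0v M) => //.
by rewrite tu uv.
Qed.

End Minimizers.

(** * Existence and uniqueness of minimizers *)

Section ExistenceUniqueness.
Context {R : realType}.
Implicit Types (g h : R -> R) (s : seq R) (a b c t u v : R)
  (p q e : R * R) (k l : seq (R * R)) (w : set (R * R)).

Lemma seq_min (T : eqType) (f : T -> R) (s : seq T) (x0 : T) : x0 \in s ->
  exists2 x, x \in s & forall y, y \in s -> f x <= f y.
Proof.
elim: s x0 => // y s IH x0 _; case: s IH => [|z s] IH.
  by exists y; rewrite ?mem_head // => x; rewrite inE => /eqP ->.
have [x xs xm] := IH z (mem_head _ _).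
have [yx|/ltW xy] := leP (f y) (f x).
  exists y; rewrite ?mem_head // => r; rewrite inE => /predU1P[->//|/xm].
  exact: le_trans.
exists x; first by rewrite inE xs orbT.
by move=> r; rewrite inE => /predU1P[->//|/xm].
Qed.

Lemma path_before_eq p l1 l2 : path before p l1 -> path before p l2 ->
  l1 =i l2 -> l1 = l2.
Proof.
move=> /path_sorted h1 /path_sorted h2.
exact: (irr_sorted_eq (@before_trans R) (@before_irr R)).
Qed.

Lemma lists_over (T : eqType) (W : seq T) (n : nat) :
  exists L : seq (seq T), forall l : seq T, {subset l <= W} -> (size l <= n)%N -> l \in L.
Proof.
elim: n => [|n [L IH]].
  by exists [:: [::]] => l _; rewrite leqn0 size_eq0 => /eqP ->.
exists ([::] :: allpairs cons W L) => -[//|x l] lW sl.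
rewrite inE /=; apply/allpairsP; exists (x, l); split => //=.
  by apply: lW; rewrite mem_head.
by apply: IH => // y yl; apply: lW; rewrite inE yl orbT.
Qed.

(** In a strip with finitely many points there are finitely many chains, so
    that the best one exists, and it is optimal because every path can be
    replaced by a chain. *)
Lemma minimizers_exist w p e : strip_finite w -> p.1 < e.1 ->
  exists g, minimizers w p.1 [set p.2] e.1 [set e.2] g.
Proof.
move=> sf pe.
have [W WE] := (finite_seqP _).1 (sf p.1 e.1).
have [L LP] := lists_over W (size W).
have subW l : path before p (rcons l e) -> {in l, forall q, w q} -> l \in L.
  move=> H lw; have lW : {subset l <= W}.
    move=> q ql; have [h1 h2] := andP (path_before_rcons H ql).
    have : [set` W] q by rewrite -WE; split; [exact: lw|rewrite /= !ltW].
    by [].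
  apply: LP => //; apply: uniq_leq_size => //.
  by have /= /andP[_] := path_before_uniq H; rewrite rcons_uniq => /andP[].
pose L' := [seq l <- L | path before p (rcons l e) && all (fun q => `[< w q >]) l].
pose f l := action w p.1 e.1 (polyline p (rcons l e)).
have L'P l : (l \in L') <-> path before p (rcons l e) /\ {in l, forall q, w q}.
  rewrite mem_filter; split.
    by move=> /andP[/andP[H /allP lw] _]; split => // q /lw /asboolP.
  move=> [H lw]; rewrite H (subW l H lw) andbT /=.
  by apply/allP => q /lw wq; apply/asboolP.
have [|l /L'P[H lw] lmin] := @seq_min _ f L' [::].
  by apply/L'P; split => //=; rewrite andbT.
exists (polyline p (rcons l e)); split; first exact: (polyline_admissible H lw).
move=> h adm; have Ph := admissible_pl_path adm.
have [_ _ _ h0 h1] := adm.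
have [l' [H' lw' le']] := inscribed_chain sf pe Ph.
rewrite h0 h1 -!surjective_pairing in H' le'.
apply: le_trans le'; apply: le_trans (action_polyline_le sf H' lw').
by apply: lmin; apply/L'P.
Qed.

Lemma linear_between_slope u v g t t' : linear_between u v g ->
  u <= t -> t < t' -> t' <= v -> slope t t' g = slope u v g.
Proof.
move=> L ut tt' t'v; rewrite /slope.
rewrite (L t) ?(L t') ?ut ?t'v ?(le_trans (ltW tt')) ?(le_trans ut (ltW tt')) //.
have ne : t' - t != 0 by rewrite subr_eq0 gt_eqF.
have ne' : v - u != 0.
  by rewrite subr_eq0 gt_eqF // (le_lt_trans ut) // (lt_le_trans tt').
by field; rewrite ne ne'.
Qed.

Lemma linear_between_cat u v c g : u < v -> v < c -> linear_between u v g ->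
  linear_between v c g -> slope u v g = slope v c g -> linear_between u c g.
Proof.
move=> uv vc L1 L2 E.
apply: affine_linear_between; first exact: lt_trans vc.
have gv : g v = g u + slope u v g * (v - u) by apply: L1; rewrite ltW ?lexx.
exists (slope u v g), (g u - slope u v g * u) => t.
rewrite /= in_itv /= => /andP[ut tc]; have [tv|vt] := leP t v.
  rewrite (L1 t) ?ut // -/(slope u v g); ring.
rewrite (L2 t) ?(ltW vt) // -/(slope v c g) -E gv; ring.
Qed.

(** The slope changes at every interior point of the partition, so that all of
    them are switchings. *)
Fixpoint kinked g t0 s : Prop :=
  if s is t :: s' then
    (if s' is t' :: _ then slope t0 t g <> slope t t' g else True) /\ kinked g t s'
  else True.

Lemma kinked_partition g t0 s : pl_partition g t0 s ->
  exists s', [/\ pl_partition g t0 s', last t0 s' = last t0 s & kinked g t0 s'].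
Proof.
elim: s t0 => [|t s IH] t0 /=; first by exists [::].
move=> [lt L /IH [[|t' s'] [P' <- K']]]; first by exists [:: t].
have [E|NE] := pselect (slope t0 t g = slope t t' g); last by exists [:: t, t' & s'].
case: P' => tt' L' P'; have Lc := linear_between_cat lt tt' L L' E.
exists (t' :: s'); split => //=; first by split => //; exact: lt_trans tt'.
case: K' => K' K''; split => //; case: s' K' {K'' P'} => // t'' s' K'.
rewrite -(linear_between_slope Lc (lexx _) lt (ltW tt')) E //.
Qed.

Lemma switches_at_kink g a t b : a < t < b -> linear_between a t g ->
  linear_between t b g -> slope a t g <> slope t b g -> switches_at g t.
Proof.
move=> /andP[at_ tb] L1 L2 NE [e e0 [c [d H]]]; apply: NE.
pose m := Num.min e (Num.min (t - a) (b - t)) / 2.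
have m0 : 0 < m by rewrite divr_gt0 // !lt_min e0 !subr_gt0 at_ tb.
have me : m < e.
  apply: lt_le_trans (_ : m * 2 <= e); first by rewrite mulr_natr mulr2n ltrDl.
  by rewrite /m divfK // ge_min lexx.
have ma : m < t - a.
  apply: lt_le_trans (_ : m * 2 <= t - a); first by rewrite mulr_natr mulr2n ltrDl.
  by rewrite /m divfK // !ge_min lexx orbT.
have mb : m < b - t.
  apply: lt_le_trans (_ : m * 2 <= b - t); first by rewrite mulr_natr mulr2n ltrDl.
  by rewrite /m divfK // !ge_min lexx !orbT.
have h1 : a <= t - m by lra.
have h2 : t - m < t by lra.
have h3 : t < t + m by lra.
have h4 : t + m <= b by lra.
rewrite -(linear_between_slope L1 h1 h2 (lexx _)).
rewrite -(linear_between_slope L2 (lexx _) h3 h4) /slope.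
have Hx x : t - e < x < t + e -> g x = c * x + d.
  by move=> xI; apply: H; rewrite /= in_itv.
rewrite !Hx; [|apply/andP; split; lra ..].
have ne : m != 0 by rewrite gt_eqF.
have -> : t - (t - m) = m by ring.
have -> : t + m - t = m by ring.
by field.
Qed.

Lemma kinked_cat g t0 s1 t s2 b : pl_partition g t0 (s1 ++ t :: b :: s2) ->
  kinked g t0 (s1 ++ t :: b :: s2) ->
  [/\ last t0 s1 < t < b, linear_between (last t0 s1) t g,
     linear_between t b g & slope (last t0 s1) t g <> slope t b g].
Proof.
elim: s1 t0 => [|r s1 IH] t0 /=.
  by move=> [h1 h2 [h3 h4 _]] [h5 _]; split; rewrite ?h1.
by move=> [_ _ P] [_ K]; exact: IH P K.
Qed.

Lemma mem_split (T : eqType) (x : T) (s : seq T) : x \in s ->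
  exists s1 s2 : seq T, s = s1 ++ x :: s2.
Proof. by case/splitPr => s1 s2; exists s1, s2. Qed.

Lemma graph_seq_split g s k1 q k2 : graph_seq g s = k1 ++ q :: k2 ->
  [/\ s = map fst k1 ++ q.1 :: map fst k2, k1 = graph_seq g (map fst k1),
    q = (q.1, g q.1) & k2 = graph_seq g (map fst k2)].
Proof.
move=> E; have sE : s = map fst k1 ++ q.1 :: map fst k2.
  have := congr1 (map fst) E; rewrite map_cat /= -map_comp => <-.
  by rewrite map_id.
move: E; rewrite {1}sE /graph_seq map_cat => /eqP.
rewrite eqseq_cat ?size_map // => /andP[/eqP E1 /eqP [E2 E3]].
by split; rewrite // ?E1 ?E3 // [q in LHS]surjective_pairing E2.
Qed.

(** An admissible path is the polyline through its switchings, which lie in the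
    configuration.  In the last clause, a vertex at the height of both its
    neighbours would not be a switching; this is what makes the kinetic energy
    depend on the time of each vertex. *)
Lemma kink_chain w t0 A0 t1 A1 g : t0 < t1 -> admissible w t0 A0 t1 A1 g ->
  exists k, [/\ path before (t0, g t0) (rcons k (t1, g t1)),
    {in k, forall q, w q},
    energy t0 t1 g = kinetic (t0, g t0) (rcons k (t1, g t1)),
    {in `[t0, t1], g =1 polyline (t0, g t0) (rcons k (t1, g t1))} &
    forall k1 q k2, k = k1 ++ q :: k2 ->
      ~ ((last (t0, g t0) k1).2 = q.2 /\ (head (t1, g t1) k2).2 = q.2)].
Proof.
move=> t01 adm; have [s0 P0 E0] := admissible_pl_path adm.
have [s1 [P1 E1 K1]] := kinked_partition P0.
case/lastP: s1 P1 E1 K1 => [|s t] P E K.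
  by move: t01; rewrite -E0 -E /= ltxx.
rewrite last_rcons E0 in E; subst t.
have Gr : graph_seq g (rcons s t1) = rcons (graph_seq g s) (t1, g t1).
  exact: map_rcons.
have H : path before (t0, g t0) (rcons (graph_seq g s) (t1, g t1)).
  by rewrite -Gr; exact: path_graph_seq.
have kink : forall r1 t r2, s = r1 ++ t :: r2 ->
   let a := last t0 r1 in let b := head t1 r2 in
   [/\ a < t < b, linear_between a t g,
     linear_between t b g & slope a t g <> slope t b g].
  move=> r1 t r2 sE; move: P K; rewrite sE rcons_cat /=.
  case: r2 {sE} => [|b r2] /=; exact: kinked_cat.
exists (graph_seq g s); split => //.
- move=> q qs; have /= qt := path_before_rcons H qs.
  move: qs => /mapP[t ts qE]; have [_ _ S _ _] := adm.
  have [r1 [r2 sE]] := mem_split ts.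
  have [h1 h2 h3 h4] := kink _ _ _ sE.
  rewrite qE /= in qt *; apply: S => //; exact: switches_at_kink h4.
- by rewrite -Gr -(energy_partition P) last_rcons.
- by have := pl_partition_polyline P; rewrite last_rcons Gr.
- move=> k1 q k2 /graph_seq_split [sE k1E qE k2E] [h1 h2].
  have [_ _ _] := kink _ _ _ sE; apply; rewrite /slope.
  have gq : g q.1 = q.2 by rewrite qE.
  have -> : g (last t0 [seq i.1 | i <- k1]) = q.2.
    by rewrite -h1 [in RHS]k1E last_graph_seq.
  have -> : g (head t1 [seq i.1 | i <- k2]) = q.2.
    by rewrite -h2 [in RHS]k2E; case: (k2).
  by rewrite gq subrr !mul0r.
Qed.

(** Two chains with the same ends have equal actions only if their kinetic
    energies differ by twice the difference of their numbers of points.  Such a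
    coincidence is accidental if some vertex [q] of one chain is not in the other
    one and is not at the height of both its neighbours: moving [q] in time then
    changes only one of the two energies. *)
Definition no_ties w : Prop :=
  forall e0 e1 k1 q k2 k (z : int), w e0 -> w e1 ->
    {in k1 ++ q :: k2, forall r, w r} -> {in k, forall r, w r} ->
    path before e0 (rcons (k1 ++ q :: k2) e1) ->
    path before e0 (rcons k e1) -> q \notin k ->
    ~ ((last e0 k1).2 = q.2 /\ (head e1 k2).2 = q.2) ->
    kinetic e0 (rcons (k1 ++ q :: k2) e1) - kinetic e0 (rcons k e1)
      <> 2 * z%:~R.

(** Two minimizers have equal actions; as there is no tie, each vertex of one of
    them is a vertex of the other one. *)
Lemma minimizers_unique w p e g h : no_ties w -> w p -> w e -> p.1 < e.1 ->
  minimizers w p.1 [set p.2] e.1 [set e.2] g ->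
  minimizers w p.1 [set p.2] e.1 [set e.2] h -> {in `[p.1, e.1], g =1 h}.
Proof.
move=> nt wp we pe [ag mg] [ah mh].
have [_ _ _ /= g0 g1] := ag; have [_ _ _ /= h0 h1] := ah.
have [k [Hk wk Ek Pk Sk]] := kink_chain pe ag.
have [l [Hl wl El Pl Sl]] := kink_chain pe ah.
rewrite g0 g1 -!surjective_pairing in Hk Ek Pk Sk.
rewrite h0 h1 -!surjective_pairing in Hl El Pl Sl.
have tie : exists z : int,
    kinetic p (rcons k e) - kinetic p (rcons l e) = 2 * z%:~R.
  have E : action w p.1 e.1 g = action w p.1 e.1 h.
    by apply/eqP; rewrite eq_le mg // mh.
  exists ((points_on_path w p.1 e.1 g)%:Z - (points_on_path w p.1 e.1 h)%:Z).
  rewrite rmorphB /= -!pmulrn; move: E; rewrite !actionE Ek El.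
  move: (kinetic p _) (kinetic p _) (points_on_path _ _ _ g)%:R.
  by move: ((points_on_path _ _ _ h)%:R : R) => N' a b N E; clear -E; lra.
suff kl : k = l by move=> t tI; rewrite Pk // Pl // kl.
have Hk' : path before p k by move: Hk; rewrite -cats1 cat_path => /andP[].
have Hl' : path before p l by move: Hl; rewrite -cats1 cat_path => /andP[].
apply: (path_before_eq Hk' Hl') => q; apply/idP/idP; apply: contraTT => qn.
  apply/negP => qk; have [k1 [k2 kE]] := mem_split qk.
  have [z] := tie; rewrite kE in Hk wk *.
  exact: (nt _ _ _ _ _ _ z wp we wk wl Hk Hl qn (Sk _ _ _ kE)).
apply/negP => ql; have [l1 [l2 lE]] := mem_split ql.
have [z zE] := tie; rewrite lE in Hl wl zE.
apply: (nt _ _ _ _ _ _ (- z) wp we wl wk Hl Hk qn (Sl _ _ _ lE)).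
by rewrite rmorphN /= mulrN -zE opprB.
Qed.

End ExistenceUniqueness.

(** * Good cells capture minimizers *)

Lemma three_quarters {R : realType} (c m s : nat) :
  (s + m = c)%N -> (4 * m <= c)%N -> 3 / 4 * c%:R <= s%:R :> R.
Proof.
move=> E H; have : (3 * c <= 4 * s)%N by lia.
by rewrite -(ler_nat R) !natrM; lra.
Qed.

Section Capture.
Context {R : realType}.
Variables (L x0 rad : R) (J : nat).
Implicit Types (g h : R -> R) (a b t u v y z D : R) (c : nat)
  (p q e : R * R) (k l s : seq (R * R)) (w : set (R * R)) (n m : int).

(** The cell [n] is centred at time [n * L] and has length [L]; its inner part
    leaves gaps of length [L / 2] between points of different cells. *)
Definition inner n : set (R * R) :=
  [set p | `|p.1 - n%:~R * L| <= L / 4 /\ `|p.2 - x0| <= 1].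

Definition hit w n : Prop := exists2 p, w p & inner n p.

Definition misses w n (c : nat) : nat :=
  \sum_(i < c) ~~ `[< hit w (n - 1 - i%:Z) >].

Definition zone n : set (R * R) :=
  [set p | (n%:~R - J%:R - 2^-1) * L <= p.1 <= (n%:~R + J%:R + 2^-1) * L].

(** A path that goes through the zone finds nothing else to visit there than one
    point per cell. *)
Definition exact_zone w n : Prop :=
  (forall p, w p -> zone n p -> exists2 m, `|m - n| <= J%:Z & inner m p) /\
  (forall m, `|m - n| <= J%:Z -> exists2 p, w p /\ inner m p &
     forall q, w q -> inner m q -> q = p).

Definition outer_left w n (c : nat) : set (R * R) :=
  w `&` [set p | (n%:~R - c%:R - 2^-1) * L <= p.1 <= (n%:~R - 2^-1) * L /\
                 rad < `|p.2|].

(** At every scale on the left most cells can be harvested and few points far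
    from the axis are available.  The ratios 1/4 and 1/8 leave to harvesting an
    advantage proportional to [c]. *)
Definition left_good w n : Prop := forall c : nat,
  (4 * misses w n c <= c)%N /\
  forall s, uniq s -> (forall p, p \in s -> outer_left w n c p) ->
    (8 * size s <= c)%N.

Definition reflect_time (p : R * R) : R * R := (- p.1, p.2).

(** The condition on the right is the one on the left after time reversal. *)
Definition good_cell w n : Prop :=
  [/\ exact_zone w n, left_good w n &
      left_good (reflect_time @^-1` w) (- n)].

(** A bound on the kinetic cost of joining, in time [L / 4] at least, a height
    bounded by [D] to an inner point. *)
Definition join_cost D : R := 2 * (D + `|x0| + 1) ^+ 2 / L.

Hypothesis L_ge : 32 <= L.
Hypothesis rad_ge : `|x0| + 1 <= rad.
Hypothesis J_ge : 2 * join_cost rad + 2 <= J%:R.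

Let L_gt0 : 0 < L. Proof. by apply: lt_le_trans L_ge. Qed.

Lemma inner_height n p : inner n p -> `|p.2| <= `|x0| + 1.
Proof.
move=> [_ h]; have -> : p.2 = x0 + (p.2 - x0) by ring.
by apply: (le_trans (ler_normD _ _)); rewrite lerD2l.
Qed.

Lemma inner_time n p : inner n p ->
  n%:~R * L - L / 4 <= p.1 <= n%:~R * L + L / 4.
Proof. by move=> [+ _]; rewrite ler_norml => /andP[h1 h2]; apply/andP; split; lra. Qed.

Lemma link_inner p q : L / 2 <= q.1 - p.1 -> `|p.2 - x0| <= 1 ->
  `|q.2 - x0| <= 1 -> link p q <= 8 / L.
Proof.
move=> gap hp hq; rewrite /link.
have d2 : (q.2 - p.2) ^+ 2 <= 4.
  have -> : q.2 - p.2 = (q.2 - x0) - (p.2 - x0) by ring.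
  move: hp hq; rewrite !ler_norml => /andP[h1 h2] /andP[h3 h4]; nra.
have g0 : 0 < q.1 - p.1 by apply: lt_le_trans gap; rewrite divr_gt0.
rewrite ler_pdivrMr //; apply: (le_trans d2).
have -> : 4 = 8 / L * (L / 2) :> R by field; rewrite gt_eqF.
by rewrite ler_wpM2l // divr_ge0 // ltW.
Qed.

Lemma misses_recr w n c :
  misses w n c.+1 = (misses w n c + ~~ `[< hit w (n - 1 - c%:Z) >])%N.
Proof. by rewrite /misses big_ord_recr. Qed.

(** Collecting a point in each hit cell costs at most [8 / L] of energy per point,
    as consecutive inner points are at least [L / 2] apart in time and differ by
    at most 2 in height. *)
Lemma harvest_chain w n p c : w p -> inner n p ->
  exists e s, [/\ path before e s, last e s = p,
    (forall q, q \in e :: s -> w q),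
    (size s + misses w n c = c)%N &
    [/\ (n%:~R - c%:R) * L - L / 4 <= e.1, `|e.2 - x0| <= 1 &
      kinetic e s <= (size s)%:R * (8 / L)]].
Proof.
move=> wp ip; elim: c => [|c [e [s [H1 H2 H3 H4 [H5 H6 H7]]]]].
  exists p, [::]; split => //=.
  - by move=> q; rewrite inE => /eqP ->.
  - by rewrite /misses big_ord0.
  split; rewrite ?mul0r //.
  - by rewrite subr0; have /andP[] := inner_time ip.
  - by case: ip.
have [hc|nhc] := pselect (hit w (n - 1 - c%:Z)); last first.
  exists e, s; split => //; first by rewrite misses_recr asboolF //= addn1 addnS H4.
  split => //; apply: le_trans H5; rewrite -[c.+1%:R]natr1 lerD2r.
  by rewrite ler_wpM2r ?(ltW L_gt0) // opprD addrA gerDl lerN10.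
have [q wq iq] := hc; have [_ hq] := iq.
have := inner_time iq; rewrite !rmorphB /= -pmulrn => /andP[q1 q2].
have gap : L / 2 <= e.1 - q.1 by lra.
have qe : before q e by rewrite /before -subr_gt0; apply: lt_le_trans gap; rewrite divr_gt0.
exists q, (e :: s); split => //=.
- by rewrite qe.
- by move=> r; rewrite inE => /predU1P[->//|/H3].
- by rewrite misses_recr asboolT //= addn0 addSn H4.
split => //.
- by rewrite -[c.+1%:R]natr1; lra.
- by rewrite -natr1 mulrDl mul1r addrC lerD // link_inner.
Qed.

(** At least 3/4 of the [c] cells are hit and each of their points brings 7/8 net
    of its kinetic cost since [32 <= L], whence the factor 21/32 = 3/4 * 7/8. *)
Lemma harvest_cost w n p c u y D : w p -> inner n p -> left_good w n ->
  u <= (n%:~R - c%:R - 2^-1) * L -> `|y| <= D ->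
  exists s, [/\ path before (u, y) (rcons s p), {in s, forall q, w q} &
    2^-1 * kinetic (u, y) (rcons s p) - (size s)%:R
      <= join_cost D - 21 / 32 * c%:R].
Proof.
move=> wp ip lg uc yD.
have [e [s [H1 H2 H3 H4 [H5 H6 H7]]]] := harvest_chain c wp ip.
have gap : L / 4 <= e.1 - u by lra.
have g0 : 0 < e.1 - u by apply: lt_le_trans gap; rewrite divr_gt0.
have l1 : 2^-1 * link (u, y) e <= join_cost D.
  have d2 : (e.2 - y) ^+ 2 <= (D + `|x0| + 1) ^+ 2.
    rewrite -[leLHS]real_normK ?num_real // lerXn2r ?nnegrE //.
      by rewrite !addr_ge0 // (le_trans _ yD).
    have -> : e.2 - y = - y + x0 + (e.2 - x0) by ring.
    apply: (le_trans (ler_normD _ _)); apply: lerD => //.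
    by apply: (le_trans (ler_normD _ _)); rewrite normrN lerD2r.
  rewrite /link /= mulrA ler_pdivrMr //.
  apply: (@le_trans _ _ (2^-1 * (D + `|x0| + 1) ^+ 2)).
    by rewrite ler_wpM2l // invr_ge0.
  apply: (@le_trans _ _ (join_cost D * (L / 4))).
    rewrite /join_cost; have -> : 2 * (D + `|x0| + 1) ^+ 2 / L * (L / 4) =
      2^-1 * (D + `|x0| + 1) ^+ 2 by field; rewrite gt_eqF.
    by [].
  rewrite ler_wpM2l // /join_cost mulr_ge0 ?invr_ge0 ?(ltW L_gt0) //.
  by rewrite mulr_ge0 ?sqr_ge0.
have [mc _] := lg c.
have sc := three_quarters H4 mc : 3 / 4 * c%:R <= (size s)%:R :> R.
have E : e :: s = rcons (belast e s) p by rewrite -H2 -lastI.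
exists (belast e s); rewrite -E size_belast; split.
- by rewrite /= H1 andbT /before /= -subr_gt0.
- by move=> q qs; apply: H3; exact: mem_belast.
- rewrite /= mulrDr.
  have k1 : 2^-1 * kinetic e s <= (size s)%:R / 8.
    apply: (@le_trans _ _ (2^-1 * ((size s)%:R * (8 / L)))).
      by rewrite ler_wpM2l // invr_ge0.
    have : 8 / L <= 4^-1 by rewrite ler_pdivrMr //; have := L_ge; lra.
    have : 0 <= (size s)%:R :> R by [].
    by move: (_%:R) (8 / L) => x y0 *; nra.
  lra.
Qed.

Lemma exact_zone_height w n p : exact_zone w n -> w p -> zone n p ->
  `|p.2| <= rad.
Proof.
move=> [H _] wp /(H _ wp)[m _ im].
exact: le_trans (inner_height im) rad_ge.
Qed.

Lemma inner_zone n p : inner n p -> zone n p.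
Proof.
move=> /inner_time /andP[h1 h2].
have J0 : 0 <= J%:R :> R by [].
rewrite /zone /=; apply/andP; split; nra.
Qed.

Definition passes_between w u v g q : Prop :=
  [/\ w q, u < q.1 < v & g q.1 = q.2].

(** If [g] only visits far points after [u], their number is at most 1/8 of the
    number [c] of cells up to [p], whereas harvesting brings [21 / 32 * c] and the
    cost of joining is smaller than [c / 2]. *)
Lemma left_leg_far w n p g u z E c1 : exact_zone w n ->
  left_good w n -> w p -> inner n p ->
  (J <= c1)%N -> 2 * join_cost E + 2 <= c1%:R ->
  u <= (n%:~R - c1%:R - 2^-1) * L -> `|z| <= E ->
  (forall q, passes_between w u p.1 g q -> rad < `|q.2|) ->
  exists s (k : nat), [/\ path before (u, z) (rcons s p),
    {in s, forall q, w q},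
    forall l, uniq l -> (forall q, q \in l -> passes_between w u p.1 g q) ->
      (size l <= k)%N &
    2^-1 * kinetic (u, z) (rcons s p) - (size s)%:R <= - (3 / 4) - k%:R].
Proof.
move=> ez lg wp ip Jc1 cE uc zE out.
have uL : u = u / L * L by rewrite divfK // gt_eqF.
(* the number of cells between [u] and the cell [n] is the integer part of [r] *)
pose r := n%:~R - 2^-1 - u / L.
have c1r : c1%:R <= r.
  have : u / L <= n%:~R - c1%:R - 2^-1 by rewrite ler_pdivrMr.
  by rewrite /r; clear; move: (c1%:R) (n%:~R) (u / L) => *; lra.
have /truncn_itv /andP[cr rc] : 0 <= r by apply: le_trans c1r.
have c1c : (c1 <= Num.truncn r)%N by rewrite truncn_ge_nat // (le_trans _ c1r).
move: (Num.truncn r) cr rc c1c => c cr rc c1c.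
have uc1 : u <= (n%:~R - c%:R - 2^-1) * L.
  rewrite uL ler_wpM2r ?(ltW L_gt0) //; move: cr; rewrite /r.
  by clear; move: (c%:R) (n%:~R) (u / L) => *; lra.
have uc2 : (n%:~R - c.+1%:R - 2^-1) * L <= u.
  rewrite uL ler_wpM2r ?(ltW L_gt0) //; move: rc; rewrite /r.
  by clear; move: (c.+1%:R) (n%:~R) (u / L) => *; lra.
have [s [H1 H2 H3]] := harvest_cost wp ip lg uc1 zE.
exists s, (c.+1 %/ 8)%N; split => //.
  move=> l ul lP; rewrite leq_divRL // mulnC; have [_ H] := lg c.+1.
  apply: H => // q /lP /[dup] /out rq [wq /andP[uq qp] gq]; split => //; split => //.
  rewrite (le_trans uc2 (ltW uq)) /=.
  rewrite leNgt; apply/negP => qz; move: rq; apply/negP; rewrite -leNgt.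
  apply: (exact_zone_height ez wq); rewrite /zone /=; apply/andP; split.
    apply: le_trans (ltW qz); rewrite ler_wpM2r ?(ltW L_gt0) // lerD2r.
    by rewrite gerDl oppr_le0.
  apply: (le_trans (ltW qp)); have /andP[_] := inner_zone ip; exact.
apply: (le_trans H3).
have k8 : (c.+1 %/ 8)%:R <= c.+1%:R / 8 :> R.
  rewrite ler_pdivlMr // -(natrM R _ 8) ler_nat; exact: leq_divM.
have cc : c1%:R <= c%:R :> R by rewrite ler_nat.
have c0 : 2 <= c%:R :> R.
  apply: le_trans cc; apply: le_trans cE; rewrite lerDr mulr_ge0 // /join_cost.
  by rewrite mulr_ge0 ?invr_ge0 ?(ltW L_gt0) // mulr_ge0 ?sqr_ge0.
move: k8; rewrite -[c.+1%:R]natr1; move: cE cc c0; clear.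
move: (join_cost E) (c1%:R : R) (c%:R : R) ((c.+1 %/ 8)%:R : R) => *; lra.
Qed.

Lemma last_visit w a b g : strip_finite w ->
  (forall q, passes_between w a b g q -> rad < `|q.2|) \/
  exists q, [/\ passes_between w a b g q, `|q.2| <= rad &
    forall r, passes_between w q.1 b g r -> rad < `|r.2|].
Proof.
move=> sf; have [l [_ _ lP]] := visited_seq a b g sf.
pose l' := [seq q <- l | [&& a < q.1, q.1 < b & `|q.2| <= rad]].
have l'P q : q \in l' <-> passes_between w a b g q /\ `|q.2| <= rad.
  rewrite mem_filter; split.
    by move=> /andP[/and3P[h1 h2 h3] /lP [wq [_ gq]]]; split => //; split; rewrite ?h1.
  move=> [[wq /andP[h1 h2] gq] h3]; rewrite h1 h2 h3 /=; apply/lP.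
  by split => //; split => //; rewrite !ltW.
case El : l' => [|q0 l1].
  left=> q qP; rewrite ltNge; apply/negP => qr.
  by have := (l'P q).2 (conj qP qr); rewrite El.
right; have [|q ql qmax] := @seq_min _ _ (fun q => - q.1) l' q0.
  by rewrite El mem_head.
have [qP qr] := (l'P q).1 ql; exists q; split => // r [wr /andP[qr1 rb] gr].
rewrite ltNge; apply/negP => rr; have [_ /andP[aq _] _] := qP.
have /qmax : r \in l'.
  by apply/l'P; split => //; split => //; rewrite rb (lt_trans aq).
by rewrite lerN2 leNgt qr1.
Qed.

(** The left half of a detour through the point [p] of a good cell starts where
    the path [g] last visited a point of height at most [rad], or at the initial
    time.  If this last visit is in the zone, it is at an inner point of another
    cell, no further point is visited, and a single link to [p] suffices. *)
Lemma left_leg w n p g t0 y D c0 : strip_finite w -> exact_zone w n ->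
  left_good w n -> w p -> inner n p ->
  2 * join_cost D + 2 <= c0%:R -> (J <= c0)%N ->
  t0 <= (n%:~R - c0%:R - 2^-1) * L -> `|y| <= D ->
  exists u z s (k : nat), [/\ path before (u, z) (rcons s p),
    {in s, forall q, w q},
    forall l, uniq l -> (forall q, q \in l -> passes_between w u p.1 g q) ->
      (size l <= k)%N &
    let cost := 2^-1 * kinetic (u, z) (rcons s p) - (size s)%:R in
    (t0 < u /\ z = g u /\ cost <= 4^-1 - k%:R) \/
    (u = t0 /\ z = y /\ cost <= - (3 / 4) - k%:R)].
Proof.
move=> sf ez lg wp ip c0D Jc0 t0c yD.
have [out|[q [[wq /andP[tq qp] gq] qr out]]] := last_visit t0 p.1 g sf.
  have [s [k [H1 H2 H3 H4]]] := left_leg_far ez lg wp ip Jc0 c0D t0c yD out.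
  by exists t0, y, s, k; split => //; right.
have [qz|zq] := leP q.1 ((n%:~R - J%:R - 2^-1) * L).
  have [s [k [H1 H2 H3 H4]]] :=
    left_leg_far ez lg wp ip (leqnn _) J_ge qz qr out.
  exists q.1, q.2, s, k; split => //; left; split => //; split => //.
  by apply: (le_trans H4); rewrite lerD2r; lra.
have qZ : zone n q.
  rewrite /zone /= (ltW zq) /= (le_trans (ltW qp)) //.
  by have /andP[] := inner_zone ip.
have [m _ im] := ez.1 _ wq qZ.
have [/andP[q1 q2] /andP[p1 p2]] := (inner_time im, inner_time ip).
have mn : m + 1 <= n.
  rewrite lezD1 ltNge le_eqVlt; apply/negP => /predU1P[nm|nm].
    have [|p'' _ pu] := ez.2 n; first by rewrite subrr.
    by move: qp; rewrite (pu p wp ip) (pu q wq) ?ltxx // nm.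
  have : (n + 1)%:~R <= m%:~R :> R by rewrite ler_int lezD1.
  rewrite rmorphD /=; move: q1 p2 qp L_gt0; clear.
  by move: (m%:~R) (n%:~R) => *; nra.
have gap : L / 2 <= p.1 - q.1.
  have : (m + 1)%:~R <= n%:~R :> R by rewrite ler_int.
  rewrite rmorphD /=; move: q2 p1 L_gt0; clear.
  by move: (m%:~R) (n%:~R) => *; nra.
exists q.1, q.2, [::], 0%N; split => //=.
- by rewrite andbT.
- move=> [//|r l] _ /(_ r (mem_head _ _)) rP; exfalso.
  have := out r rP; case: rP => wr /andP[qr1 rp] _; apply/negP; rewrite -leNgt.
  apply: (exact_zone_height ez wr); rewrite /zone /= (ltW (lt_trans zq qr1)) /=.
  by rewrite (le_trans (ltW rp)) //; have /andP[] := inner_zone ip.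
- left; split => //; split => //; rewrite addr0 !subr0 -surjective_pairing.
  have [_ h1] := im; have [_ h2] := ip.
  have := link_inner gap h1 h2.
  have : 8 / L <= 4^-1 by rewrite ler_pdivrMr //; have := L_ge; lra.
  clear; move: (link q p) (8 / L) => *; lra.
Qed.

Lemma reflect_timeK : involutive (@reflect_time).
Proof. by move=> p; rewrite /reflect_time /= opprK -surjective_pairing. Qed.

Lemma strip_finite_reflect w : strip_finite w ->
  strip_finite (reflect_time @^-1` w).
Proof.
move=> sf a b; have := finite_image reflect_time (sf (- b) (- a)).
apply: sub_finite_set => p [wp /andP[h1 h2]]; exists (reflect_time p).
  by split => //=; rewrite !lerN2 h1 h2.
exact: reflect_timeK.
Qed.

Lemma inner_reflect n p : inner (- n) (reflect_time p) <-> inner n p.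
Proof.
rewrite /inner /= rmorphN /= mulNr.
have -> : - p.1 - - (n%:~R * L) = - (p.1 - n%:~R * L) by ring.
by rewrite normrN.
Qed.

Lemma exact_zone_reflect w n : exact_zone w n ->
  exact_zone (reflect_time @^-1` w) (- n).
Proof.
move=> [ez1 ez2]; split.
  move=> p wp zp; have [|m mn im] := ez1 _ wp.
    move: zp; rewrite /zone /= rmorphN /= => /andP[h1 h2].
    by apply/andP; split; lra.
  exists (- m); first by rewrite -opprD normrN.
  by apply/inner_reflect; rewrite opprK.
move=> m mn; have [|p [wp ip] pu] := ez2 (- m).
  have -> : - m - n = - (m - - n) by ring.
  by rewrite normrN.
exists (reflect_time p).
  split; first by rewrite /= reflect_timeK.
  by have := inner_reflect (- m) p; rewrite opprK => -[_]; apply.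
move=> q wq iq; rewrite -(pu (reflect_time q)) ?reflect_timeK //.
exact/inner_reflect.
Qed.

Lemma reflect_chain p s e : path before (reflect_time e)
    (rcons s (reflect_time p)) ->
  path before p (rcons (rev (map reflect_time s)) e) /\
  kinetic p (rcons (rev (map reflect_time s)) e) =
    kinetic (reflect_time e) (rcons s (reflect_time p)).
Proof.
elim: s e => [|r s IH] e /=.
  rewrite /before /link /reflect_time /= !andbT ltrN2 => pe; split => //.
  by rewrite !addr0; congr (_ / _); ring.
move=> /andP[er H].
have rE : r = reflect_time (reflect_time r) by rewrite reflect_timeK.
rewrite rE in H; have [H1 H2] := IH _ H.
rewrite rev_cons rcons_path H1 last_rcons; split.
  by move: er; rewrite /before /reflect_time /= => er; rewrite ltrNl.
rewrite -[rcons (rcons _ _) e]cats1 kinetic_cat last_rcons H2 -rE /= addr0 addrC.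
congr (_ + _); rewrite /link /reflect_time /=.
have -> : e.1 - - r.1 = r.1 - - e.1 by ring.
by congr (_ / _); ring.
Qed.

(** Time reversal of [left_leg]. *)
Lemma right_leg w n p g t1 y D c0 : strip_finite w -> exact_zone w n ->
  left_good (reflect_time @^-1` w) (- n) -> w p -> inner n p ->
  2 * join_cost D + 2 <= c0%:R -> (J <= c0)%N ->
  (n%:~R + c0%:R + 2^-1) * L <= t1 -> `|y| <= D ->
  exists v z s (k : nat), [/\ path before p (rcons s (v, z)),
    {in s, forall q, w q},
    forall l, uniq l -> (forall q, q \in l -> passes_between w p.1 v g q) ->
      (size l <= k)%N &
    2^-1 * kinetic p (rcons s (v, z)) - (size s)%:R <= 4^-1 - k%:R /\
    (v < t1 /\ z = g v \/ v = t1 /\ z = y)].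
Proof.
move=> sf ez lg wp ip c0D Jc0 t1c yD.
have [|||u [z [s [k [H1 H2 H3 H4]]]]] := @left_leg (reflect_time @^-1` w)
  (- n) (reflect_time p) (g \o -%R) (- t1) y D c0 (strip_finite_reflect sf)
  (exact_zone_reflect ez) lg _ _ c0D Jc0 _ yD.
- by rewrite /= reflect_timeK.
- exact/inner_reflect.
- by rewrite rmorphN /=; lra.
have uE : (u, z) = reflect_time (- u, z) by rewrite /reflect_time /= opprK.
rewrite uE in H1; have [K1 K2] := reflect_chain H1.
exists (- u), z, (rev (map reflect_time s)), k; split => //.
- by move=> q; rewrite mem_rev => /mapP[r /H2 wr ->].
- move=> l ul lP; rewrite -(size_map reflect_time); apply: H3.
    by rewrite map_inj_uniq //; exact: can_inj reflect_timeK.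
  move=> q /mapP[r /lP [wr /andP[pr ru] gr] ->]; split.
  + by rewrite /= reflect_timeK.
  + by rewrite /= ltrN2 pr andbT ltrNr.
  + by rewrite /= opprK.
rewrite K2 size_rev size_map -uE; case: H4 => [[h1 [h2 h3]]|[h1 [h2 h3]]].
  by split => //; left; split; [rewrite ltrNl|rewrite h2].
split; last by right; rewrite h1 opprK.
by apply: (le_trans h3); rewrite lerD2r; lra.
Qed.

(** If the minimizer avoided the point of the cell, the detour made of the two
    legs would do better: they cost at most 1/4 each and collect this point in
    addition.  The ends have to be moderately high compared to their distance in
    time from the cell, for the legs to exist. *)
Theorem good_cell_capture w n p g t0 (A0 : set R) t1 (A1 : set R) y D c0 :
  strip_finite w -> good_cell w n -> w p -> inner n p ->
  2 * join_cost D + 2 <= c0%:R -> (J <= c0)%N ->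
  t0 <= (n%:~R - c0%:R - 2^-1) * L -> (n%:~R + c0%:R + 2^-1) * L <= t1 ->
  A0 y -> `|y| <= D -> `|g t1| <= D ->
  minimizers w t0 A0 t1 A1 g -> g p.1 = p.2.
Proof.
move=> sf [ez lg rg] wp ip c0D Jc0 t0c t1c A0y yD gD M.
apply: contrapT => gp.
have [u [z [s [k [H1 H2 H3 H4]]]]] := left_leg g sf ez lg wp ip c0D Jc0 t0c yD.
have [v [z' [s' [k' [H1' H2' H3' [H4' H5']]]]]] :=
  right_leg g sf ez rg wp ip c0D Jc0 t1c gD.
have z'E : z' = g v by case: H5' => [[]|[-> ->]].
have vt : v <= t1 by case: H5' => [[/ltW]|[->]].
have up := path_before_ends H1; have pv := path_before_ends H1'.
rewrite /= in up pv.
have tu : t0 <= u by case: H4 => [[/ltW]|[->]].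
have at_p q : w q -> q.1 = p.1 -> g q.1 <> q.2.
  move=> wq qp gq; have zq : zone n q.
    by have := inner_zone ip; rewrite /zone /= qp.
  have [m _ im] := ez.1 _ wq zq.
  have mn : m = n.
    have [/andP[q1 q2] /andP[p1 p2]] := (inner_time im, inner_time ip).
    rewrite qp in q1 q2; apply/eqP; rewrite eq_le; apply/andP; split; rewrite leNgt -lezD1;
      apply/negP; rewrite -(ler_int R) rmorphD /=; have := L_gt0;
      move: p1 p2 q1 q2; move: (m%:~R) (n%:~R) => *; nra.
  have [|r _ ru] := ez.2 n; first by rewrite subrr.
  rewrite mn in im; have qE : q = p by rewrite (ru q) // (ru p).
  by apply: gp; rewrite -qE.
(* what [g] visits between the ends of the detour, besides these ends, lies along
   one of the two legs *)
have count : (points_on_path w u v g <=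
    k + k' + (indicator w (u, g u) + indicator w (v, g v)))%N.
  apply: points_on_path_le => // l ul lP.
  pose f1 := [seq q <- l | (u < q.1) && (q.1 < p.1)].
  pose f2 := [seq q <- l | (p.1 < q.1) && (q.1 < v)].
  pose f3 := [seq q <- [:: (u, g u); (v, g v)] | `[< w q >]].
  have -> : (indicator w (u, g u) + indicator w (v, g v))%N = size f3.
    by rewrite size_filter /= addn0.
  have sub : {subset l <= f1 ++ f2 ++ f3}.
    move=> q ql; have [wq [/andP[uq qv] gq]] := lP q ql.
    rewrite !mem_cat !mem_filter ql !inE (asboolT wq) /= !andbT.
    move: uq; rewrite le_eqVlt => /predU1P[uq|->].
      by rewrite [q]surjective_pairing -gq -uq eqxx !orbT.
    move: qv; rewrite le_eqVlt => /predU1P[qv|->].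
      by rewrite [q]surjective_pairing -gq qv eqxx !orbT.
    rewrite andbT; have [//|//|qp] := ltgtP q.1 p.1.
    by case: (at_p q wq qp gq).
  apply: (leq_trans (uniq_leq_size ul sub)).
  rewrite !size_cat addnA leq_add2r leq_add //.
    apply: H3; first exact: filter_uniq.
    by move=> q; rewrite mem_filter => /andP[h /lP[? [_ ?]]]; split.
  apply: H3'; first exact: filter_uniq.
  by move=> q; rewrite mem_filter => /andP[h /lP[? [_ ?]]]; split.
have chain : path before (u, z) (rcons (s ++ p :: s') (v, g v)).
  rewrite rcons_cat cat_path /=; move: H1; rewrite rcons_path => /andP[-> ->] /=.
  by move: H1'; rewrite z'E.
have inw : {in s ++ p :: s', forall q, w q}.
  move=> q; rewrite mem_cat inE => /orP[/H2//|/predU1P[->//|/H2'//]].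
have Muv : minimizers w u (if u == t0 then A0 else [set g u]) v [set g v] g.
  have tv : t0 < v <= t1 by rewrite vt (le_lt_trans tu) // (lt_trans up).
  have M' := minimizers_restrict_right sf tv M.
  case: eqP => [->//|_]; apply: minimizers_restrict_left M' => //.
  by rewrite tu (lt_trans up).
have Az : (if u == t0 then A0 else [set g u]) z.
  case: H4 => [[tu' [-> _]]|[-> [-> _]]]; last by rewrite eqxx.
  by rewrite gt_eqF.
have := minimizer_le_chain sf Muv Az chain inw.
have E0 : 0 <= energy u v g.
  by have [adm _] := Muv; exact: energy_ge0 (admissible_pl_path adm).
have KE : kinetic (u, z) (rcons (s ++ p :: s') (v, g v)) =
    kinetic (u, z) (rcons s p) + kinetic p (rcons s' (v, g v)).
  rewrite rcons_cat rcons_cons -cat_rcons kinetic_cat last_rcons.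
  by [].
rewrite {}KE size_cat /= -z'E.
move: count H4 H4'; rewrite -(ler_nat R) !natrD /=.
move=> count H4 H4'.
have iz : (indicator w (u, g u))%:R <= 1 :> R by rewrite /indicator; case: asbool.
have iz0 : 0 <= (indicator w (u, z))%:R :> R by [].
have izu : t0 < u /\ z = g u -> indicator w (u, z) = indicator w (u, g u).
  by move=> [_ ->].
rewrite z'E -[(size s').+1%:R]natr1 -z'E.
case: H4 => [[h1 [h2 h3]]|[h1 [h2 h3]]].
  rewrite (izu (conj h1 h2)) => le; move: le count H4' h3 E0; rewrite z'E.
  move: (kinetic _ _) (kinetic _ _) (energy _ _ _) (points_on_path _ _ _ _)%:R.
  move: ((size s)%:R : R) ((size s')%:R : R) (k%:R : R) (k'%:R : R) => a1 a2 a3 a4.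
  move: ((indicator w (u, g u))%:R : R) ((indicator w (v, g v))%:R : R) => a5 a6 a7 a8 a9 a10 *.
  lra.
move=> le; move: le count H4' h3 E0 iz iz0; rewrite z'E.
move: (kinetic _ _) (kinetic _ _) (energy _ _ _) (points_on_path _ _ _ _)%:R.
move: ((size s)%:R : R) ((size s')%:R : R) (k%:R : R) (k'%:R : R) => a1 a2 a3 a4.
move: ((indicator w (u, g u))%:R : R) ((indicator w (v, g v))%:R : R) => a5 a6.
move: ((indicator w (u, z))%:R : R) => a7 a8 a9 a10 a11 *.
lra.
Qed.

End Capture.

(** * The recurrent minimizer of a configuration with good cells *)

Section Deterministic.
Context {R : realType}.
Variables (L x0 rad : R) (J : nat).
Implicit Types (g h : R -> R) (t u v y z D : R)
  (p q e : R * R) (w : set (R * R)) (a b n m : int).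

Hypothesis L_ge : 32 <= L.
Hypothesis rad_ge : `|x0| + 1 <= rad.
Hypothesis J_ge : 2 * join_cost L x0 rad + 2 <= J%:R.

Lemma spaced_sequence (S : int -> Prop) (c : nat) :
  (forall N : int, exists n : int, N <= n /\ S n) ->
  exists f : nat -> int, forall k : nat,
    [/\ S (f k), k%:Z <= f k & f k + c.+1%:Z <= f k.+1].
Proof.
move=> /choice [up upP].
pose f := fix f (k : nat) := if k is k'.+1 then up (f k' + c.+1%:Z) else up 0.
exists f => k; split; first by case: k => [|k] /=; exact: (upP _).2.
- elim: k => [|k IH] /=; first exact: (upP _).1.
  by apply: le_trans (upP _).1; lia.
- exact: (upP _).1.
Qed.

Definition marked w n p : Prop :=
  [/\ good_cell L x0 rad J w n, w p & inner L x0 n p].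

Lemma good_cell_marked w n : good_cell L x0 rad J w n -> exists p, marked w n p.
Proof.
move=> /[dup] gc [[_ ez] _ _]; have [|p [wp ip] _] := ez n; first by rewrite subrr.
by exists p.
Qed.

(** The points of good cells have bounded heights, so that [J] cells of distance
    are enough for [good_cell_capture]. *)
Lemma marked_capture w g a A b B n p : strip_finite w ->
  marked w a A -> marked w b B -> marked w n p ->
  a + J.+1%:Z <= n -> n + J.+1%:Z <= b ->
  minimizers w A.1 [set A.2] B.1 [set B.2] g -> g p.1 = p.2.
Proof.
move=> sf [_ _ iA] [_ _ iB] [gc wp ip] an nb M.
have [_ _ _ /= gA gB] := M.1.
have L0 : 0 < L by apply: lt_le_trans L_ge.
have hA := le_trans (inner_height iA) rad_ge.
have hB := le_trans (inner_height iB) rad_ge.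
apply: (good_cell_capture L_ge rad_ge J_ge sf gc wp ip J_ge (leqnn _) _ _ _ hA _ M) => //=.
- have /andP[_ h] := inner_time iA; apply: (le_trans h).
  have : (a + J.+1%:Z)%:~R <= n%:~R :> R by rewrite ler_int.
  rewrite rmorphD /= -pmulrn -[J.+1%:R]natr1.
  move: (a%:~R : R) (n%:~R : R) (J%:R : R) => *; nra.
- have /andP[h _] := inner_time iB; apply: le_trans h.
  have : (n + J.+1%:Z)%:~R <= b%:~R :> R by rewrite ler_int.
  rewrite rmorphD /= -pmulrn -[J.+1%:R]natr1.
  move: (b%:~R : R) (n%:~R : R) (J%:R : R) => *; nra.
- by rewrite gB.
Qed.

Lemma marked_lt w n m p q : marked w n p -> marked w m q -> n < m -> p.1 < q.1.
Proof.
move=> [_ _ ip] [_ _ iq] nm.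
have L0 : 0 < L by apply: lt_le_trans L_ge.
have /andP[_ h1] := inner_time ip; have /andP[h2 _] := inner_time iq.
have : (n + 1)%:~R <= m%:~R :> R by rewrite ler_int lezD1.
rewrite rmorphD /=; move: (m%:~R : R) (n%:~R : R) h1 h2 => *; nra.
Qed.

Lemma enough_cells D : exists c : nat, 2 * join_cost L x0 D + 2 <= c%:R /\ (J <= c)%N.
Proof.
exists (J + (Num.truncn (2 * join_cost L x0 D + 2)).+1)%N; split; last exact: leq_addr.
by apply: le_trans (ltW (truncnS_gt _)) _; rewrite ler_nat leq_addl.
Qed.

Lemma global_minimizer_marked w g n p : strip_finite w ->
  global_minimizer w g -> recurrent g -> marked w n p -> g p.1 = p.2.
Proof.
move=> sf gm [r [t [r0 tp tn tr]]] [gc wp ip].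
have [c [cD Jc]] := enough_cells r; have L0 : 0 < L by apply: lt_le_trans L_ge.
have [k [k1 k2]] : exists k : nat, (n%:~R + c%:R + 2^-1) * L <= t k%:Z /\
    t (- k%:Z) <= (n%:~R - c%:R - 2^-1) * L.
  have h1 : \forall k \near \oo, (n%:~R + c%:R + 2^-1) * L <= t k%:Z.
    by move/cvgryPge : tp; apply.
  have h2 : \forall k \near \oo, t (- k%:Z) <= (n%:~R - c%:R - 2^-1) * L.
    by move/cvgrNyPle : tn; apply.
  have [k [? ?]] := filter_ex (filterI h1 h2).
  by exists k.
have t01 : t (- k%:Z) < t k%:Z.
  apply: le_lt_trans k2 (lt_le_trans _ k1); rewrite ltr_pM2r //.
  have : 0 <= c%:R :> R by [].
  move: (c%:R : R) (n%:~R : R) => *; lra.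
apply: (good_cell_capture L_ge rad_ge J_ge sf gc wp ip cD Jc k2 k1 _ _ _ (gm _ _ t01)) => //=.
  by rewrite ler_norml; exact: tr.
by rewrite ler_norml; exact: tr.
Qed.

(** The initial points of the finite-time minimizers are free: in
    [good_cell_capture] the detour may start at height [x0] at any initial time. *)
Lemma one_sided_marked w g : strip_finite w -> one_sided_minimizer w g ->
  exists N : int, forall T : R, T <= 0 -> exists2 h : R -> R,
    (exists t0 : R, t0 <= T /\ minimizers w t0 [set: R] 0 [set g 0] h) &
    (forall s, T <= s <= 0 -> g s = h s) /\
    forall n p, n <= N -> T <= p.1 -> marked w n p ->  h p.1 = p.2.
Proof.
move=> sf os.
pose D := `|x0| + `|g 0|; have [c [cD Jc]] := enough_cells D.
have L0 : 0 < L by apply: lt_le_trans L_ge.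
exists (- c.+1%:Z) => T T0.
have s0 : 0 < 1 - T by lra.
have h1 := os _ s0.
have h2 : \forall t \near +oo, - T + (c%:R + 3) * L <= t by apply: nbhs_pinfty_ge; exact: num_real.
have [t [[h M gh] tT]] := filter_ex (filterI h1 h2).
have cL : 0 <= c%:R * L by rewrite mulr_ge0 // ltW.
exists h.
  exists (- t); split => //; move: tT cL L0; move: (c%:R : R) => *; nra.
split; first by move=> s /andP[s1 s2]; apply: gh; apply/andP; split; lra.
move=> n p nN Tp [gc wp ip].
have h0 : h 0 = g 0 by have [[_ _ _ _ /= ->] _] := M.
apply: (good_cell_capture L_ge rad_ge J_ge sf gc wp ip cD Jc _ _ (I : [set: R] x0) _ _ M).
- have /andP[_ p2] := inner_time ip.
  have : - t <= T - (c%:R + 3) * L by lra.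
  move=> le; apply: (le_trans le).
  move: Tp p2 L0; move: (c%:R : R) (n%:~R : R) => *; nra.
- have : n%:~R <= (- c.+1%:Z)%:~R :> R by rewrite ler_int.
  rewrite rmorphN /= -pmulrn -[c.+1%:R]natr1 => le.
  move: le L0; move: (c%:R : R) (n%:~R : R) => *; nra.
- by rewrite /D lerDl.
- by rewrite h0 /D lerDr.
Qed.

(** Minimizers between the points of distant good cells pass through the points
    of the good cells in between, where uniqueness makes them agree; their union
    is the global minimizer.  The other minimizers are compared with it between
    the points of good cells that they are forced to visit as well. *)
Theorem recurrent_minimizer_of_good_cells w : strip_finite w -> no_ties w ->
  (forall N : int, exists n : int, N <= n /\ good_cell L x0 rad J w n) ->
  (forall N : int, exists n : int, n <= N /\ good_cell L x0 rad J w n) ->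
  exists g : R -> R,
    [/\ global_minimizer w g /\ recurrent g,
        forall g' : R -> R,
          global_minimizer w g' -> recurrent g' -> g' = g &
        forall gt : R -> R, one_sided_minimizer w gt ->
          exists2 tau : R, tau < 0 & forall s, s <= tau -> g s = gt s].
Proof.
move=> sf nt Gp Gn.
have L0 : 0 < L by apply: lt_le_trans L_ge.
have [b bP] := spaced_sequence J Gp.
have Gn' : forall N : int, exists n : int, N <= n /\ good_cell L x0 rad J w (- 1 - n).
  move=> N; have [n [nN gn]] := Gn (- 1 - N); exists (- 1 - n); split; first by lia.
  by have -> : - 1 - (- 1 - n) = n by lia.
have [a' aP'] := spaced_sequence J Gn'.
pose a k := - 1 - a' k.
have aP k : [/\ good_cell L x0 rad J w (a k), a k <= - 1 - k%:Z &
    a k.+1 + J.+1%:Z <= a k].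
  by have [h1 h2 h3] := aP' k; rewrite /a; split => //; lia.
have /choice[B mB] : forall k, exists p, marked w (b k) p.
  by move=> k; have [/good_cell_marked] := bP k.
have /choice[A mA] : forall k, exists p, marked w (a k) p.
  by move=> k; have [/good_cell_marked] := aP k.
have amono k k' : (k <= k')%N -> a k' <= a k.
  elim: k' => [|k' IH]; first by rewrite leqn0 => /eqP ->.
  rewrite leq_eqVlt => /predU1P[->//|/IH le]; apply: le_trans le.
  by have [_ _] := aP k'; lia.
have ab k k' : a k < b k'.
  by have [_ h _] := aP k; have [_ h' _] := bP k'; lia.
have AB k k' : (A k).1 < (B k').1 by exact: marked_lt (mA k) (mB k') (ab k k').
have Alow k : (0 < k)%N -> (A k).1 <= - k%:R.
  move=> k0; have [_ ak _] := aP k; have [_ _ iA] := mA k.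
  have /andP[_ h] := inner_time iA; apply: (le_trans h).
  have : (a k)%:~R <= (- 1 - k%:Z)%:~R :> R by rewrite ler_int.
  have k0' : 0 <= k%:R :> R by [].
  have -> : (- 1 - k%:Z)%:~R = - (1 + k%:R) :> R.
    by rewrite -opprD rmorphN rmorphD.
  move: (k%:R : R) ((a k)%:~R : R) k0' L_ge => *; nra.
have Bhigh k : (0 < k)%N -> k%:R <= (B k).1.
  move=> k0; have [_ bk _] := bP k; have [_ _ iB] := mB k.
  have /andP[h _] := inner_time iB; apply: le_trans h.
  have : (k%:Z)%:~R <= (b k)%:~R :> R by rewrite ler_int.
  have k0' : 1 <= k%:R :> R by rewrite ler1n.
  rewrite -pmulrn; move: (k%:R : R) ((b k)%:~R : R) k0' L_ge => *; nra.
have /choice[G GP] : forall k, exists g,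
    minimizers w (A k).1 [set (A k).2] (B k).1 [set (B k).2] g.
  by move=> k; exact: minimizers_exist.
have agree k g h : minimizers w (A k).1 [set g (A k).1] (B k).1 [set g (B k).1] g ->
    minimizers w (A k).1 [set h (A k).1] (B k).1 [set h (B k).1] h ->
    g (A k).1 = (A k).2 -> g (B k).1 = (B k).2 ->
    h (A k).1 = (A k).2 -> h (B k).1 = (B k).2 -> {in `[(A k).1, (B k).1], g =1 h}.
  move=> Mg Mh gA gB hA hB; rewrite gA gB in Mg; rewrite hA hB in Mh.
  by have [[_ wA _] [_ wB _]] := (mA k, mB k); exact: minimizers_unique Mg Mh.
have GA k : G k (A k).1 = (A k).2 by have [[_ _ _ /= -> _] _] := GP k.
have GB k : G k (B k).1 = (B k).2 by have [[_ _ _ _ /= ->] _] := GP k.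
have GP' k : minimizers w (A k).1 [set G k (A k).1] (B k).1 [set G k (B k).1] (G k).
  by rewrite GA GB.
have A_succ k : (A k.+1).1 < (A k).1.
  by apply: marked_lt (mA k.+1) (mA k) _; have [_ _] := aP k; lia.
have B_succ k : (B k).1 < (B k.+1).1.
  by apply: marked_lt (mB k) (mB k.+1) _; have [_ _] := bP k; lia.
have step k : {in `[(A k).1, (B k).1], G k.+1 =1 G k}.
  apply: agree => //.
  - exact: (minimizers_restrict sf (ltW (A_succ k)) (AB k k) (ltW (B_succ k)) (GP k.+1)).
  - apply: (marked_capture sf (mA k.+1) (mB k.+1) (mA k) _ _ (GP k.+1)).
      by have [] := aP k.
    by have := ab k k.+1; have [_ _ h] := bP k.+1; have := ab k k; have [_ _] := bP k; lia.
  - apply: (marked_capture sf (mA k.+1) (mB k.+1) (mB k) _ _ (GP k.+1)).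
      by have := ab k k; have [_ _] := aP k; lia.
    by have [] := bP k.
have Asub k k' : (k <= k')%N -> (A k').1 <= (A k).1.
  elim: k' => [|k' IH]; first by rewrite leqn0 => /eqP ->.
  rewrite leq_eqVlt => /predU1P[->//|/IH le]; exact: le_trans (ltW (A_succ k')) le.
have Bsub k k' : (k <= k')%N -> (B k).1 <= (B k').1.
  elim: k' => [|k' IH]; first by rewrite leqn0 => /eqP ->.
  rewrite leq_eqVlt => /predU1P[->//|/IH le]; exact: le_trans le (ltW (B_succ k')).
have steps k k' : (k <= k')%N -> {in `[(A k).1, (B k).1], G k' =1 G k}.
  elim: k' => [|k' IH]; first by rewrite leqn0 => /eqP ->.
  rewrite leq_eqVlt => /predU1P[->//|]; rewrite ltnS => kk' t tI.
  rewrite -IH // step //; move: tI; rewrite !in_itv /= => /andP[h1 h2].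
  by rewrite (le_trans (Asub _ _ kk')) //= (le_trans h2) // Bsub.
have inside k t : (0 < k)%N -> `|t| <= k%:R -> t \in `[(A k).1, (B k).1].
  move=> k0; rewrite ler_norml in_itv /= => /andP[h1 h2].
  by rewrite (le_trans (Alow k k0) h1) (le_trans h2) // Bhigh.
(* the G k extend one another, so any k with |t| <= k gives the same value *)
pose g t := G (Num.truncn `|t|).+1 t.
have gG k t : (0 < k)%N -> `|t| <= k%:R -> g t = G k t.
  move=> k0 tk; have tm : `|t| <= (Num.truncn `|t|).+1%:R by exact/ltW/truncnS_gt.
  rewrite /g; have [mk|/ltnW km] := leqP (Num.truncn `|t|).+1 k.
    by rewrite (steps _ _ mk) //; exact: inside.
  by rewrite (steps _ _ km) //; exact: inside.
have bound t0 t1 : exists k, [/\ (0 < k)%N, `|t0| <= k%:R & `|t1| <= k%:R].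
  exists (Num.truncn (Num.max `|t0| `|t1|)).+1; split => //.
    by apply: le_trans (ltW (truncnS_gt _)); rewrite le_max lexx.
  by apply: le_trans (ltW (truncnS_gt _)); rewrite le_max lexx orbT.
have gmin : global_minimizer w g.
  move=> t0 t1 t01; have [k [k0 t0k t1k]] := bound t0 t1.
  have [i0 i1] := (inside k t0 k0 t0k, inside k t1 k0 t1k).
  have gk t : t0 <= t <= t1 -> g t = G k t.
    move=> /andP[h1 h2]; apply: gG => //; move: t0k t1k; rewrite !ler_norml.
    by move=> /andP[h3 h4] /andP[h5 h6]; apply/andP; split; lra.
  rewrite (gk t0) ?lexx ?(ltW t01) // (gk t1) ?lexx ?(ltW t01) //.
  apply: (@eq_minimizers _ w t0 _ t1 _ (G k) g (ltW t01)).
    by move=> t; rewrite in_itv /= => /gk.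
  move: i0 i1; rewrite !in_itv /= => /andP[i0 _] /andP[_ i1].
  exact: (minimizers_restrict sf i0 t01 i1 (GP k)).
have gA k : g (A k).1 = (A k).2.
  have [k' [k'0 h1 h2]] := bound (A k).1 k%:R.
  rewrite (gG k') // (steps k k') ?GA // ?in_itv /= ?lexx ?(ltW (AB k k)) //.
  by rewrite -(ler_nat R) (le_trans _ h2) // normr_nat.
have gB k : g (B k).1 = (B k).2.
  have [k' [k'0 h1 h2]] := bound (B k).1 k%:R.
  rewrite (gG k') // (steps k k') ?GB // ?in_itv /= ?lexx ?(ltW (AB k k)) //.
  by rewrite -(ler_nat R) (le_trans _ h2) // normr_nat.
exists g; split.
- split => //; exists rad, (fun i => match i with Posz k => (B k).1 | Negz k => (A k).1 end).
  split.
  + by apply: lt_le_trans rad_ge; rewrite ltr_wpDl.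
  + apply/cvgryPge => M; have [k [k0 _ Mk]] := bound 0 M.
    exists k => // k' /= kk'; apply: le_trans (Bhigh k' _); last exact: leq_trans kk'.
    apply: le_trans (ler_norm M) _; apply: (le_trans Mk); by rewrite ler_nat.
  + apply/cvgrNyPle => M; have [k [k0 _ Mk]] := bound 0 M.
    exists k.+1 => // -[//|k'] /=; rewrite ltnS => kk'.
    apply: (le_trans (Alow k' _)); first exact: leq_trans k0 kk'.
    rewrite lerNl; apply: le_trans (ler_norm _) _; rewrite normrN.
    by apply: (le_trans Mk); rewrite ler_nat.
  + move=> [k|k]; rewrite -ler_norml ?gA ?gB.
      by have [_ _ i] := mB k; exact: le_trans (inner_height i) rad_ge.
    by have [_ _ i] := mA k; exact: le_trans (inner_height i) rad_ge.
- move=> g' gm' rec'; apply/funext => t.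
  have [k [k0 tk _]] := bound t t; have tI := inside k t k0 tk.
  have g'm := global_minimizer_marked sf gm' rec'.
  apply: (agree k) tI => //; first exact: gm' (AB k k).
  + exact: gmin (AB k k).
  + exact: g'm (mA k).
  + exact: g'm (mB k).
- move=> gt os; have [N NP] := one_sided_marked sf os.
  have [j [j0 _ jN]] := bound 0 N%:~R.
  have aN k : (j <= k)%N -> a k <= N.
    move=> jk; have [_ ak _] := aP k; apply: (le_trans ak).
    move: jN; rewrite ler_norml => /andP[h _].
    have : (- j%:Z)%:~R <= N%:~R :> R by rewrite rmorphN /= -pmulrn.
    by rewrite ler_int; move: jk; lia.
  exists (A j).1; first by apply: (le_lt_trans (Alow j j0)); rewrite oppr_lt0 ltr0n.
  move=> s sA; have [k [k0 _ sk]] := bound 0 s.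
  pose i := maxn k j.+1.
  have i0 : (0 < i)%N by rewrite /i leq_max k0.
  have ji : (j < i)%N by rewrite /i leq_max leqnn orbT.
  have Ai : (A i).1 <= s.
    apply: (le_trans (Alow i i0)); move: sk; rewrite ler_norml => /andP[h _].
    apply: le_trans h; rewrite lerN2 ler_nat; exact: leq_maxl.
  have Aj0 : (A j).1 <= 0 by apply: (le_trans (Alow j j0)); rewrite oppr_le0.
  have Aij : (A i).1 < (A j).1.
    by apply: marked_lt (mA i) (mA j) _; have := amono _ _ ji; have [_ _] := aP j; lia.
  have [h [t0 [t0A Mh]] [gh hm]] := NP _ (le_trans Ai (le_trans sA Aj0)).
  have hi := hm _ _ (aN i (ltnW ji)) (lexx _) (mA i).
  have hj := hm _ _ (aN j (leqnn _)) (ltW Aij) (mA j).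
  have M1 := minimizers_restrict sf t0A Aij Aj0 Mh.
  rewrite hi hj in M1.
  have M2 := gmin _ _ Aij; rewrite !gA in M2.
  have [[_ wi _] [_ wj _]] := (mA i, mA j).
  rewrite (minimizers_unique nt wi wj Aij M2 M1) ?in_itv /= ?Ai //.
  by rewrite gh // Ai /= (le_trans sA).
Qed.

End Deterministic.

(** * Probabilities and Poisson counts *)

Section RealProbability.
Context {d : measure_display} {T : measurableType d} {R : realType}.
Variable P : probability T R.
Implicit Types A B : set T.

Definition pr A : R := fine (P A).

Lemma prE A : measurable A -> P A = (pr A)%:E.
Proof. by move=> mA; rewrite /pr fineK // fin_num_measure. Qed.

Lemma pr_ge0 A : 0 <= pr A.
Proof. exact: fine_ge0. Qed.

Lemma pr_le A B : measurable A -> measurable B -> A `<=` B -> pr A <= pr B.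
Proof.
by move=> mA mB AB; rewrite -lee_fin -!prE // le_measure ?inE.
Qed.

Lemma pr_setT : pr setT = 1.
Proof. by rewrite /pr probability_setT. Qed.

Lemma pr_le1 A : measurable A -> pr A <= 1.
Proof. by move=> mA; rewrite -pr_setT; apply: pr_le. Qed.

Lemma pr_setC A : measurable A -> pr (~` A) = 1 - pr A.
Proof.
by move=> mA; apply: EFin_inj; rewrite EFinB -!prE ?probability_setC //; exact: measurableC.
Qed.

Lemma pr_setU_disj A B : measurable A -> measurable B -> A `&` B = set0 ->
  pr (A `|` B) = pr A + pr B.
Proof.
move=> mA mB AB; apply: EFin_inj; rewrite EFinD -!prE ?measureU //.
exact: measurableU.
Qed.

Lemma pr_setU A B : measurable A -> measurable B ->
  pr (A `|` B) <= pr A + pr B.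
Proof.
move=> mA mB; have mU := measurableU _ _ mA mB.
by rewrite -lee_fin EFinD -!prE // measureU2.
Qed.

Lemma pr_setDI A B : measurable A -> measurable B ->
  pr A = pr (A `\` B) + pr (A `&` B).
Proof.
move=> mA mB; have mI : measurable (A `&` B) by exact: measurableI.
have mD : measurable (A `\` B) by exact: measurableD.
by apply: EFin_inj; rewrite EFinD -!prE // -measureDI.
Qed.

Lemma exists_cons (I : eqType) (i : I) (s : seq I) (F : I -> set T) :
  [set w | exists2 j, j \in i :: s & F j w] =
  F i `|` [set w | exists2 j, j \in s & F j w].
Proof.
apply/seteqP; split=> w /=.
  by move=> [j]; rewrite inE => /predU1P[->|js] Fj; [left|right; exists j].
move=> [Fi|[j js Fj]]; first by exists i => //; exact: mem_head.
by exists j => //; rewrite inE js orbT.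
Qed.

Lemma measurable_exists_seq (I : eqType) (s : seq I) (F : I -> set T) :
  (forall i, measurable (F i)) ->
  measurable [set w | exists2 i, i \in s & F i w].
Proof.
move=> mF; elim: s => [|i s IH]; last by rewrite exists_cons; exact: measurableU.
by rewrite (_ : mkset _ = set0) // -subset0 => w [].
Qed.

Lemma pr_exists_seq (I : eqType) (s : seq I) (F : I -> set T) :
  (forall i, measurable (F i)) ->
  pr [set w | exists2 i, i \in s & F i w] <= \sum_(i <- s) pr (F i).
Proof.
move=> mF; elim: s => [|i s IH].
  rewrite big_nil (_ : mkset _ = set0) /pr ?measure0 //.
  by rewrite -subset0 => w [].
rewrite exists_cons big_cons.
apply: (le_trans (pr_setU (mF i) (measurable_exists_seq s mF))).
by rewrite lerD2l.
Qed.

Lemma pr_exists_disjoint (F : nat -> set T) n :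
  (forall i, measurable (F i)) -> (forall i j w, F i w -> F j w -> i = j) ->
  pr [set w | exists2 i, (i < n)%N & F i w] = \sum_(i < n) pr (F i) /\
  measurable [set w | exists2 i, (i < n)%N & F i w].
Proof.
move=> mF disj; elim: n => [|n [IH m]].
  rewrite big_ord0 (_ : mkset _ = set0) /pr ?measure0 //.
  by rewrite -subset0 => w [].
have -> : [set w | exists2 i, (i < n.+1)%N & F i w] =
    [set w | exists2 i, (i < n)%N & F i w] `|` F n.
  apply/seteqP; split=> w /=.
    move=> [i]; rewrite ltnS leq_eqVlt => /predU1P[->|iltn] Fi; first by right.
    by left; exists i.
  by move=> [[i iltn Fi]|Fn]; [exists i => //; exact: ltnW|exists n].
split; last exact: measurableU.
rewrite big_ord_recr /= -IH -pr_setU_disj // -subset0 => w [/= [i iltn Fi] Fn].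
by move: iltn; rewrite (disj i n w) // ltnn.
Qed.

(** Inclusion and exclusion, one event at a time: the product rule for joint
    occurrences extends to non-occurrences. *)
Lemma pr_occur_none (K : eqType) (E : K -> set T) (p : K -> R) :
  (forall k, measurable (E k)) ->
  (forall s, uniq s ->
     pr [set w | forall k, k \in s -> E k w] = \prod_(k <- s) p k) ->
  forall s t, uniq (s ++ t) ->
    pr [set w | (forall k, k \in s -> E k w) /\ (forall k, k \in t -> ~ E k w)] =
    \prod_(k <- s) p k * \prod_(k <- t) (1 - p k) /\
    measurable
      [set w | (forall k, k \in s -> E k w) /\ (forall k, k \in t -> ~ E k w)].
Proof.
move=> mE pE.
have mall (s : seq K) : measurable [set w | forall k, k \in s -> E k w].
  rewrite (_ : mkset _ = ~` [set w | exists2 k, k \in s & (~` E k) w]).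
    by apply: measurableC; apply: measurable_exists_seq => k; exact: measurableC.
  apply/seteqP; split=> w /=; first by move=> H [k ks]; apply; exact: H.
  by move=> H k ks; apply: contrapT => nE; apply: H; exists k.
move=> s t; elim: t s => [|k t IH] s.
  rewrite cats0 big_nil mulr1 => us.
  have -> : [set w | (forall k, k \in s -> E k w) /\
                     (forall k, k \in [::] -> ~ E k w)] =
            [set w | forall k, k \in s -> E k w].
    by apply/seteqP; split=> w /= => [[]|H] //; split.
  by split; [exact: pE|exact: mall].
move=> u; have us : uniq (s ++ t).
  move: u; rewrite !cat_uniq /= => /and3P[-> + /andP[_ ->]].
  by rewrite negb_or andbT => /andP[_ ->].
have uks : uniq ((k :: s) ++ t).
  by move: u; rewrite -[k :: t]cat1s uniq_catCA.
have [p1 m1] := IH _ us; have [p2 m2] := IH _ uks.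
set A := [set w | _] in p1 m1.
have AI : [set w | (forall i, i \in k :: s -> E i w) /\
    (forall i, i \in t -> ~ E i w)] = A `&` E k.
  apply/seteqP; split=> w /= => [[H1 H2]|[[H1 H2] Ek]].
    by split; [split => // i si; apply: H1; rewrite inE si orbT|apply: H1; exact: mem_head].
  by split => // i; rewrite inE => /predU1P[->//|]; exact: H1.
have AD : [set w | (forall i, i \in s -> E i w) /\
    (forall i, i \in k :: t -> ~ E i w)] = A `\` E k.
  apply/seteqP; split=> w /= => [[H1 H2]|[[H1 H2] Ek]].
    by split; [split => // i si; apply: H2; rewrite inE si orbT|apply: H2; exact: mem_head].
  by split => // i; rewrite inE => /predU1P[->//|]; exact: H2.
rewrite AD; split; last exact: measurableD.
have := pr_setDI m1 (mE k); rewrite -AI p1 p2 !big_cons => E1.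
by rewrite -[LHS](addrK (p k * \prod_(j <- s) p j * \prod_(j <- t) (1 - p j))) -E1; ring.
Qed.

Lemma pr_bigcup_geometric (F : nat -> set T) (e : R) : 0 <= e ->
  (forall k, measurable (F k)) -> (forall k, pr (F k) <= e / (2 ^ k.+1)%:R) ->
  pr (\bigcup_k F k) <= e.
Proof.
move=> e0 mF Fe; have mU : measurable (\bigcup_k F k) by exact: bigcup_measurable.
rewrite -lee_fin -prE //.
apply: (le_trans (measure_sigma_subadditive P mF mU (@subset_refl _ _))).
have := @epsilon_trick R (fun=> 0)%E e xpredT (fun=> lexx _) e0.
have -> : (\sum_(0 <= i <oo) (0 : \bar R) = 0)%E by exact: eseries0.
rewrite add0e; apply: le_trans; apply: lee_nneseries => //.
by move=> k _; rewrite add0e; have := Fe k; rewrite -lee_fin -(prE (mF k)).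
Qed.

Lemma negligible_small A :
  (forall e, 0 < e -> exists B, [/\ measurable B, A `<=` B & pr B <= e]) ->
  P.-negligible A.
Proof.
move=> H; have /choice[B BP] : forall k : nat, exists B,
    [/\ measurable B, A `<=` B & pr B <= k.+1%:R^-1].
  by move=> k; apply: H; rewrite invr_gt0.
have mI : measurable (\bigcap_k B k) by apply: bigcapT_measurable => k; have [] := BP k.
exists (\bigcap_k B k); split => //; last by move=> w Aw k _; have [_ + _] := BP k; apply.
rewrite prE //; congr EFin; apply/eqP; rewrite eq_le pr_ge0 andbT.
apply/ler_addgt0Pl => e e0; rewrite addr0.
have [k ke] : exists k : nat, k.+1%:R^-1 < e.
  exists (Num.truncn e^-1); rewrite invf_plt ?posrE //; exact: truncnS_gt.
have [mB _ Bk] := BP k; apply: le_trans (ltW ke); apply: le_trans Bk.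
by apply: pr_le => //; exact: bigcap_inf.
Qed.

End RealProbability.

Section ExpSeries.
Context {R : realType}.
Implicit Types (x l : R) (k n : nat).

Lemma exp_partial_sum_le x n : 0 <= x -> \sum_(i < n) x ^+ i / i`!%:R <= expR x.
Proof.
move=> x0; have <- : series (exp_coeff x) n = \sum_(i < n) x ^+ i / i`!%:R.
  by rewrite /series /= big_mkord.
apply: nondecreasing_cvgn_le; last exact: is_cvg_series_exp_coeff.
move=> a b ab; rewrite /series /= -(subnKC ab) /index_iota !subn0 iotaD big_cat /=.
by rewrite lerDl sumr_ge0 // => i _; exact: exp_coeff_ge0.
Qed.

Lemma expR_le_sum x (y : R) : (forall n, \sum_(i < n) x ^+ i / i`!%:R <= y) ->
  expR x <= y.
Proof.
move=> H; apply: limr_le; first exact: is_cvg_series_exp_coeff.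
by near=> n; have := H n; rewrite /series /= big_mkord.
Unshelve. all: by end_near. Qed.

(** The Taylor remainder of the exponential, which reduces the tail of the Poisson
    distribution to its first term. *)
Lemma expR_le_remainder x k : 0 <= x ->
  expR x <= \sum_(j < k) x ^+ j / j`!%:R + x ^+ k / k`!%:R * expR x.
Proof.
move=> x0; apply: expR_le_sum => n.
have t0 j : 0 <= x ^+ j / j`!%:R by rewrite divr_ge0 ?exprn_ge0.
apply: (@le_trans _ _ (\sum_(j < k + n) x ^+ j / j`!%:R)).
  by rewrite addnC big_split_ord /= lerDl sumr_ge0.
rewrite big_split_ord /= lerD2l.
apply: le_trans (ler_wpM2l (t0 k) (exp_partial_sum_le n x0)).
rewrite mulr_sumr ler_sum // => i _; rewrite exprD mulrACA ler_wpM2l ?mulr_ge0 ?exprn_ge0 //.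
rewrite -invfM lef_pV2 ?posrE ?mulr_gt0 ?ltr0n ?fact_gt0 // -natrM ler_nat.
rewrite -(bin_fact (leq_addr i k)) addKn.
by rewrite leq_pmull // bin_gt0 leq_addr.
Qed.

(** [k^k / k!] is one term of the series of [e^k]. *)
Lemma pow_self_le_fact k : k%:R ^+ k <= expR 1 ^+ k * k`!%:R :> R.
Proof.
have f0 : 0 < k`!%:R :> R by rewrite ltr0n fact_gt0.
rewrite -ler_pdivrMr // -expRM_natl mulr1.
case: k f0 => [|k] f0; first by rewrite expr0 fact0 divr1 expR0.
by have := @expR_ge1Dxn R k.+1%:R k (ler0n _ _); apply: le_trans; rewrite lerDr.
Qed.

End ExpSeries.

Section PoissonField.
Context {d : measure_display} {Omega : measurableType d} {R : realType}.
Let RR := (measurableTypeR R * measurableTypeR R)%type.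
Variables (P : probability Omega R) (mu : {measure set RR -> \bar R})
  (conf : Omega -> set (R * R)).
Hypothesis PF : poisson_field P mu conf.
Implicit Types (B : set RR) (w : Omega) (p q : R * R).

Lemma measurable_count B (C : set (\bar R)) : measurable B -> measurable C ->
  measurable [set w | C (point_count conf B w)].
Proof.
move=> mB mC; rewrite -[X in measurable X]setTI.
exact: (poisson_field_measurable PF mB).
Qed.

Definition no_point B : set Omega := [set w | point_count conf B w = 0%E].

Definition many B k : set Omega := [set w | (k%:R%:E <= point_count conf B w)%E].

Lemma no_pointP B w : no_point B w <-> conf w `&` B = set0.
Proof.
rewrite /no_point /point_count /counting /=; case: asboolP => [fin|inf]; last first.
  by split => // E; case: inf; rewrite E.
split=> [[/eqP]|->]; last by rewrite fset_set0 cardfs0.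
by rewrite pnatr_eq0 cardfs_eq0 => /eqP /fset_set_set0; apply.
Qed.

Lemma many_size B w (s : seq (R * R)) : uniq s ->
  (forall p, p \in s -> (conf w `&` B) p) -> many B (size s) w.
Proof.
move=> us sB; rewrite /many /point_count /counting /=.
case: asboolP => [fin|_]; last exact: leey.
rewrite lee_fin ler_nat; apply: uniq_leq_size => // p /sB ps.
by rewrite in_fset_set // inE.
Qed.

Lemma not_many_finite B w k : ~ many B k w -> finite_set (conf w `&` B).
Proof.
rewrite /many /point_count /counting /=.
by case: asboolP => // _; rewrite leey.
Qed.

Lemma single_point B w : point_count conf B w = 1%E ->
  exists2 p, conf w p /\ B p & forall q, conf w q -> B q -> q = p.
Proof.
rewrite /point_count /counting; case: asboolP => // fin [/eqP].
rewrite pnatr_eq1 => /cardfs1P [p pE].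
have H q : (conf w `&` B) q <-> q = p.
  have := in_fset_set fin q; rewrite pE inE => E; split.
    by move=> Bq; apply/eqP; rewrite E inE.
  by move=> /eqP; rewrite E inE.
by exists p; [exact: (H p).2|move=> q wq Bq; apply/(H q).1].
Qed.

Lemma occupied_point B w : ~ no_point B w -> exists2 p, conf w p & B p.
Proof.
move=> nv; apply: contrapT => H; apply: nv; apply/no_pointP; rewrite -subset0 => p [wp Bp].
by apply: H; exists p.
Qed.

Lemma measurable_no_point B : measurable B -> measurable (no_point B).
Proof. by move=> mB; apply: (measurable_count mB (C := [set 0%E])). Qed.

Lemma measurable_many B k : measurable B -> measurable (many B k).
Proof.
move=> mB; apply: (measurable_count mB (C := [set x | (k%:R%:E <= x)%E])).
rewrite (_ : mkset _ = `[k%:R%:E, +oo[%classic); first exact: emeasurable_itv.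
by apply/seteqP; split=> x /=; rewrite in_itv /= andbT.
Qed.

Lemma pr_no_point B (l : R) : measurable B -> mu B = l%:E -> pr P (no_point B) = expR (- l).
Proof.
move=> mB lB; have := poisson_field_count PF 0 mB lB.
by rewrite fact0 expr0 divr1 mul1r /pr /no_point => ->.
Qed.

Lemma pr_single B (l : R) : measurable B -> mu B = l%:E ->
  pr P [set w | point_count conf B w = 1%E] = l * expR (- l).
Proof.
move=> mB lB; have := poisson_field_count PF 1 mB lB.
by rewrite (_ : 1`! = 1)%N // expr1 divr1 /pr => ->.
Qed.

Lemma pr_occupied_le B (l : R) : measurable B -> mu B = l%:E ->
  pr P (~` no_point B) <= l.
Proof.
move=> mB lB; rewrite pr_setC ?(pr_no_point mB lB); last exact: measurable_no_point.
by have := expR_ge1Dx (- l); lra.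
Qed.

Lemma many_complement B k :
  ~` many B k = [set w | exists2 j, (j < k)%N & point_count conf B w = j%:R%:E].
Proof.
apply/seteqP; split=> w /=; rewrite /many /point_count /counting /=.
  case: asboolP => [fin|_]; last by rewrite leey.
  by move=> /negP; rewrite lee_fin -ltNge ltr_nat => h; exists (#|` fset_set (conf w `&` B)|)%fset.
by move=> [j jk ->]; rewrite lee_fin ler_nat leqNgt jk.
Qed.

Lemma pr_many B (l : R) k : measurable B -> 0 <= l -> mu B = l%:E ->
  pr P (many B k) <= l ^+ k / k`!%:R.
Proof.
move=> mB l0 lB; rewrite -[many B k]setCK many_complement.
have mE j : measurable [set w | point_count conf B w = j%:R%:E].
  exact: (measurable_count mB (C := [set j%:R%:E])).
have [|Ep Em] := pr_exists_disjoint P k mE.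
  by move=> i j w /= -> [/eqP]; rewrite eqr_nat => /eqP.
rewrite pr_setC // Ep.
have -> : \sum_(j < k) pr P [set w | point_count conf B w = j%:R%:E] =
    (\sum_(j < k) l ^+ j / j`!%:R) * expR (- l).
  rewrite mulr_suml; apply: eq_bigr => j _.
  by have := poisson_field_count PF j mB lB; rewrite /pr => ->.
rewrite lerBlDr; have := expR_le_remainder k l0; rewrite expRN.
move: (expR l) (expR_gt0 l) => e e0 H.
by rewrite -(ler_pM2r e0) mul1r mulrDl divfK ?gt_eqF // addrC.
Qed.

Lemma pr_all (I : finType) (B : I -> set RR) (C : I -> set (\bar R)) :
  (forall i, measurable (B i)) -> trivIset [set: I] B ->
  (forall i, measurable (C i)) ->
  pr P [set w | forall i, C i (point_count conf (B i) w)] =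
    \prod_i pr P [set w | C i (point_count conf (B i) w)].
Proof.
move=> mB tB mC.
have tB' : trivIset [set: 'I_#|I|] (fun j => B (enum_val j)).
  move=> i j _ _ [w [Bi Bj]]; apply: enum_val_inj.
  by apply: (tB _ _ Logic.I Logic.I); exists w.
have := poisson_field_independent PF (fun j : 'I_#|I| => mB (enum_val j)) tB'
  (fun j : 'I_#|I| => mC (enum_val j)).
have -> : [set w | forall j : 'I_#|I|,
      C (enum_val j) (point_count conf (B (enum_val j)) w)] =
    [set w | forall i, C i (point_count conf (B i) w)].
  apply/seteqP; split=> w /= H; last by move=> j; exact: H.
  by move=> i; have := H (enum_rank i); rewrite enum_rankK.
rewrite /pr => ->.
have -> : (\prod_(j < #|I|) P [set w | C (enum_val j)
      (point_count conf (B (enum_val j)) w)] =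
    \prod_(j < #|I|) (pr P [set w | C (enum_val j)
      (point_count conf (B (enum_val j)) w)])%:E)%E.
  by apply: eq_bigr => j _; apply: prE; exact: measurable_count.
by rewrite prodEFin /= [RHS](reindex _ (onW_bij _ (enum_val_bij I))).
Qed.

End PoissonField.

(** * Intensity of boxes and finiteness of time strips *)

Section Intensity.
Context {R : realType}.
Let RR := (measurableTypeR R * measurableTypeR R)%type.
Variable m : {finite_measure set (measurableTypeR R) -> \bar R}.
Implicit Types (a b x : R).

Definition intensity : {measure set RR -> \bar R} := (@lebesgue_measure R \x m)%E.

Definition mass (A : set R) : R := fine (m A).

Definition box a b (A : set R) : set RR := [set p | a <= p.1 <= b /\ A p.2].

Lemma massE A : measurable A -> m A = (mass A)%:E.
Proof. by move=> mA; rewrite /mass fineK // fin_num_measure. Qed.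

Lemma mass_ge0 A : 0 <= mass A.
Proof. exact: fine_ge0. Qed.

Lemma boxE a b A : box a b A = `[a, b]%classic `*` A.
Proof. by apply/seteqP; split => p /=; rewrite /box /= in_itv. Qed.

Lemma measurable_box a b A : measurable A -> measurable (box a b A).
Proof. by move=> mA; rewrite boxE; apply: measurableX. Qed.

Lemma intensity_box a b A : a <= b -> measurable A ->
  intensity (box a b A) = ((b - a) * mass A)%:E.
Proof.
move=> ab mA; rewrite boxE /intensity /= product_measure1E //.
transitivity (lebesgue_measure `[a, b]%classic * (mass A)%:E)%E.
  by congr (_ * _)%E; exact: massE.
rewrite lebesgue_measure_itv /= lte_fin EFinM; congr (_ * _)%E.
case: ltP => // ba; have -> : a = b by apply/eqP; rewrite eq_le ab ba.
by rewrite subrr.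
Qed.

Lemma intensity_sub_box a b (B : set RR) : a <= b -> measurable B ->
  B `<=` box a b setT ->
  exists l : R, [/\ 0 <= l, l <= (b - a) * mass setT & intensity B = l%:E].
Proof.
move=> ab mB BS.
have le : (intensity B <= ((b - a) * mass setT)%:E)%E.
  by rewrite -intensity_box // le_measure ?inE //; exact: measurable_box.
have ge : (0 <= intensity B)%E by [].
exists (fine (intensity B)); split; first exact: fine_ge0.
  by rewrite -[leRHS]/(fine ((b - a) * mass setT)%:E) fine_le // ge0_fin_numE // (le_lt_trans le) ?ltry.
by rewrite fineK // ge0_fin_numE // (le_lt_trans le) ?ltry.
Qed.

Definition far_from_axis rad : set R := [set x | rad < `|x|].

Lemma measurable_far_from_axis rad : measurable (far_from_axis rad).
Proof.
rewrite (_ : far_from_axis rad = ~` `[- rad, rad]); first exact: measurableC.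
by apply/seteqP; split => x /=; rewrite /far_from_axis /= in_itv /= -ler_norml ltNge => /negP.
Qed.

Lemma mass_far_small (e : R) : 0 < e -> exists n : nat, mass (far_from_axis n%:R) < e.
Proof.
move=> e0.
have mF n : measurable (far_from_axis n%:R) by exact: measurable_far_from_axis.
have : m (far_from_axis n%:R) @[n --> \oo] --> m (\bigcap_n far_from_axis n%:R).
  apply: nonincreasing_cvg_mu => //.
  - by have := massE (mF 0%N) => mE; apply: le_lt_trans (ltry (mass (far_from_axis 0%:R))); rewrite -mE.
  - exact: bigcapT_measurable.
  - move=> i j ij; apply/subsetPset => x; rewrite /far_from_axis /=; apply: le_lt_trans.
    by rewrite ler_nat.
have -> : \bigcap_n far_from_axis n%:R = set0.
  rewrite -subset0 => x /(_ (Num.truncn `|x|).+1 Logic.I); rewrite /far_from_axis /=.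
  by move/(lt_trans (truncnS_gt _)); rewrite ltxx.
rewrite measure0 => /fine_cvgP[_] /cvgrPdist_lt /(_ _ e0) H.
have [n _ /(_ n (leqnn _))] := H; rewrite /= sub0r normrN => h; exists n.
exact: le_lt_trans (ler_norm _) h.
Qed.

(** The line is a countable union of intervals of length 2, and one of them has
    positive mass. *)
Lemma mass_near_pos : m setT != 0%E -> exists x0, 0 < mass `[x0 - 1, x0 + 1]%classic.
Proof.
move=> m0; apply: contrapT => H; move/eqP: m0; apply.
have z x : m `[x - 1, x + 1]%classic = 0%E.
  rewrite massE //; congr EFin; apply/eqP; rewrite eq_le mass_ge0 andbT leNgt.
  by apply/negP => x0; apply: H; exists x.
apply/eqP; rewrite eq_le measure_ge0 andbT.
have cov : [set: R] `<=` \bigcup_(n : nat) (`[n%:R - 1, n%:R + 1]%classic `|` `[- n%:R - 1, - n%:R + 1]%classic).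
  move=> x _; exists (Num.truncn `|x|) => //=.
  have /truncn_itv /andP[h1] : 0 <= `|x| by [].
  rewrite -natr1 => h2; rewrite !in_itv /=.
  have [x0|x0] := leP 0 x.
    by left; rewrite ger0_norm // in h1 h2 *; apply/andP; split; lra.
  by right; rewrite ltr0_norm // in h1 h2 *; apply/andP; split; lra.
apply: (le_trans (measure_sigma_subadditive m _ _ cov)) => //.
  by move=> n; apply: measurableU.
rewrite eseries0 // => n _ _; apply/eqP; rewrite eq_le measure_ge0 andbT.
apply: (le_trans (measureU2 _ _ _)) => //.
apply: (@le_trans _ _ (0 + 0)%E); last by rewrite adde0.
apply: leeD; first by rewrite -(z n%:R).
by rewrite -(z (- n%:R)).
Qed.

End Intensity.

Section StripFinite.
Context {d : measure_display} {Omega : measurableType d} {R : realType}.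
Variables (P : probability Omega R)
  (m : {finite_measure set (measurableTypeR R) -> \bar R})
  (conf : Omega -> set (R * R)).
Hypothesis PF : poisson_field P (intensity m) conf.

(** A bounded time strip has finite intensity because [m] is finite, and the
    probability of [k] points in it tends to 0 with [k]. *)
Lemma strip_finite_ae : {ae P, forall w, strip_finite (conf w)}.
Proof.
pose S (n : nat) := box (- n%:R : R) n%:R setT.
have mS n : measurable (S n) by exact: measurable_box.
have neg n : P.-negligible [set w | ~ finite_set (conf w `&` S n)].
  have n0 : - n%:R <= n%:R :> R by apply: (@le_trans _ _ 0); rewrite ?oppr_le0.
  pose l : R := (n%:R - - n%:R) * mass m setT.
  have lE : intensity m (S n) = l%:E by exact: intensity_box.
  have l0 : 0 <= l by rewrite mulr_ge0 ?subr_ge0 // mass_ge0.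
  apply: negligible_small => e e0.
  have /cvgrPdist_lt /(_ _ e0) [k _ /(_ k (leqnn _))] := @cvg_exp_coeff R l.
  rewrite /= sub0r normrN => ke.
  exists (many conf (S n) k); split; first exact: (measurable_many PF).
    by move=> w nf; apply: contrapT => /not_many_finite.
  apply: (le_trans (pr_many PF k (mS n) l0 lE)).
  by apply: le_trans (ltW ke); exact: ler_norm.
have negU := negligible_bigcup neg.
apply: negligibleS negU => w /= H; apply: contrapT => H'; apply: H => a b.
pose n := (Num.truncn (Num.max `|a| `|b|)).+1.
have na : `|a| <= n%:R by apply: le_trans (ltW (truncnS_gt _)); rewrite le_max lexx.
have nb : `|b| <= n%:R by apply: le_trans (ltW (truncnS_gt _)); rewrite le_max lexx orbT.
have fin : finite_set (conf w `&` S n).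
  by apply: contrapT => nf; apply: H'; exists n.
apply: sub_finite_set fin => p [wp /andP[h1 h2]]; split => //; split => //.
move: na nb; rewrite !ler_norml => /andP[h3 h4] /andP[h5 h6].
by apply/andP; split; lra.
Qed.

End StripFinite.

(** * Almost sure existence of good cells *)

Lemma quarter_bound (k s : nat) : (k < 4 * s)%N -> (6 * k <= 24 * s)%N.
Proof. lia. Qed.

Lemma eighth_bound (k : nat) : (k <= 8 * (k %/ 8).+1)%N /\
  (5 * k <= 40 * (k %/ 8).+1)%N.
Proof. by split; lia. Qed.

Lemma eighth_lt (k s : nat) : (k < 8 * s)%N -> ((k %/ 8).+1 <= s)%N.
Proof. lia. Qed.

Lemma int_window {R : realType} (n c : int) (W : nat) : `|c - n| <= W%:Z ->
  n%:~R - W%:R <= c%:~R :> R /\ c%:~R <= n%:~R + W%:R :> R.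
Proof.
rewrite ler_norml => /andP[h1 h2]; split.
  have : (n - W%:Z)%:~R <= c%:~R :> R by rewrite ler_int; lia.
  by rewrite rmorphB.
have : c%:~R <= (n + W%:Z)%:~R :> R by rewrite ler_int; lia.
by rewrite rmorphD.
Qed.

Section SiteCells.
Variables (J V : nat).
Implicit Types (n : int) (c : 'I_(2 * J).+1 + ('I_V + 'I_V)).

(** An injective parametrization of the cells at distance at most [J + V] from [n]:
    those of the zone, and [V] more cells on each side. *)
Definition site_cell n c : int :=
  match c with
  | inl a => n - J%:Z + a%:Z
  | inr (inl a) => n - J%:Z - 1 - a%:Z
  | inr (inr a) => n + J%:Z + 1 + a%:Z
  end.

Lemma site_cell_bounds n c : `|site_cell n c - n| <= (J + V)%:Z.
Proof.
by case: c => [[a la]|[[a la]|[a la]]]; rewrite /site_cell /=; lia.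
Qed.

Lemma site_cell_inj n : injective (site_cell n).
Proof.
move=> [[a la]|[[a la]|[a la]]] [[b lb]|[[b lb]|[b lb]]] /= E;
  try (by exfalso; lia).
- by congr inl; apply: val_inj => /=; lia.
- by congr (inr (inl _)); apply: val_inj => /=; lia.
- by congr (inr (inr _)); apply: val_inj => /=; lia.
Qed.

Lemma site_cell_far n (c : 'I_V + 'I_V) :
  (site_cell n (inr c) <= n - J%:Z - 1) \/ (n + J%:Z + 1 <= site_cell n (inr c)).
Proof. by case: c => [[a la]|[a la]]; [left|right]; rewrite /site_cell /=; lia. Qed.

Lemma site_cell_near n (c : int) : `|c - n| <= J%:Z ->
  exists a : 'I_(2 * J).+1, c = n - J%:Z + a%:Z.
Proof.
move=> cn; have h : (absz (c - (n - J%:Z))%R < (2 * J).+1)%N by lia.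
by exists (Ordinal h) => /=; lia.
Qed.

Lemma site_cell_surj n (c : int) : `|c - n| <= (J + V)%:Z ->
  exists a, c = site_cell n a.
Proof.
move=> cn; have [near|far] := leP `|c - n| J%:Z.
  by have [a ->] := site_cell_near near; exists (inl a).
have [lt|gt] := ltP c n.
  have h : (absz (n - J%:Z - 1 - c)%R < V)%N by lia.
  by exists (inr (inl (Ordinal h))) => /=; lia.
have h : (absz (c - (n + J%:Z + 1))%R < V)%N by lia.
by exists (inr (inr (Ordinal h))) => /=; lia.
Qed.

End SiteCells.

Section GoodCells.
Context {d : measure_display} {Omega : measurableType d} {R : realType}.
Let RR := (measurableTypeR R * measurableTypeR R)%type.
Variables (P : probability Omega R)
  (m : {finite_measure set (measurableTypeR R) -> \bar R})
  (conf : Omega -> set (R * R)).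
Hypothesis PF : poisson_field P (intensity m) conf.
Variables (L x0 rad : R) (J : nat).
Implicit Types (n : int) (w : Omega) (p : R * R) (k V : nat).

Let near_mass : R := mass m `[x0 - 1, x0 + 1]%classic.
Let far_mass : R := mass m (far_from_axis rad).
Let h : R := 2^-1.

Hypothesis L_ge : 32 <= L.
Hypothesis rad_ge : `|x0| + 1 <= rad.
Hypothesis near_mass_gt0 : 0 < near_mass.
Hypothesis miss_small : expR (- (L / 2 * near_mass)) <= h ^+ 24.
Hypothesis outer_small : 8 * expR 1 * (L * far_mass) <= h ^+ 40.

Let L_gt0 : 0 < L. Proof. exact: lt_le_trans L_ge. Qed.
Let h_ge0 : 0 <= h. Proof. by rewrite invr_ge0. Qed.
Let h_le1 : h <= 1. Proof. by rewrite invf_le1 // ler1n. Qed.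

Lemma innerE n : inner L x0 n =
  box (n%:~R * L - L / 4) (n%:~R * L + L / 4) `[x0 - 1, x0 + 1]%classic.
Proof.
apply/seteqP; split=> p; rewrite /inner /box /= !in_itv /= !ler_distl.
  by move=> [h1 h2]; split => //; rewrite andbC.
by move=> [h1 h2]; split => //; rewrite andbC.
Qed.

Lemma measurable_inner n : measurable (inner L x0 n : set RR).
Proof. by rewrite innerE; apply: measurable_box. Qed.

Lemma intensity_inner n : intensity m (inner L x0 n) = (L / 2 * near_mass)%:E.
Proof.
rewrite innerE intensity_box //; last by have := L_gt0; lra.
by congr ((_ * _)%:E); field.
Qed.

Lemma pr_miss n : pr P (no_point conf (inner L x0 n)) = expR (- (L / 2 * near_mass)).
Proof. exact: (pr_no_point PF (measurable_inner n) (intensity_inner n)). Qed.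

Lemma hit_occupied w n : hit L x0 (conf w) n <-> ~ no_point conf (inner L x0 n) w.
Proof.
split; first by move=> [p wp ip] /no_pointP E; have : set0 p by rewrite -E.
by move=> /occupied_point[p wp ip]; exists p.
Qed.

Lemma inner_inj n n' p : inner L x0 n p -> inner L x0 n' p -> n = n'.
Proof.
move=> /inner_time /andP[h1 h2] /inner_time /andP[h3 h4].
apply/eqP; rewrite eq_le !leNgt -!lezD1; apply/andP; split; apply/negP;
  rewrite -(ler_int R) rmorphD /=; have := L_gt0; move: h1 h2 h3 h4;
  move: (n%:~R : R) (n'%:~R : R) => *; nra.
Qed.

Lemma half_powers k (a : R) : 0 <= a -> a <= h ^+ k -> forall j i,
  (i <= k * j)%N -> a ^+ j <= h ^+ i.
Proof.
move=> a0 ak j i ij; apply: (@le_trans _ _ ((h ^+ k) ^+ j)).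
  by rewrite lerXn2r // nnegrE ?exprn_ge0.
by rewrite -exprM; exact: ler_wiXn2l.
Qed.

Definition missed_cells (c : nat -> int) k (S : {set 'I_k}) : set Omega :=
  [set w | forall i : 'I_k, (if i \in S then [set 0%E] else setT)
    (point_count conf (inner L x0 (c i)) w)].

Lemma pr_missed_cells c k (S : {set 'I_k}) : injective c ->
  measurable (missed_cells c S) /\
  pr P (missed_cells c S) = expR (- (L / 2 * near_mass)) ^+ #|S|.
Proof.
move=> cI; have mC i : measurable (if i \in S then [set 0%E : \bar R] else setT).
  by case: ifP => // _; exact: emeasurable_set1.
have tB : trivIset [set: 'I_k] (fun i : 'I_k => inner L x0 (c i) : set RR).
  by move=> i j _ _ [p [/inner_inj /[apply] /cI/val_inj]].
split.
  rewrite (_ : missed_cells c S = \bigcap_(i in [set: 'I_k])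
    [set w | (if i \in S then [set 0%E : \bar R] else setT)
      (point_count conf (inner L x0 (c i)) w)]).
    apply: fin_bigcap_measurable => // i _.
    exact: (measurable_count PF (measurable_inner _)).
  by apply/seteqP; split=> w H i //=; [move=> _; exact: H|exact: (H i Logic.I)].
rewrite (pr_all PF (fun i : 'I_k => measurable_inner (c i)) tB mC).
rewrite (bigID (mem S)) /= [X in _ * X]big1 ?mulr1; last first.
  move=> i /negbTE iS; rewrite -[RHS](pr_setT P); congr pr.
  by apply/seteqP; split => // w _; rewrite /= iS.
rewrite (eq_bigr (fun=> expR (- (L / 2 * near_mass)))) ?prodr_const //.
by move=> i ->; rewrite -(pr_miss (c i)).
Qed.

Definition many_missed (c : nat -> int) k : set Omega :=
  [set w | exists2 S : {set 'I_k}, S \in [seq S : {set 'I_k} <- enum predT | (k < 4 * #|S|)%N] &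
    missed_cells c S w].

(** Union bound over at most 2^k sets of more than [k / 4] cells, each of which is
    entirely missed with probability at most 2^-6k. *)
Lemma pr_many_missed c k : injective c ->
  measurable (many_missed c k) /\ pr P (many_missed c k) <= h ^+ (5 * k).
Proof.
move=> cI; have mS (S : {set 'I_k}) := (pr_missed_cells S cI).1.
split; first exact: measurable_exists_seq.
apply: (le_trans (pr_exists_seq P _ mS)).
apply: (@le_trans _ _ (\sum_(S <- [seq S : {set 'I_k} <- enum predT | (k < 4 * #|S|)%N]) h ^+ (6 * k))).
  rewrite big_seq [leRHS]big_seq; apply: ler_sum => S.
  rewrite mem_filter => /andP[kS _]; rewrite (pr_missed_cells S cI).2.
  by apply: (half_powers _ miss_small); [exact: expR_ge0|exact: quarter_bound].
rewrite big_const_seq count_predT iter_addr_0.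
have sz : (size [seq S : {set 'I_k} <- enum predT | (k < 4 * #|S|)%N] <= 2 ^ k)%N.
  rewrite size_filter (leq_trans (count_size _ _)) // -cardE -cardsT.
  by rewrite -powersetT card_powerset cardsT card_ord.
have -> : h ^+ (5 * k) = h ^+ (6 * k) *+ 2 ^ k.
  rewrite -mulr_natr natrX (_ : 6 * k = k + 5 * k)%N; last by lia.
  by rewrite exprD mulrAC -exprMn mulVf // expr1n mul1r.
by rewrite -[leLHS]mulr_natr -[leRHS]mulr_natr ler_wpM2l ?ler_nat // exprn_ge0.
Qed.

Lemma not_many_missed c k w : ~ many_missed c k w ->
  (4 * \sum_(i < k) ~~ `[< hit L x0 (conf w) (c i) >] <= k)%N.
Proof.
move=> H; rewrite leqNgt; apply/negP => lt; apply: H.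
pose S := [set i : 'I_k | ~~ `[< hit L x0 (conf w) (c i) >]]%SET.
exists S.
  rewrite mem_filter mem_enum andbT -sum1_card big_mkcond /=.
  rewrite (eq_bigr (fun i : 'I_k => nat_of_bool (~~ `[< hit L x0 (conf w) (c i) >]))) //.
  by move=> i _; rewrite inE; case: asboolP.
move=> i; rewrite inE; case: asboolP => //= nh.
by apply: contrapT => nv; apply: nh; apply/hit_occupied.
Qed.

Definition outer_strip (a : R) k : set RR :=
  box a (a + k%:R * L) (far_from_axis rad).

Lemma measurable_outer_strip a k : measurable (outer_strip a k).
Proof. exact: measurable_box (measurable_far_from_axis _). Qed.

(** The tail bound l^K / K! of the Poisson distribution, with K about [k / 8], is
    at most (e l / K)^K, and [e * l / K] is small by [outer_small]. *)
Lemma pr_outer_strip a k :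
  pr P (many conf (outer_strip a k) (k %/ 8).+1) <= h ^+ (5 * k).
Proof.
set K := (k %/ 8).+1.
have kL0 : 0 <= k%:R * L by rewrite mulr_ge0 // ltW // L_gt0.
have lE : intensity m (outer_strip a k) = (k%:R * L * far_mass)%:E.
  rewrite intensity_box ?lerDl //; last exact: measurable_far_from_axis.
  by rewrite addrC addKr.
have f0 : 0 <= far_mass by exact: mass_ge0.
have Lf0 : 0 <= L * far_mass by rewrite mulr_ge0 // ltW // L_gt0.
have l0 : 0 <= k%:R * L * far_mass by rewrite -mulrA mulr_ge0.
apply: (le_trans (pr_many PF K (measurable_outer_strip a k) l0 lE)).
have [kK kK'] : (k <= 8 * K)%N /\ (5 * k <= 40 * K)%N by exact: eighth_bound.
have K0 : 0 < K`!%:R :> R by rewrite ltr0n fact_gt0.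
rewrite ler_pdivrMr //.
apply: (@le_trans _ _ ((8 * expR 1 * (L * far_mass)) ^+ K * K`!%:R)); last first.
  rewrite ler_wpM2r ?(ltW K0) //; apply: (half_powers _ outer_small).
    by rewrite (mulr_ge0 _ Lf0) // mulr_ge0 // expR_ge0.
  exact: kK'.
apply: (@le_trans _ _ ((K%:R * (8 * (L * far_mass))) ^+ K)).
  have le1 : k%:R * L * far_mass <= K%:R * (8 * (L * far_mass)).
    have -> : K%:R * (8 * (L * far_mass)) = (8 * K)%:R * (L * far_mass).
      by rewrite natrM; ring.
    by rewrite -mulrA ler_wpM2r // ler_nat.
  by apply: lerXn2r => //; rewrite nnegrE // mulr_ge0 // mulr_ge0.
rewrite exprMn.
have -> : (8 * expR 1 * (L * far_mass)) ^+ K * K`!%:R =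
    (expR 1 ^+ K * K`!%:R) * (8 * (L * far_mass)) ^+ K.
  by rewrite -mulrA mulrCA exprMn mulrAC.
apply: ler_wpM2r; first by rewrite exprn_ge0 // mulr_ge0.
exact: pow_self_le_fact.
Qed.

(** The failure of [left_good] at distance [k], on the left and on the right. *)
Definition bad_range n k : set Omega :=
  (many_missed (fun i => n - 1 - i%:Z) k `|`
   many conf (outer_strip ((n%:~R - k%:R - 2^-1) * L) k) (k %/ 8).+1) `|`
  (many_missed (fun i => n + 1 + i%:Z) k `|`
   many conf (outer_strip ((n%:~R + 2^-1) * L) k) (k %/ 8).+1).

Lemma pr_bad_range n k :
  measurable (bad_range n k) /\ pr P (bad_range n k) <= 4 * h ^+ (5 * k).
Proof.
have [|m1 p1] := @pr_many_missed (fun i => n - 1 - i%:Z) k; first by move=> i j; lia.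
have [|m2 p2] := @pr_many_missed (fun i => n + 1 + i%:Z) k; first by move=> i j; lia.
have m3 a := measurable_many PF (k %/ 8).+1 (measurable_outer_strip a k).
have p3 := pr_outer_strip ((n%:~R - k%:R - 2^-1) * L) k.
have p4 := pr_outer_strip ((n%:~R + 2^-1) * L) k.
split; first by apply: measurableU; apply: measurableU.
apply: (le_trans (pr_setU P (measurableU _ _ m1 (m3 _)) (measurableU _ _ m2 (m3 _)))).
have := pr_setU P m1 (m3 ((n%:~R - k%:R - 2^-1) * L)).
have := pr_setU P m2 (m3 ((n%:~R + 2^-1) * L)).
lra.
Qed.

Definition bad_beyond n V : set Omega := \bigcup_i bad_range n (V.+1 + i).

Lemma pr_bad_beyond n V :
  measurable (bad_beyond n V) /\ pr P (bad_beyond n V) <= h ^+ (5 * V).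
Proof.
have mB i := (pr_bad_range n (V.+1 + i)).1.
split; first exact: bigcup_measurable.
apply: pr_bigcup_geometric => //; first by rewrite exprn_ge0.
move=> i; apply: (le_trans (pr_bad_range n (V.+1 + i)).2).
have -> : h ^+ (5 * V) / (2 ^ i.+1)%:R = 4 * h ^+ (5 * V + i + 3).
  rewrite natrX -exprVn -/h -addnA exprD [h ^+ (i + 3)]exprD [h ^+ i.+1]exprS.
  move: (h ^+ (5 * V)) (h ^+ i) => x y.
  have -> : 4 * (x * (y * h ^+ 3)) = x * (4 * h ^+ 3 * y) by ring.
  by have -> : 4 * h ^+ 3 = h by rewrite /h; field.
rewrite ler_wpM2l //; apply: ler_wiXn2l => //; lia.
Qed.

Lemma not_bad_range_left n k w : ~ bad_range n k w ->
  (4 * misses L x0 (conf w) n k <= k)%N /\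
  forall s, uniq s -> (forall p, p \in s -> outer_left L rad (conf w) n k p) ->
    (8 * size s <= k)%N.
Proof.
move=> nb; split.
  by apply: (@not_many_missed (fun i => n - 1 - i%:Z) k w) => H; apply: nb; left; left.
move=> s us sP; rewrite leqNgt; apply/negP => lt; apply: nb; left; right.
have H : forall p, p \in s -> (conf w `&` outer_strip ((n%:~R - k%:R - 2^-1) * L) k) p.
  move=> p /sP [wp [/andP[h1 h2] h3]]; split => //; split => //.
  rewrite h1 /=; apply: (le_trans h2).
  by have -> : (n%:~R - k%:R - 2^-1) * L + k%:R * L = (n%:~R - 2^-1) * L by ring.
have := many_size us H; rewrite /many /=; apply: le_trans; rewrite lee_fin ler_nat.
exact: eighth_lt.
Qed.

Lemma not_bad_range_right n k w : ~ bad_range n k w ->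
  (4 * misses L x0 (reflect_time @^-1` conf w) (- n) k <= k)%N /\
  forall s, uniq s -> (forall p, p \in s ->
      outer_left L rad (reflect_time @^-1` conf w) (- n) k p) ->
    (8 * size s <= k)%N.
Proof.
move=> nb; split.
  have := @not_many_missed (fun i => n + 1 + i%:Z) k w.
  have -> : (\sum_(i < k) ~~ `[< hit L x0 (conf w) (n + 1 + i%:Z) >])%N =
      misses L x0 (reflect_time @^-1` conf w) (- n) k.
    apply: eq_bigr => i _; congr (~~ _ : nat); apply: asbool_equiv_eq.
    have -> : - n - 1 - i%:Z = - (n + 1 + i%:Z) by ring.
    split=> [[p wp ip]|[p wp ip]]; exists (reflect_time p) => //.
    - by rewrite /= reflect_timeK.
    - exact/inner_reflect.
    - by apply/inner_reflect; rewrite reflect_timeK.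
  by apply => H; apply: nb; right; left.
move=> s us sP; rewrite leqNgt; apply/negP => lt; apply: nb; right; right.
have us' : uniq (map (@reflect_time R) s).
  by rewrite map_inj_uniq //; exact: can_inj (@reflect_timeK R).
have H : forall p, p \in map (@reflect_time R) s ->
    (conf w `&` outer_strip ((n%:~R + 2^-1) * L) k) p.
  move=> _ /mapP[p /sP [wp [/andP[h1 h2] h3]] ->]; split => //; split => //.
  move: h1 h2; rewrite rmorphN /= => h1 h2; apply/andP; split; lra.
have := many_size us' H; rewrite size_map /many /=; apply: le_trans; rewrite lee_fin ler_nat.
exact: eighth_lt.
Qed.

Definition zone_rest n : set RR := zone L J n `\`
  [set p | exists2 a, a \in enum 'I_(2 * J).+1 & inner L x0 (n - J%:Z + a%:Z) p].

Definition outer_rest n V : set RR :=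
  box ((n%:~R - (J + V)%:R - 2^-1) * L) ((n%:~R + (J + V)%:R + 2^-1) * L)
    (far_from_axis rad) `\` zone L J n.

Definition site_index V := ('I_(2 * J).+1 + ('I_V + 'I_V) + bool)%type.

Definition site_box n V (i : site_index V) : set RR :=
  match i with
  | inl c => inner L x0 (@site_cell J V n c)
  | inr true => zone_rest n
  | inr false => outer_rest n V
  end.

Definition site_value V (i : site_index V) : set (\bar R) :=
  match i with
  | inl (inl _) => [set 1%E]
  | inl (inr _) => ~` [set 0%E]
  | inr _ => [set 0%E]
  end.

(** Conditions on disjoint regions, so that they are independent.  If in addition
    nothing bad happens at larger distances, the cell [n] is good. *)
Definition near_event V n : set Omega :=
  [set w | forall i : site_index V, site_value i (point_count conf (site_box n i) w)].

Lemma zoneE n : zone L J n = box ((n%:~R - J%:R - 2^-1) * L)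
  ((n%:~R + J%:R + 2^-1) * L) setT.
Proof. by apply/seteqP; split=> p /=; [move=> h0; split|case]. Qed.

Lemma measurable_zone n : measurable (zone L J n : set RR).
Proof. by rewrite zoneE; exact: measurable_box. Qed.

Lemma measurable_site_box V n (i : site_index V) : measurable (site_box n i).
Proof.
case: i => [c|[]] /=; first exact: measurable_inner.
  apply: measurableD; first exact: measurable_zone.
  by apply: measurable_exists_seq => a; exact: measurable_inner.
apply: measurableD; last exact: measurable_zone.
exact: measurable_box (measurable_far_from_axis _).
Qed.

Lemma measurable_site_value V (i : site_index V) : measurable (site_value i).
Proof.
case: i => [[c|c]|b] /=; try exact: emeasurable_set1.
by apply: measurableC; exact: emeasurable_set1.
Qed.

Lemma measurable_near_event V n : measurable (near_event V n).
Proof.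
rewrite (_ : near_event V n = \bigcap_(i in [set: site_index V])
    [set w | site_value i (point_count conf (site_box n i) w)]).
  apply: fin_bigcap_measurable; first exact: finite_finset.
  move=> i _; exact: (measurable_count PF (measurable_site_box n i) (measurable_site_value i)).
apply/seteqP; split=> w H; first by move=> i _; exact: H.
by move=> i; exact: (H i Logic.I).
Qed.

Lemma inner_window n c p (W : nat) : inner L x0 c p -> `|c - n| <= W%:Z ->
  (n%:~R - W%:R - 2^-1) * L <= p.1 <= (n%:~R + W%:R + 2^-1) * L.
Proof.
move=> /inner_time /andP[h1 h2] /(@int_window R) [h3 h4].
move: h1 h2 h3 h4 L_gt0; move: (c%:~R : R) (n%:~R : R) (W%:R : R) => a b e *.
apply/andP; split; nra.
Qed.

Lemma site_box_window V n (i : site_index V) p : site_box n i p ->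
  (n%:~R - (J + V)%:R - 2^-1) * L <= p.1 <= (n%:~R + (J + V)%:R + 2^-1) * L.
Proof.
case: i => [c|[]] /=.
- by move=> /inner_window; apply; exact: site_cell_bounds.
- move=> [/andP[h1 h2] _]; have V0 : 0 <= V%:R * L by rewrite mulr_ge0 // ltW // L_gt0.
  by rewrite natrD; apply/andP; split; lra.
- by move=> [[]].
Qed.

Lemma far_cell_not_zone V n (c : 'I_V + 'I_V) p :
  inner L x0 (@site_cell J V n (inr c)) p -> ~ zone L J n p.
Proof.
move=> /inner_time /andP[h1 h2] /andP[h3 h4].
have [h5|h5] := @site_cell_far J V n c.
- move: h5; rewrite -(ler_int R) !rmorphB /= -pmulrn; move: h1 h2 h3 h4 L_gt0.
  by move: ((site_cell n (inr c))%:~R : R) (n%:~R : R) (J%:R : R) => *; nra.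
- move: h5; rewrite -(ler_int R) !rmorphD /= -pmulrn; move: h1 h2 h3 h4 L_gt0.
  by move: ((site_cell n (inr c))%:~R : R) (n%:~R : R) (J%:R : R) => *; nra.
Qed.

Lemma inner_not_far n p : inner L x0 n p -> ~ far_from_axis rad p.2.
Proof.
move=> /inner_height h1; rewrite /far_from_axis /= => /lt_le_trans /(_ (le_trans h1 rad_ge)).
by rewrite ltxx.
Qed.

Lemma site_box_disjoint V n (i j : site_index V) p :
  site_box n i p -> site_box n j p -> i = j.
Proof.
have rest c : site_box n (inl c : site_index V) p -> ~ zone_rest n p.
  case: c => [a|c] /= ip [zp np]; last exact: far_cell_not_zone ip zp.
  by apply: np; exists a => //; rewrite mem_enum.
have outer c : site_box n (inl c : site_index V) p -> ~ outer_rest n V p.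
  by move=> /= /inner_not_far nf [[_ /nf]].
have zo : zone_rest n p -> ~ outer_rest n V p by move=> [zp _] [_]; apply.
case: i j => [c|[]] [c'|[]] // H1 H2.
- by congr inl; apply: (@site_cell_inj J V n); exact: inner_inj H1 H2.
- by case: (rest c H1).
- by case: (outer c H1).
- by case: (rest c' H2).
- by case: (zo H1).
- by case: (outer c' H2).
- by case: (zo H2).
Qed.

Lemma pr_site_box_all (V : nat) n :
  pr P (near_event V n) = \prod_(i : site_index V)
    pr P [set w | site_value i (point_count conf (site_box n i) w)].
Proof.
apply: (pr_all PF (measurable_site_box n) _ (@measurable_site_value V)).
by move=> i j _ _ [p [/site_box_disjoint /[apply]]].
Qed.

Lemma intensity_outer_rest n V :
  exists2 l, intensity m (outer_rest n V) = l%:E & l <= 2 * V%:R * (L * far_mass).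
Proof.
have L0 := L_gt0; have V0 : 0 <= V%:R * L by rewrite mulr_ge0 // ltW.
have J0 : 0 <= J%:R * L by rewrite mulr_ge0 // ltW.
pose B1 := box ((n%:~R - (J + V)%:R - 2^-1) * L) ((n%:~R - J%:R - 2^-1) * L)
  (far_from_axis rad).
pose B2 := box ((n%:~R + J%:R + 2^-1) * L) ((n%:~R + (J + V)%:R + 2^-1) * L)
  (far_from_axis rad).
have mf := @measurable_far_from_axis R rad.
have mB1 : measurable (B1 : set RR) by exact: measurable_box.
have mB2 : measurable (B2 : set RR) by exact: measurable_box.
have E1 : intensity m B1 = (V%:R * L * far_mass)%:E.
  rewrite intensity_box //; last by rewrite natrD; lra.
  by congr ((_ * _)%:E); rewrite natrD; ring.
have E2 : intensity m B2 = (V%:R * L * far_mass)%:E.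
  rewrite intensity_box //; last by rewrite natrD; lra.
  by congr ((_ * _)%:E); rewrite natrD; ring.
have mO : measurable (outer_rest n V) := @measurable_site_box V n (inr false).
have sub : outer_rest n V `<=` B1 `|` B2.
  move=> p [[/andP[h1 h2] fp] nz]; have [h3|h3] := leP p.1 ((n%:~R - J%:R - 2^-1) * L).
    by left; split => //; rewrite h1.
  right; split => //; rewrite h2 andbT leNgt; apply/negP => h4; apply: nz.
  by rewrite /zone /= !ltW.
have le : (intensity m (outer_rest n V) <= (2 * V%:R * (L * far_mass))%:E)%E.
  apply: (le_trans (le_measure _ _ _ sub)); rewrite ?inE //; first exact: measurableU.
  apply: (le_trans (measureU2 _ mB1 mB2)).
  apply: (@le_trans _ _ ((V%:R * L * far_mass)%:E + (V%:R * L * far_mass)%:E)%E).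
    by apply: leeD; [rewrite -E1|rewrite -E2].
  rewrite -EFinD lee_fin le_eqVlt; apply/orP; left; apply/eqP; ring.
have ge : (0 <= intensity m (outer_rest n V))%E by [].
have fin : intensity m (outer_rest n V) \is a fin_num.
  by rewrite ge0_fin_numE // (le_lt_trans le) ?ltry.
exists (fine (intensity m (outer_rest n V))); first by rewrite fineK.
by rewrite -lee_fin fineK.
Qed.

Let single_prob : R := L / 2 * near_mass * expR (- (L / 2 * near_mass)).

Let cluster_prob : R :=
  single_prob ^+ (2 * J).+1 * expR (- ((2 * J%:R + 1) * L * mass m setT)).

Lemma cluster_prob_gt0 : 0 < cluster_prob.
Proof.
have L2 : 0 < L / 2 by rewrite divr_gt0 // L_gt0.
by rewrite mulr_gt0 ?exprn_gt0 ?expR_gt0 // !mulr_gt0 ?expR_gt0.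
Qed.

(** The zone contributes a factor that does not depend on [V].  Each of the [V]
    pairs of further cells contributes 1/2 at least: both cells are hit with
    probability at least (7/8)^2, and they contain no far point with probability
    at least 3/4. *)
Lemma pr_near_event_ge V n : cluster_prob * h ^+ V <= pr P (near_event V n).
Proof.
rewrite pr_site_box_all big_sumType /= big_sumType /= big_bool /=.
pose q : R := expR (- (L / 2 * near_mass)).
have q8 : q <= 8^-1.
  apply: (le_trans miss_small); apply: (@le_trans _ _ (h ^+ 3)).
    exact: ler_wiXn2l.
  by rewrite /h; lra.
have q0 : 0 <= q by exact: expR_ge0.
rewrite (eq_bigr (fun=> single_prob)); last first.
  by move=> a _; rewrite (pr_single PF (measurable_inner _) (intensity_inner _)).
rewrite prodr_const card_ord.
rewrite (eq_bigr (fun=> 1 - q)); last first.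
  move=> a _; have mN c := measurable_no_point PF (measurable_inner c).
  by rewrite (_ : mkset _ = ~` no_point conf (inner L x0 (@site_cell J V n (inr a)))) // pr_setC // pr_miss.
rewrite prodr_const card_sum card_ord.
have [l1 [l10 l1le l1E]] : exists l : R, [/\ 0 <= l,
    l <= (2 * J%:R + 1) * L * mass m setT & intensity m (zone_rest n) = l%:E].
  have [||l [h1 h2 h3]] := @intensity_sub_box R m ((n%:~R - J%:R - 2^-1) * L)
    ((n%:~R + J%:R + 2^-1) * L) (zone_rest n) _ (@measurable_site_box 0 n (inr true)).
  - have := L_gt0; have J0 : 0 <= J%:R :> R by [].
    move: (n%:~R : R) (J%:R : R) J0 => *; nra.
  - by move=> p [zp _]; rewrite -zoneE.
  exists l; split => //; apply: (le_trans h2); rewrite le_eqVlt; apply/orP; left.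
  by apply/eqP; congr (_ * _); field.
have -> : pr P [set w | point_count conf (zone_rest n) w = 0%E] = expR (- l1).
  exact: (pr_no_point PF (@measurable_site_box 0 n (inr true)) l1E).
have [l2 l2E l2le] := intensity_outer_rest n V.
have -> : pr P [set w | point_count conf (outer_rest n V) w = 0%E] = expR (- l2).
  exact: (pr_no_point PF (@measurable_site_box V n (inr false)) l2E).
have u8 : L * far_mass <= 8^-1.
  have u0 : 0 <= L * far_mass by rewrite mulr_ge0 ?mass_ge0 // ltW // L_gt0.
  apply: (@le_trans _ _ (8 * expR 1 * (L * far_mass))).
    rewrite ler_peMl //; have := expR_ge1Dx (1 : R); lra.
  apply: (le_trans outer_small); apply: (@le_trans _ _ (h ^+ 3)).
    exact: ler_wiXn2l.
  by rewrite /h; lra.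
have e2 : h ^+ V <= (1 - q) ^+ (V + V) * expR (- l2).
  apply: (@le_trans _ _ ((1 - q) ^+ (V + V) * (1 - 2 * (L * far_mass)) ^+ V)).
    rewrite exprD -!exprMn; apply: lerXn2r; rewrite ?nnegrE ?mulr_ge0 //; try lra.
    have q7 : 7 / 8 <= 1 - q by lra.
    have u6 : 3 / 4 <= 1 - 2 * (L * far_mass) by lra.
    move: (1 - q) (1 - 2 * (L * far_mass)) q7 u6; rewrite /h => a b *; nra.
  rewrite ler_wpM2l ?exprn_ge0 //; first lra.
  apply: (@le_trans _ _ (expR (- (2 * (L * far_mass))) ^+ V)).
    apply: lerXn2r; rewrite ?nnegrE ?expR_ge0 //; first lra.
    exact: expR_ge1Dx.
  rewrite -expRM_natl ler_expR; move: l2le; lra.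
have e1 : expR (- ((2 * J%:R + 1) * L * mass m setT)) <= expR (- l1).
  by rewrite ler_expR lerN2.
rewrite /cluster_prob.
have s0 : 0 <= single_prob ^+ (2 * J).+1.
  have L2 : 0 <= L / 2 by rewrite divr_ge0 // ltW // L_gt0.
  by rewrite exprn_ge0 // mulr_ge0 ?expR_ge0 // mulr_ge0 // ltW.
rewrite [leRHS]mulrACA; apply: ler_pM => //.
- by rewrite mulr_ge0 // expR_ge0.
- exact: exprn_ge0.
- exact: ler_wpM2l.
Qed.

Section Sites.
Variables (V : nat) (c0 : int).

(** The regions on which the events [near_event V] at different sites depend are
    disjoint. *)
Definition site_center (k : nat) : int := c0 + k%:Z * (2 * (J + V) + 2)%:Z.

Lemma site_center_disjoint k l (i j : site_index V) p :
  site_box (site_center k) i p -> site_box (site_center l) j p -> k = l.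
Proof.
move=> /site_box_window /andP[h1 h2] /site_box_window /andP[h3 h4].
have key a b : (a < b)%N ->
    ((site_center a)%:~R + (J + V)%:R + 2^-1) * L <
    ((site_center b)%:~R - (J + V)%:R - 2^-1) * L.
  move=> ab; rewrite ltr_pM2r ?L_gt0 //.
  have : (site_center a + (2 * (J + V) + 2)%:Z)%:~R <= (site_center b)%:~R :> R.
    by rewrite ler_int /site_center; move: ab; clear; nia.
  rewrite rmorphD /= -pmulrn [(_ + 2)%:R]natrD natrM.
  by move: ((site_center a)%:~R : R) ((site_center b)%:~R : R) ((J + V)%:R : R) => *; lra.
have [/key hh|/key hh|//] := ltngtP k l; exfalso; lra.
Qed.

Lemma pr_sites s : uniq s ->
  pr P [set w | forall k, k \in s -> near_event V (site_center k) w] =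
  \prod_(k <- s) pr P (near_event V (site_center k)).
Proof.
move=> us; pose I := ('I_(size s) * site_index V)%type.
pose ctr (a : 'I_(size s)) := site_center (nth 0%N s a).
pose B (i : I) : set RR := site_box (ctr i.1) i.2.
have -> : [set w | forall k, k \in s -> near_event V (site_center k) w] =
    [set w | forall i : I, site_value i.2 (point_count conf (B i) w)].
  apply/seteqP; split=> w /= H.
    by move=> [a i] /=; apply: (H (nth 0%N s a)); exact: mem_nth.
  move=> k ks i; have ik : (index k s < size s)%N by rewrite index_mem.
  by have := H (Ordinal ik, i); rewrite /B /ctr /= nth_index.
have mB i : measurable (B i) by exact: measurable_site_box.
have tB : trivIset [set: I] B.
  move=> [a i] [b j] _ _ [p [/= p1 p2]].
  have ab : nth 0%N s a = nth 0%N s b := site_center_disjoint p1 p2.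
  have ab' : a = b.
    by apply: val_inj; apply/eqP; rewrite /= -(nth_uniq 0%N (ltn_ord a) (ltn_ord b) us) ab.
  by rewrite ab' in p1 *; congr (_, _); exact: site_box_disjoint p1 p2.
rewrite (pr_all PF mB tB (fun i : I => measurable_site_value i.2)).
rewrite (big_nth 0%N) big_mkord.
rewrite -(pair_bigA _ (fun (a : 'I_(size s)) (i : site_index V) =>
   pr P [set w | site_value i (point_count conf (site_box (ctr a) i) w)])) /=.
by apply: eq_bigr => a _; rewrite pr_site_box_all.
Qed.

Definition sites_fail : set Omega :=
  [set w | forall k, k \in iota 0 (4 ^ V) -> ~ near_event V (site_center k) w].

(** (1 - x)^M <= e^(-M x) <= 1 / (M x), where M = 4^V and x is of order 2^-V. *)
Lemma pr_sites_fail : measurable sites_fail /\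
  pr P sites_fail <= h ^+ V / cluster_prob.
Proof.
have [Ep mE] := pr_occur_none (fun k => measurable_near_event V (site_center k))
  pr_sites (iota_uniq 0 (4 ^ V) : uniq ([::] ++ _)).
have E : [set w | (forall k, k \in [::] -> near_event V (site_center k) w) /\
    (forall k, k \in iota 0 (4 ^ V) -> ~ near_event V (site_center k) w)] = sites_fail.
  by apply/seteqP; split=> w /= => [[]|H] //; split.
rewrite E in Ep mE; split => //; rewrite Ep big_nil mul1r.
have c1 := cluster_prob_gt0.
pose x := cluster_prob * h ^+ V.
have h0 : 0 < h by rewrite invr_gt0.
have xp : 0 < x by rewrite mulr_gt0 // exprn_gt0.
apply: (@le_trans _ _ (\prod_(k <- iota 0 (4 ^ V)) expR (- x))).
  apply: ler_prod => k _; rewrite subr_ge0 pr_le1 ?andTb; last exact: measurable_near_event.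
  by have := pr_near_event_ge V (site_center k); have := expR_ge1Dx (- x); rewrite -/x; lra.
rewrite big_const_seq count_predT size_iota iter_mulr_1 -expRM_natl mulrN expRN.
have -> : h ^+ V / cluster_prob = ((4 ^ V)%:R * x)^-1.
  rewrite /x natrX; have -> : 4 = h^-1 * h^-1 :> R by rewrite /h; field.
  rewrite exprMn (exprVn h V : h^-1 ^+ V = (h ^+ V)^-1); move: (h ^+ V) (exprn_gt0 V h0) => y y0.
  by field; rewrite !gt_eqF.
have p0 : 0 < (4 ^ V)%:R * x by rewrite mulr_gt0 // ltr0n expn_gt0.
rewrite lef_pV2 ?posrE ?expR_gt0 //.
by have := expR_ge1Dx ((4 ^ V)%:R * x); lra.
Qed.

Definition sites_bad : set Omega := sites_fail `|`
  [set w | exists2 k, k \in iota 0 (4 ^ V) & bad_beyond (site_center k) (J + V) w].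

(** The sites are many enough for one of them to succeed, yet few enough for none
    of them to be spoiled from far away, since 4^V * 2^-5V is small. *)
Lemma pr_sites_bad : measurable sites_bad /\
  pr P sites_bad <= h ^+ V * (cluster_prob^-1 + 1).
Proof.
have [m1 p1] := pr_sites_fail.
have mB k := (pr_bad_beyond (site_center k) (J + V)).1.
have m2 := measurable_exists_seq (iota 0 (4 ^ V)) mB.
split; first exact: measurableU.
apply: (le_trans (pr_setU P m1 m2)); rewrite mulrDr mulr1; apply: lerD => //.
apply: (le_trans (pr_exists_seq P _ mB)).
apply: (@le_trans _ _ (\sum_(k <- iota 0 (4 ^ V)) h ^+ (5 * (J + V)))).
  by apply: ler_sum => k _; exact: (pr_bad_beyond _ _).2.
rewrite big_const_seq count_predT size_iota iter_addr_0 -mulr_natr natrX.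
have h0 : 0 < h by rewrite invr_gt0.
apply: (@le_trans _ _ (h ^+ (2 * V + V) * 4 ^+ V)).
  rewrite ler_wpM2r ?exprn_ge0 //; apply: ler_wiXn2l => //; lia.
rewrite exprD mulrAC exprM -exprMn; have -> : h ^+ 2 * 4 = 1 by rewrite /h; field.
by rewrite expr1n mul1r.
Qed.

Lemma not_sites_bad_good w : ~ sites_bad w ->
  exists2 k, (k < 4 ^ V)%N & good_cell L x0 rad J (conf w) (site_center k).
Proof.
move=> nb; have [k ki] : exists2 k, k \in iota 0 (4 ^ V) & near_event V (site_center k) w.
  apply: contrapT => H; apply: nb; left => k ki near; apply: H; by exists k.
move=> near; have k4 : (k < 4 ^ V)%N by move: ki; rewrite mem_iota.
exists k => //; set n := site_center k in near *.
have nbb : ~ bad_beyond n (J + V) w by move=> H; apply: nb; right; exists k.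
have hitI c : `|c - n| <= (J + V)%:Z -> hit L x0 (conf w) c.
  move=> /site_cell_surj [a ->]; apply/hit_occupied.
  have := near (inl a); case: a => [a|a] /=; last by [].
  by move=> E; rewrite /no_point /= E => /eqP; rewrite onee_eq0.
have no_rest p : conf w p -> ~ zone_rest n p.
  move=> wp zp; have /no_pointP E := near (inr true).
  by have : set0 p by rewrite -E.
have no_outer p : conf w p -> ~ outer_rest n V p.
  move=> wp zp; have /no_pointP E := near (inr false).
  by have : set0 p by rewrite -E.
have in_zone p : conf w p -> zone L J n p ->
    exists2 c, `|c - n| <= J%:Z & inner L x0 c p.
  move=> wp zp; have [a ip] : exists a : 'I_(2 * J).+1, inner L x0 (n - J%:Z + a%:Z) p.
    apply: contrapT => H; apply: (no_rest p wp); split => // -[a _ ip].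
    by apply: H; exists a.
  exists (n - J%:Z + a%:Z) => //; have := ltn_ord a; clear; lia.
have no_far p : conf w p -> (n%:~R - (J + V)%:R - 2^-1) * L <= p.1 ->
    p.1 <= (n%:~R + (J + V)%:R + 2^-1) * L -> ~ rad < `|p.2|.
  move=> wp h1 h2 h3; have [zp|nz] := pselect (zone L J n p).
    by have [c _ /inner_not_far] := in_zone p wp zp; apply.
  by apply: (no_outer p wp); split => //; split => //; rewrite h1.
have range c : (J + V < c)%N -> ~ bad_range n c w.
  by move=> lc bc; apply: nbb; exists (c - (J + V).+1)%N => //; rewrite subnKC.
have scale a b : (a <= b)%N -> a%:R * L <= b%:R * L.
  by move=> ab; rewrite ler_wpM2r ?ler_nat // ltW // L_gt0.
have JV0 : 0 <= (J + V)%:R * L by rewrite mulr_ge0 // ltW // L_gt0.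
have LP := L_gt0.
split.
- split => // c /site_cell_near [a ->].
  have := near (inl (inl a)) => /single_point [p [wp ip] pu].
  by exists p.
- move=> c; have [cV|/range nb'] := leqP c (J + V); last exact: not_bad_range_left.
  split.
    rewrite /misses big1 // => i _; rewrite asboolT //; apply: hitI.
    by have := ltn_ord i; move: cV; clear; lia.
  move=> [//|p s] _ /(_ p (mem_head _ _)) [wp [/andP[h1 h2] h3]].
  have h5 := scale _ _ cV; case: (no_far p wp) => //; lra.
- move=> c; have [cV|/range nb'] := leqP c (J + V); last exact: not_bad_range_right.
  split.
    rewrite /misses big1 // => i _; rewrite asboolT //.
    have [|p wp ip] := hitI (n + 1 + i%:Z).
      by have := ltn_ord i; move: cV; clear; lia.
    exists (reflect_time p); first by rewrite /= reflect_timeK.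
    have -> : - n - 1 - i%:Z = - (n + 1 + i%:Z) by ring.
    exact/inner_reflect.
  move=> [//|p s] _ /(_ p (mem_head _ _)) [wp [/andP[h1 h2] h3]].
  have h5 := scale _ _ cV; rewrite rmorphN /= in h1 h2.
  case: (no_far (reflect_time p) wp) => //=; lra.
Qed.

End Sites.

Lemma good_cells_ae (N : int) :
  P.-negligible [set w | ~ exists n : int, N <= n /\ good_cell L x0 rad J (conf w) n] /\
  P.-negligible [set w | ~ exists n : int, n <= N /\ good_cell L x0 rad J (conf w) n].
Proof.
have small e : 0 < e -> exists V : nat, h ^+ V * (cluster_prob^-1 + 1) <= e.
  move=> e0; pose C := cluster_prob^-1 + 1.
  have C0 : 0 < C by rewrite addr_gt0 // invr_gt0 cluster_prob_gt0.
  exists (Num.truncn (C / e)); set V := Num.truncn _.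
  rewrite /h exprVn mulrC -/C ler_pdivrMr ?exprn_gt0 // mulrC -ler_pdivrMr //.
  apply: (@le_trans _ _ V.+1%:R); first exact/ltW/truncnS_gt.
  by rewrite -natrX ler_nat ltn_expl.
split; apply: negligible_small => e /small [V Ve].
- have [mB pB] := pr_sites_bad V N.
  exists (sites_bad V N); split => //; last exact: le_trans Ve.
  move=> w /= H; apply: contrapT => /not_sites_bad_good [k _ gk]; apply: H.
  by exists (site_center V N k); split => //; rewrite /site_center lerDl.
- pose c0 := N - (4 ^ V)%:Z * (2 * (J + V) + 2)%:Z.
  have [mB pB] := pr_sites_bad V c0.
  exists (sites_bad V c0); split => //; last exact: le_trans Ve.
  move=> w /= H; apply: contrapT => /not_sites_bad_good [k k4 gk]; apply: H.
  exists (site_center V c0 k); split => //; rewrite /site_center /c0.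
  rewrite -addrA gerDl addrC subr_le0 ler_wpM2r // lez_nat; exact: ltnW.
Qed.

End GoodCells.

(** * Rigidity of ties *)

Section TieEstimates.
Context {R : realType}.
Implicit Types (p q : R * R) (v : nat -> R * R) (t x y D h : R).

Lemma quotient_lipschitz (X X' T T' Y tau : R) : 0 < tau -> tau <= T -> tau <= T' ->
  `|X| <= Y -> `|X'| <= Y ->
  `|X ^+ 2 / T - X' ^+ 2 / T'| <=
    2 * Y / tau * `|X - X'| + Y ^+ 2 / tau ^+ 2 * `|T - T'|.
Proof.
move=> tau0 tT tT' XY XY'.
have T0 : 0 < T by exact: lt_le_trans tT.
have T0' : 0 < T' by exact: lt_le_trans tT'.
have Y0 : 0 <= Y by exact: le_trans XY.
have -> : X ^+ 2 / T - X' ^+ 2 / T' =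
    (X + X') / T * (X - X') - X' ^+ 2 / (T * T') * (T - T').
  by field; rewrite !gt_eqF.
apply: (le_trans (ler_normB _ _)).
rewrite (normrM ((X + X') / T)) (normrM (X' ^+ 2 / (T * T'))).
apply: lerD; apply: ler_wpM2r => //; rewrite normrM normfV.
  rewrite (gtr0_norm T0); apply: ler_pM => //; first by rewrite invr_ge0 ltW.
    by apply: (le_trans (ler_normD _ _)); lra.
  by rewrite lef_pV2.
rewrite normrX (gtr0_norm (mulr_gt0 T0 T0')); apply: ler_pM => //.
- by rewrite invr_ge0 mulr_ge0 // ltW.
- exact: lerXn2r.
- by rewrite lef_pV2 ?posrE ?mulr_gt0 ?exprn_gt0 // expr2 ler_pM // ltW.
Qed.

Lemma link_lipschitz p q p' q' Y tau e : 0 < tau ->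
  tau <= q.1 - p.1 -> tau <= q'.1 - p'.1 ->
  `|q.2 - p.2| <= Y -> `|q'.2 - p'.2| <= Y ->
  `|p.1 - p'.1| <= e -> `|p.2 - p'.2| <= e ->
  `|q.1 - q'.1| <= e -> `|q.2 - q'.2| <= e ->
  `|link p q - link p' q'| <= (4 * Y / tau + 2 * (Y / tau) ^+ 2) * e.
Proof.
move=> tau0 T T' XY XY' p1 p2 q1 q2.
have Y0 : 0 <= Y by exact: le_trans XY.
apply: (le_trans (quotient_lipschitz tau0 T T' XY XY')).
have d2 : `|q.2 - p.2 - (q'.2 - p'.2)| <= 2 * e.
  have -> : q.2 - p.2 - (q'.2 - p'.2) = (q.2 - q'.2) - (p.2 - p'.2) by ring.
  by apply: (le_trans (ler_normB _ _)); lra.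
have d1 : `|q.1 - p.1 - (q'.1 - p'.1)| <= 2 * e.
  have -> : q.1 - p.1 - (q'.1 - p'.1) = (q.1 - q'.1) - (p.1 - p'.1) by ring.
  by apply: (le_trans (ler_normB _ _)); lra.
have c1 : 0 <= 2 * Y / tau by rewrite divr_ge0 ?mulr_ge0 // ltW.
have c2 : 0 <= Y ^+ 2 / tau ^+ 2 by rewrite divr_ge0 ?exprn_ge0 // ltW.
apply: (le_trans (lerD (ler_wpM2l c1 d2) (ler_wpM2l c2 d1))).
rewrite expr_div_n le_eqVlt; apply/orP; left; apply/eqP; field; by rewrite gt_eqF.
Qed.

Definition two_links p q x t : R := link p (t, x) + link (t, x) q.

(** The second divided difference of 1 / t at three points is the inverse of their
    product, which gives a lower bound on the convexity of [two_links]. *)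
Lemma two_links_convex p q x t t' t'' D d : 0 < D -> 0 < d ->
  p.1 < t -> t < t' -> t' < t'' -> t'' < q.1 ->
  q.1 - p.1 <= D -> d <= `|x - p.2| \/ d <= `|q.2 - x| ->
  d ^+ 2 / D ^+ 3 * ((t'' - t') * (t' - t) * (t'' - t)) <=
  two_links p q x t * (t'' - t') + two_links p q x t'' * (t' - t)
    - two_links p q x t' * (t'' - t).
Proof.
move=> D0 d0 pt tt' t't'' tq pqD dd.
set X := x - p.2 in dd *; set Y := q.2 - x in dd *.
pose W := (t'' - t') * (t' - t) * (t'' - t).
have W0 : 0 <= W by rewrite !mulr_ge0 // subr_ge0 ltW // (lt_trans tt').
have [s0 s0' s0''] : [/\ 0 < t - p.1, 0 < t' - p.1 & 0 < t'' - p.1] by split; lra.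
have [r0 r0' r0''] : [/\ 0 < q.1 - t, 0 < q.1 - t' & 0 < q.1 - t''] by split; lra.
have inv3 a b c : 0 < a -> a <= D -> 0 < b -> b <= D -> 0 < c -> c <= D ->
    W / D ^+ 3 <= W / (a * b * c).
  move=> a0 aD b0 bD c1 cD; apply: ler_wpM2l => //.
  rewrite lef_pV2 ?posrE ?exprn_gt0 ?mulr_gt0 // !exprS expr0 mulr1 mulrA.
  by apply: ler_pM => //; [rewrite mulr_ge0 // ltW|exact: ltW|apply: ler_pM => //; exact: ltW].
have P1 := @inv3 (t - p.1) (t' - p.1) (t'' - p.1).
have P2 := @inv3 (q.1 - t) (q.1 - t') (q.1 - t'').
have {P1} P1 : W / D ^+ 3 <= W / ((t - p.1) * (t' - p.1) * (t'' - p.1)) by apply: P1; lra.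
have {P2} P2 : W / D ^+ 3 <= W / ((q.1 - t) * (q.1 - t') * (q.1 - t'')) by apply: P2; lra.
have E : two_links p q x t * (t'' - t') + two_links p q x t'' * (t' - t)
    - two_links p q x t' * (t'' - t) =
    X ^+ 2 * (W / ((t - p.1) * (t' - p.1) * (t'' - p.1))) +
    Y ^+ 2 * (W / ((q.1 - t) * (q.1 - t') * (q.1 - t''))).
  by rewrite /two_links /link /= -/X -/Y /W; field; rewrite !gt_eqF.
have WD : 0 <= W / D ^+ 3 by rewrite divr_ge0 // exprn_ge0 // ltW.
rewrite E -/W; have -> : d ^+ 2 / D ^+ 3 * W = d ^+ 2 * (W / D ^+ 3) by ring.
have dd0 : 0 <= d ^+ 2 by exact: sqr_ge0.
have sq (u : R) : d <= `|u| -> d ^+ 2 <= u ^+ 2.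
  by move=> du; rewrite -[u ^+ 2]real_normK ?num_real // lerXn2r // nnegrE // ltW.
case: dd => [/sq|/sq] du.
  apply: (@le_trans _ _ (X ^+ 2 * (W / ((t - p.1) * (t' - p.1) * (t'' - p.1))))).
    exact: ler_pM.
  by rewrite lerDl mulr_ge0 ?sqr_ge0 // (le_trans WD).
apply: (@le_trans _ _ (Y ^+ 2 * (W / ((q.1 - t) * (q.1 - t') * (q.1 - t''))))).
  by apply: ler_pM => //; rewrite sqr_ge0 || rewrite exprn_ge0 // ltW.
by rewrite lerDr mulr_ge0 ?sqr_ge0 // (le_trans WD).
Qed.

(** The list of the links, with signs, in a difference of two kinetic energies;
    the points are referred to by their positions in an enumeration. *)
Definition pattern := seq (bool * (nat * nat)).

Definition pattern_sum (pat : pattern) v : R :=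
  \sum_(c <- pat) (-1) ^+ c.1 * link (v c.2.1) (v c.2.2).

Definition apart D p q := D^-1 <= `|p.1 - q.1| \/ D^-1 <= `|p.2 - q.2|.

(** The point [q] completes the points [v 0, ..., v (n - 1)] to a tie.  The number
    [D] bounds all coordinates from above and all relevant separations from below,
    so that the estimates are uniform. *)
Record tie D n (pat : pattern) (ia ib : nat) (z : int) v q : Prop := Tie {
  tie_bounded : forall i, (i < n)%N -> `|(v i).1| <= D /\ `|(v i).2| <= D;
  tie_bounded_kink : `|q.1| <= D /\ `|q.2| <= D;
  tie_apart : forall i j, (i < n)%N -> (j < n)%N -> i != j -> apart D (v i) (v j);
  tie_apart_kink : forall i, (i < n)%N -> apart D q (v i);
  tie_pattern : forall c, c \in pat ->
    [/\ (c.2.1 < n)%N, (c.2.2 < n)%N & D^-1 <= (v c.2.2).1 - (v c.2.1).1];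
  tie_neighbours : (ia < n)%N /\ (ib < n)%N;
  tie_between : D^-1 <= q.1 - (v ia).1 /\ D^-1 <= (v ib).1 - q.1;
  tie_bend : D^-1 <= `|q.2 - (v ia).2| \/ D^-1 <= `|(v ib).2 - q.2|;
  tie_eq : link (v ia) q + link q (v ib) = 2 * z%:~R + pattern_sum pat v
}.

(** A Lipschitz constant of [link] for heights bounded by [D] and time differences
    that are at least [1 / (2 D)]. *)
Definition link_const D := 4 * (2 * D) / (2 * D)^-1 + 2 * (2 * D / (2 * D)^-1) ^+ 2.

(** Up to [link_const D * h] per link the energy at [q] is constant on nearby
    configurations; the last factor is the inverse of the modulus of convexity in
    [two_links_convex] for times that differ by at most [2 D] and a height
    difference [1 / D]. *)
Definition gap_const D (pat : pattern) :=
  2 * ((size pat)%:R + 2) * link_const D * ((2 * D) ^+ 3 * D ^+ 2).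

Lemma link_shift D h p q p' q' : 0 < D -> h <= (2 * D)^-1 / 2 ->
  [/\ `|p.2| <= D, `|q.2| <= D, `|p'.2| <= D & `|q'.2| <= D] ->
  (2 * D)^-1 <= q.1 - p.1 -> (2 * D)^-1 <= q'.1 - p'.1 ->
  `|p.1 - p'.1| <= h -> `|p.2 - p'.2| <= h ->
  `|q.1 - q'.1| <= h -> `|q.2 - q'.2| <= h ->
  `|link p q - link p' q'| <= link_const D * h.
Proof.
move=> D0 hD [p2 q2 p2' q2'] T T' ph1 ph2 qh1 qh2.
apply: link_lipschitz => //; first by rewrite invr_gt0 mulr_gt0.
  by apply: (le_trans (ler_normB _ _)); lra.
by apply: (le_trans (ler_normB _ _)); lra.
Qed.

Lemma energy_near (c s s' l1 l1' l2 l2' z B k : R) :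
  l1' + l2' = z + s' -> `|s - s'| <= k * B -> `|l1 - l1'| <= B -> `|l2 - l2'| <= B ->
  `|l1 + l2 - (z + s)| <= (k + 2) * B.
Proof. rewrite !ler_norml; lra. Qed.

(** Among points of about the same height that complete nearby configurations to
    a tie, no three have times that are far apart: the energy of the two links
    at the point is a uniformly convex function of its time. *)
Lemma tie_gap D n pat ia ib z (v v' v'' : nat -> R * R) q q' q'' h :
  0 < D -> h <= (2 * D)^-1 / 2 ->
  tie D n pat ia ib z v q -> tie D n pat ia ib z v' q' ->
  tie D n pat ia ib z v'' q'' ->
  (forall i, (i < n)%N -> `|(v i).1 - (v' i).1| <= h /\ `|(v i).2 - (v' i).2| <= h) ->
  (forall i, (i < n)%N -> `|(v i).1 - (v'' i).1| <= h /\ `|(v i).2 - (v'' i).2| <= h) ->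
  `|q.2 - q'.2| <= h -> `|q.2 - q''.2| <= h ->
  q.1 < q'.1 -> q'.1 < q''.1 ->
  (q''.1 - q'.1) * (q'.1 - q.1) <= gap_const D pat * h.
Proof.
move=> D0 hD T T' T'' vh' vh'' qh' qh'' qq' qq''.
have h0 : 0 <= h by exact: le_trans qh'.
have D2 : (2 * D)^-1 = D^-1 / 2 by rewrite invfM mulrC.
have Di : 0 < D^-1 by rewrite invr_gt0.
have [ian ibn] := tie_neighbours T.
(* the constant that the energy of the two links nearly takes *)
pose c := 2 * z%:~R + pattern_sum pat v.
pose E := ((size pat)%:R + 2) * link_const D * h.
have near u r : tie D n pat ia ib z u r ->
    (forall i, (i < n)%N -> `|(v i).1 - (u i).1| <= h /\ `|(v i).2 - (u i).2| <= h) ->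
    `|q.2 - r.2| <= h ->
    `|two_links (v ia) (v ib) q.2 r.1 - c| <= E.
  move=> U uh rh.
  have patE : `|pattern_sum pat v - pattern_sum pat u| <=
      (size pat)%:R * (link_const D * h).
    rewrite /pattern_sum -sumrB.
    have -> : (size pat)%:R * (link_const D * h) = \sum_(e <- pat) link_const D * h.
      by rewrite big_const_seq count_predT iter_addr addr0 mulr_natl.
    apply: (le_trans (ler_norm_sum _ _ _)).
    rewrite big_seq [leRHS]big_seq; apply: ler_sum => e epat.
    rewrite -mulrBr normrM normrX normrN1 expr1n mul1r.
    have [i1 i2 ti] := tie_pattern T epat; have [_ _ ti'] := tie_pattern U epat.
    have [b1 b1'] := tie_bounded T i1; have [b2 b2'] := tie_bounded T i2.
    have [b3 b3'] := tie_bounded U i1; have [b4 b4'] := tie_bounded U i2.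
    have [c1 c1'] := uh _ i1; have [c2 c2'] := uh _ i2.
    by apply: link_shift => //; rewrite D2; lra.
  have [bq bq'] := tie_bounded_kink T; have [br br'] := tie_bounded_kink U.
  have [ba ba'] := tie_bounded T ian; have [bb bb'] := tie_bounded T ibn.
  have [bu bu'] := tie_bounded U ian; have [bw bw'] := tie_bounded U ibn.
  have [ca ca'] := uh _ ian; have [cb cb'] := uh _ ibn.
  have [t1 t2] := tie_between U.
  have l1 : `|link (v ia) (r.1, q.2) - link (u ia) r| <= link_const D * h.
    by apply: link_shift => //=; rewrite ?D2 ?subrr ?normr0 //; move: ca; rewrite ler_norml; lra.
  have l2 : `|link (r.1, q.2) (v ib) - link r (u ib)| <= link_const D * h.
    by apply: link_shift => //=; rewrite ?D2 ?subrr ?normr0 //; move: cb; rewrite ler_norml; lra.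
  by rewrite /E -mulrA; apply: energy_near (tie_eq U) patE l1 l2.
have n0 := near v q T; have n1 := near v' q' T' vh' qh'; have n2 := near v'' q'' T'' vh'' qh''.
have {n0} n0 : `|two_links (v ia) (v ib) q.2 q.1 - c| <= E.
  by apply: n0 => [i _|]; [split|]; rewrite subrr normr0.
have [t1 t2] := tie_between T.
have [_ t2''] := tie_between T''; have [cb _] := vh'' _ ibn.
have [ba _] := tie_bounded T ian; have [bb _] := tie_bounded T ibn.
have D20 : 0 < 2 * D by rewrite mulr_gt0.
have := @two_links_convex (v ia) (v ib) q.2 q.1 q'.1 q''.1 (2 * D) D^-1 D20 Di.
move=> /(_ ltac:(lra) qq' qq''); rewrite ler_norml in cb.
move=> /(_ ltac:(lra)); move: ba bb; rewrite !ler_norml => ba bb.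
move=> /(_ ltac:(lra) (tie_bend T)).
move: n0 n1 n2; rewrite !ler_norml; set f0 := two_links _ _ _ q.1.
set f1 := two_links _ _ _ q'.1; set f2 := two_links _ _ _ q''.1.
move=> n0 n1 n2 H.
have W0 : 0 < q''.1 - q.1 by lra.
have H2 : D^-1 ^+ 2 / (2 * D) ^+ 3 * ((q''.1 - q'.1) * (q'.1 - q.1) * (q''.1 - q.1)) <=
    2 * E * (q''.1 - q.1).
  by apply: (le_trans H); nra.
move: H2; rewrite mulrA ler_pM2r // => H2.
have -> : gap_const D pat * h = 2 * E * ((2 * D) ^+ 3 * D ^+ 2) by rewrite /gap_const /E; ring.
rewrite -ler_pdivrMr ?mulr_gt0 ?exprn_gt0 //; apply: le_trans H2.
rewrite le_eqVlt; apply/orP; left; apply/eqP; field; by rewrite gt_eqF.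
Qed.

End TieEstimates.

(** * Negligibility of ties *)

Lemma few_spread (s : seq nat) (g : nat) : uniq s ->
  (forall a b c, a \in s -> b \in s -> c \in s ->
     (a + g < b)%N -> (b + g < c)%N -> False) ->
  (size s <= 2 * g.+1)%N.
Proof.
move=> us spread; case: (posnP (size s)) => [->//|s0].
have [|a0 a0s a0min] := ex_minnP (P := mem s).
  by exists (nth 0%N s 0); exact: mem_nth.
have [/hasP[b bs ab]|/hasPn none] := boolP (has (fun b => (a0 + g < b)%N) s); last first.
  apply: (@leq_trans (size (iota a0 g.+1))); last by rewrite size_iota; lia.
  apply: uniq_leq_size => // x xs; rewrite mem_iota.
  by have := a0min x xs; have := none x xs; lia.
have [|a1 /andP[a1s aa1] a1min] := ex_minnP (P := fun b => (b \in s) && (a0 + g < b)%N).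
  by exists b; rewrite bs.
apply: (@leq_trans (size (iota a0 g.+1 ++ iota a1 g.+1))); last first.
  by rewrite size_cat !size_iota; lia.
apply: uniq_leq_size => // x xs; rewrite mem_cat !mem_iota.
have := a0min x xs; have [xa|ax] := leqP x (a0 + g); first by lia.
have := a1min x; rewrite xs ax => /(_ isT).
have [xa1|ax1] := leqP x (a1 + g); first by lia.
by case: (spread a0 a1 x a0s a1s xs aa1 ax1).
Qed.

Section Ties.
Context {d : measure_display} {Omega : measurableType d} {R : realType}.
Let RR := (measurableTypeR R * measurableTypeR R)%type.
Variables (P : probability Omega R)
  (m : {finite_measure set (measurableTypeR R) -> \bar R})
  (conf : Omega -> set (R * R)).
Hypothesis PF : poisson_field P (intensity m) conf.
Variables (N : nat) (n : nat) (pat : pattern) (ia ib : nat) (z : int).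
Hypothesis N_gt0 : (0 < N)%N.

Definition tie_event : set Omega := [set w | exists v q,
  [/\ forall i, (i < n)%N -> conf w (v i), conf w q &
      tie N%:R n pat ia ib z v q]].

Section Grid.
Variable G : nat.
Hypothesis G_gt0 : (0 < G)%N.
Let h : R := (G%:R ^+ 2)^-1.
Let K := (2 * N * G ^ 2).+1.
Let total : R := mass m setT.

Let h_gt0 : 0 < h. Proof. by rewrite invr_gt0 exprn_gt0 // ltr0n. Qed.

Definition slot (x : R) : nat := Num.truncn ((x + N%:R) / h).

Definition slot_set (a : nat) : set R := [set x | - N%:R <= x /\ slot x = a].

Lemma slot_setP a x : slot_set a x <->
  - N%:R + a%:R * h <= x < - N%:R + a.+1%:R * h.
Proof.
have E : (- N%:R <= x) = (0 <= (x + N%:R) / h).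
  rewrite pmulr_lge0; last by rewrite invr_gt0.
  by apply/idP/idP => ?; lra.
rewrite /slot_set /slot /= E; split=> [[x0 <-]|].
  have := truncn_itv x0; rewrite ler_pdivlMr // ltr_pdivrMr //.
  by move=> /andP[h1 h2]; apply/andP; split; lra.
move=> /andP[h1 h2].
have H : a%:R <= (x + N%:R) / h < a.+1%:R.
  by rewrite ler_pdivlMr // ltr_pdivrMr //; apply/andP; split; lra.
by split; [move: H => /andP[+ _]; apply: le_trans|apply/truncn_def].
Qed.

Lemma slot_set_itv a :
  slot_set a = `[- N%:R + a%:R * h, - N%:R + a.+1%:R * h[%classic.
Proof. by apply/seteqP; split => x /=; rewrite in_itv /= => /slot_setP. Qed.

Lemma measurable_slot_set a : measurable (slot_set a).
Proof. by rewrite slot_set_itv. Qed.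

Lemma slot_set_slot x : `|x| <= N%:R -> slot_set (slot x) x.
Proof. by rewrite ler_norml => /andP[]. Qed.

Lemma slot_lt x : `|x| <= N%:R -> (slot x < K)%N.
Proof.
move=> xN; have /slot_setP /andP[+ _] := slot_set_slot xN.
move: xN; rewrite ler_norml => /andP[_ xN] sx.
have : (slot x)%:R * h <= 2 * N%:R by lra.
rewrite -ler_pdivlMr // /h invrK -natrX -!natrM ler_nat /K; lia.
Qed.

Lemma slot_set_close a x y : slot_set a x -> slot_set a y -> `|x - y| <= h.
Proof.
move=> /slot_setP xa /slot_setP ya; rewrite ler_norml.
by move: xa ya; rewrite -natr1 => /andP[x1 x2] /andP[y1 y2]; apply/andP; split; lra.
Qed.

Lemma slot_set_spread a b g x y : (a + g < b)%N -> slot_set a x -> slot_set b y ->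
  g%:R * h < y - x.
Proof.
move=> agb /slot_setP /andP[_ xa] /slot_setP /andP[yb _].
have : (a.+1 + g)%:R * h <= b%:R * h by rewrite ler_pM2r // ler_nat; lia.
by rewrite natrD mulrDl; lra.
Qed.

Lemma sum_slot_mass k : \sum_(b < k) mass m (slot_set b) <= total.
Proof.
have mS (b : 'I_k) : measurable (slot_set b) by exact: measurable_slot_set.
have mU : measurable (\big[setU/set0]_(b < k) slot_set b) by exact: bigsetU_measurable.
rewrite -lee_fin -sumEFin.
have -> : (\sum_(b < k) (mass m (slot_set b))%:E = \sum_(b < k) m (slot_set b))%E.
  by apply: eq_bigr => b _; have := massE m (mS b) => ->.
rewrite -measure_bigsetU; [|exact: measurable_slot_set|].
  have := massE m measurableT; rewrite -/total => <-.
  by apply: le_measure; rewrite ?inE.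
by move=> i j _ _ [x [[_ <-] [_ <-]]].
Qed.

Definition cell (c : 'I_K * 'I_K) : set RR := slot_set c.1 `*` slot_set c.2.

Lemma measurable_cell c : measurable (cell c).
Proof. by apply: measurableX; exact: measurable_slot_set. Qed.

Lemma cell_disjoint c c' p : cell c p -> cell c' p -> c = c'.
Proof.
case: c c' => [a b] [a' b'] [[_ /= E1] [_ /= E2]] [[_ /= E3] [_ /= E4]].
by congr pair; apply: val_inj => /=; congruence.
Qed.

Lemma cell_close c p q : cell c p -> cell c q ->
  `|p.1 - q.1| <= h /\ `|p.2 - q.2| <= h.
Proof. 
move=> [p1 p2] [q1 q2]; split; first exact: (slot_set_close p1 q1).
exact: (slot_set_close p2 q2).
 Qed.

Lemma in_cell p : `|p.1| <= N%:R -> `|p.2| <= N%:R -> exists c, cell c p.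
Proof.
move=> p1 p2; exists (Ordinal (slot_lt p1), Ordinal (slot_lt p2)).
by split; exact: slot_set_slot.
Qed.

Definition cell_mass (c : 'I_K * 'I_K) : R := h * mass m (slot_set c.2).

Lemma cell_mass_ge0 c : 0 <= cell_mass c.
Proof. by rewrite mulr_ge0 ?mass_ge0 // ltW. Qed.

Lemma pr_cell c : pr P (~` no_point conf (cell c)) <= cell_mass c.
Proof.
apply: (pr_occupied_le PF); first exact: measurable_cell.
rewrite /intensity /= product_measure1E; try exact: measurable_slot_set.
transitivity (lebesgue_measure (slot_set c.1) * (mass m (slot_set c.2))%:E)%E.
  by congr (_ * _)%E; apply: massE; exact: measurable_slot_set.
rewrite slot_set_itv lebesgue_measure_itv /= lte_fin EFinM -EFinB ltrD2l ltr_pM2r //.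
by rewrite ltr_nat ltnSn -natr1; congr (_ %:E * _)%E; ring.
Qed.

Let cells := {ffun 'I_n -> 'I_K * 'I_K}.

(** Cells of the grid in which a tie could be found; the union bound is over these
    choices of cells. *)
Definition compatible (f : cells) (c : 'I_K * 'I_K) : bool :=
  `[< exists v q, [/\ tie N%:R n pat ia ib z v q, cell c q &
        forall i : 'I_n, cell (f i) (v i)] >].

Lemma compatibleP f c : compatible f c -> exists v q,
  [/\ tie N%:R n pat ia ib z v q, cell c q & forall i : 'I_n, cell (f i) (v i)].
Proof. by move/asboolP. Qed.

Hypothesis fine_grid : h <= (2 * N%:R)^-1 / 2.

Let N_pos : 0 < N%:R :> R. Proof. by rewrite ltr0n. Qed.

Lemma apart_cell c p q : apart N%:R p q -> cell c p -> cell c q -> False.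
Proof.
have hN : h < N%:R^-1.
  apply: (le_lt_trans fine_grid); rewrite invfM.
  by have : 0 < N%:R^-1 :> R by [rewrite invr_gt0]; lra.
by move=> ap cp cq; have [] := cell_close cp cq; case: ap; lra.
Qed.

Definition located (f : cells) (c : 'I_K * 'I_K)
  (i : 'I_n + unit) : set RR :=
  cell (match i with inl j => f j | inr _ => c end).

Definition occupied (x : cells * ('I_K * 'I_K)) : set Omega :=
  [set w | forall i, (~` [set 0%E]) (point_count conf (located x.1 x.2 i) w)].

Lemma measurable_occupied x : measurable (occupied x).
Proof.
rewrite (_ : occupied x = \bigcap_(i in [set: 'I_n + unit])
    [set w | (~` [set 0%E]) (point_count conf (located x.1 x.2 i) w)]).
  apply: fin_bigcap_measurable; first exact: finite_finset.
  move=> i _; apply: (measurable_count PF); first exact: measurable_cell.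
  by apply: measurableC; exact: emeasurable_set1.
apply/seteqP; split=> w H; first by move=> i _; exact: H.
by move=> i; exact: (H i Logic.I).
Qed.

Lemma compatible_injective f c : compatible f c ->
  injective f /\ forall i, f i != c.
Proof.
move=> /compatibleP[v [q [T cq fv]]]; split=> [i j fij|i].
  apply/eqP/negPn/negP => ij; apply: (apart_cell (tie_apart T (ltn_ord i) (ltn_ord j) ij) (fv i)).
  by rewrite fij.
apply/negP => /eqP fic; apply: (apart_cell (tie_apart_kink T (ltn_ord i)) cq).
by rewrite -fic.
Qed.

Lemma pr_occupied f c : compatible f c ->
  pr P (occupied (f, c)) <= (\prod_i cell_mass (f i)) * cell_mass c.
Proof.
move=> /compatible_injective[fI fc].
have mC : forall i : 'I_n + unit, measurable (~` [set 0%E : \bar R]).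
  by move=> _; apply: measurableC; exact: emeasurable_set1.
have mB i : measurable (located f c i) by exact: measurable_cell.
have tB : trivIset [set: 'I_n + unit] (located f c).
  move=> [i|[]] [j|[]] _ _ [p [/cell_disjoint /[apply]]] //.
  - by move=> /fI ->.
  - by move=> E; move: (fc i); rewrite E eqxx.
  - by move=> E; move: (fc j); rewrite -E eqxx.
rewrite /occupied (pr_all PF mB tB mC) big_sumType /= (big_pred1 tt); last by case.
have nc c' : 0 <= pr P [set w | (~` [set 0%E]) (point_count conf (cell c') w)].
  exact: pr_ge0.
apply: ler_pM; [by apply: prodr_ge0 => i _; exact: nc|exact: nc| |exact: pr_cell].
by apply: ler_prod => i _; rewrite nc; exact: pr_cell.
Qed.

Variable g : nat.
Hypothesis g_large : gap_const N%:R pat * h <= (g%:R * h) ^+ 2.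

(** By [tie_gap], among the possible time slots for [q] no three are pairwise more
    than [g] apart. *)
Lemma few_compatible f (b : 'I_K) :
  (#|[pred a | compatible f (a, b)]| <= 2 * g.+1)%N.
Proof.
rewrite cardE -(size_map (@nat_of_ord K)); apply: few_spread.
  by rewrite map_inj_uniq ?enum_uniq //; exact: val_inj.
have mem a : a \in enum [pred a | compatible f (a, b)] -> compatible f (a, b).
  by rewrite mem_enum.
move=> _ _ _ /mapP[a /mem + ->] /mapP[a' /mem + ->] /mapP[a'' /mem + ->].
move=> /compatibleP[v [q [T [/= q1 q2] fv]]].
move=> /compatibleP[v' [q' [T' [/= q1' q2'] fv']]].
move=> /compatibleP[v'' [q'' [T'' [/= q1'' q2''] fv'']]] aa' aa''.
have d1 := slot_set_spread aa' q1 q1'; have d2 := slot_set_spread aa'' q1' q1''.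
have gh : 0 <= g%:R * h by rewrite mulr_ge0 // ltW.
have [lt1 lt2] : q.1 < q'.1 /\ q'.1 < q''.1 by split; lra.
have close (u u' : nat -> R * R) : (forall i : 'I_n, cell (f i) (u i)) ->
    (forall i : 'I_n, cell (f i) (u' i)) -> forall i, (i < n)%N ->
    `|(u i).1 - (u' i).1| <= h /\ `|(u i).2 - (u' i).2| <= h.
  by move=> H H' i ilt; apply: cell_close (H (Ordinal ilt)) (H' (Ordinal ilt)).
have H := tie_gap N_pos fine_grid T T' T'' (close v v' fv fv') (close v v'' fv fv'')
  (slot_set_close q2 q2') (slot_set_close q2 q2'') lt1 lt2.
by have := g_large; rewrite expr2; nra.
Qed.

Lemma sum_cell_mass : \sum_c cell_mass c <= (2 * N%:R + 1) * total.
Proof.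
rewrite -(pair_big xpredT xpredT (fun a b => cell_mass (a, b))) /=.
rewrite (eq_bigr (fun=> \sum_(b < K) h * mass m (slot_set b))) // sumr_const card_ord.
rewrite -mulr_sumr -[X in X <= _]mulr_natl mulrA.
have t0 : 0 <= total by exact: mass_ge0.
apply: (@le_trans _ _ (K%:R * h * total)).
  by apply: ler_wpM2l (sum_slot_mass K); rewrite mulr_ge0 // ltW.
apply: ler_wpM2r => //; rewrite /K -[(2 * N * _).+1%:R]natr1 mulrDl mul1r !natrM.
have h1 : h <= 1 by rewrite invf_le1 ?exprn_gt0 ?ltr0n // exprn_ege1 // ler1n.
by rewrite -expr2 -mulrA /h mulfV ?mulr1 ?lerD2l // gt_eqF // exprn_gt0 // ltr0n.
Qed.

(** Union bound over the cells of a grid of mesh [h].  Once the cells of the other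
    points and the height slot of [q] are chosen, there remain of order
    [1 / sqrt h] time slots for [q] instead of [1 / h]. *)
Lemma tie_event_grid : exists B, [/\ measurable B, tie_event `<=` B &
  pr P B <= ((2 * N%:R + 1) * total) ^+ n * (h * (2 * g.+1)%:R * total)].
Proof.
have t0 : 0 <= total by exact: mass_ge0.
exists [set w | exists2 x,
  x \in enum [pred x : cells * ('I_K * 'I_K) | compatible x.1 x.2] & occupied x w].
have mO := measurable_occupied.
split; first exact: measurable_exists_seq.
  move=> w [v [q [wv wq T]]].
  have [c cq] := in_cell (tie_bounded_kink T).1 (tie_bounded_kink T).2.
  have /choice[f fP] : forall i : 'I_n, exists c', cell c' (v i).
    by move=> i; have [b1 b2] := tie_bounded T (ltn_ord i); exact: in_cell.
  exists (finfun f, c).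
    have fc : compatible (finfun f) c.
      by apply/asboolP; exists v, q; split => // i; rewrite ffunE; exact: fP.
    by rewrite mem_enum.
  move=> [i|[]] /= /no_pointP; rewrite -subset0.
    by move=> /(_ (v i)); rewrite /located /= ffunE; apply; split => //; exact: wv.
  by move=> /(_ q); apply; split.
apply: (le_trans (pr_exists_seq P _ mO)); rewrite big_enum /=.
apply: (@le_trans _ _ (\sum_(x : cells * ('I_K * 'I_K) | compatible x.1 x.2)
   (\prod_i cell_mass (x.1 i)) * cell_mass x.2)).
  by apply: ler_sum => -[f c] /= fc; exact: pr_occupied.
rewrite big_mkcond /=.
rewrite -(pair_big xpredT xpredT (fun f c => if compatible f c then
   (\prod_i cell_mass (f i)) * cell_mass c else 0)) /=.
apply: (@le_trans _ _ (\sum_(f : cells)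
   (\prod_i cell_mass (f i)) * (h * (2 * g.+1)%:R * total))).
  apply: ler_sum => f _.
  rewrite (eq_bigr (fun c => (\prod_i cell_mass (f i)) *
     (if compatible f c then cell_mass c else 0))); last first.
    by move=> c _; case: ifP => // _; rewrite mulr0.
  rewrite -mulr_sumr; apply: ler_wpM2l; first by apply: prodr_ge0 => i _; exact: cell_mass_ge0.
  rewrite -(pair_big xpredT xpredT (fun a b => if compatible f (a, b) then cell_mass (a, b) else 0)) /=.
  rewrite exchange_big /=.
  apply: (@le_trans _ _ (\sum_(b < K) h * (2 * g.+1)%:R * mass m (slot_set b))); last first.
    by rewrite -mulr_sumr; apply: ler_wpM2l (sum_slot_mass K); rewrite mulr_ge0 // ltW.
  apply: ler_sum => b _.
  have -> : \sum_(a < K) (if compatible f (a, b) then cell_mass (a, b) else 0) =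
      #|[pred a | compatible f (a, b)]|%:R * (h * mass m (slot_set b)).
    by rewrite -big_mkcond mulr_natl -sumr_const.
  rewrite mulrCA -mulrA; apply: ler_wpM2l; first exact: ltW.
  apply: ler_wpM2r; first exact: mass_ge0.
  by rewrite ler_nat; exact: few_compatible.
rewrite -mulr_suml; apply: ler_wpM2r; first by rewrite !mulr_ge0 // ltW.
rewrite -(bigA_distr_bigA (fun (_ : 'I_n) c => cell_mass c)) /= prodr_const card_ord.
by apply: lerXn2r; rewrite ?nnegrE ?mulr_ge0 ?sumr_ge0 ?sum_cell_mass // => c _; exact: cell_mass_ge0.
Qed.

End Grid.

Lemma tie_event_negligible : P.-negligible tie_event.
Proof.
apply: negligible_small => e e0.
have t0 : 0 <= mass m setT by exact: mass_ge0.
(* with slots of length 1 / G^2, gaps of c * G slots contradict [tie_gap] as soon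
   as c^2 is at least [gap_const] *)
pose c := (Num.truncn (gap_const N%:R pat : R)).+1.
pose A : R := ((2 * N%:R + 1) * mass m setT) ^+ n * ((2 * c)%:R + 2) * mass m setT.
have A0 : 0 <= A by rewrite !mulr_ge0 ?exprn_ge0 ?mulr_ge0 ?addr_ge0.
pose G := ((Num.truncn (A / e)).+1 + 4 * N)%N.
have G0 : (0 < G)%N by rewrite /G; lia.
have Gr : 0 < G%:R :> R by rewrite ltr0n.
have G1 : 1 <= G%:R :> R by rewrite ler1n.
have hG : (G%:R ^+ 2)^-1 <= (2 * N%:R)^-1 / 2 :> R.
  have N0 : 0 < N%:R :> R by rewrite ltr0n.
  rewrite -invfM lef_pV2 ?posrE ?exprn_gt0 ?mulr_gt0 //.
  apply: (@le_trans _ _ (G%:R)); last by rewrite expr2 ler_peMl // ltW.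
  have -> : 2 * N%:R * 2 = (4 * N)%:R :> R by rewrite natrM; lra.
  by rewrite ler_nat /G; lia.
have gh : gap_const N%:R pat * (G%:R ^+ 2)^-1 <= ((c * G)%:R * (G%:R ^+ 2)^-1) ^+ 2 :> R.
  have -> : ((c * G)%:R * (G%:R ^+ 2)^-1) ^+ 2 = c%:R ^+ 2 * (G%:R ^+ 2)^-1 :> R.
    by rewrite natrM; field; rewrite gt_eqF.
  rewrite ler_pM2r ?invr_gt0 ?exprn_gt0 //.
  apply: (@le_trans _ _ c%:R); first by apply: ltW; exact: truncnS_gt.
  by rewrite expr2 ler_peMl // ler1n.
have [B [mB AB pB]] := tie_event_grid G0 hG gh.
exists B; split => //; apply: (le_trans pB).
apply: (@le_trans _ _ (A / G%:R)).
  rewrite /A -!mulrA; apply: ler_wpM2l; first by rewrite exprn_ge0 // mulr_ge0 // addr_ge0.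
  rewrite mulrA [leRHS]mulrCA [leRHS]mulrC; apply: ler_wpM2r => //.
  rewrite mulrC ler_pdivrMr ?exprn_gt0 //.
  have -> : ((2 * c)%:R + 2) / G%:R * G%:R ^+ 2 = ((2 * c)%:R + 2) * G%:R :> R.
    by field; rewrite gt_eqF.
  have -> : (2 * (c * G).+1)%:R = (2 * c)%:R * G%:R + 2 :> R.
    by rewrite mulnS natrD addrC mulnA natrM.
  by rewrite mulrDl lerD2l; lra.
rewrite ler_pdivrMr // mulrC -ler_pdivrMr //.
apply: (@le_trans _ _ (Num.truncn (A / e)).+1%:R); first by apply: ltW; exact: truncnS_gt.
by rewrite ler_nat /G; lia.
Qed.

End Ties.

Section TiesOfChains.
Context {R : realType}.
Implicit Types (p q : R * R) (l O : seq (R * R)).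

Definition chain_pattern (neg : bool) O p l : pattern :=
  [seq (neg, (index c.1 O, index c.2 O)) | c <- zip (p :: l) l].

Lemma pattern_sum_cat pat pat' (v : nat -> R * R) :
  pattern_sum (pat ++ pat') v = pattern_sum pat v + pattern_sum pat' v.
Proof. by rewrite /pattern_sum big_cat. Qed.

Lemma pattern_sum_chain neg O p l x0 : {subset p :: l <= O} ->
  pattern_sum (chain_pattern neg O p l) (nth x0 O) = (-1) ^+ neg * kinetic p l.
Proof.
elim: l p => [|q l IH] p sub; first by rewrite /pattern_sum big_nil mulr0.
have pO : p \in O by apply: sub; exact: mem_head.
have qO : q \in O by apply: sub; rewrite inE mem_head orbT.
have /IH {}IH : {subset q :: l <= O} by move=> r ql; apply: sub; rewrite inE ql orbT.
by rewrite /pattern_sum /= big_cons /= !nth_index // [X in _ + X]IH mulrDr.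
Qed.

Lemma chain_pattern_before neg O p l c : path before p l -> {subset p :: l <= O} ->
  c \in chain_pattern neg O p l ->
  exists r s, [/\ r \in O, s \in O, before r s & c.2 = (index r O, index s O)].
Proof.
elim: l p => // q l IH p /= /andP[pq ql] sub.
have pO : p \in O by apply: sub; exact: mem_head.
have qO : q \in O by apply: sub; rewrite inE mem_head orbT.
rewrite inE => /predU1P[->|]; first by exists p, q.
by apply: IH => // r rl; apply: sub; rewrite inE rl orbT.
Qed.

Lemma large_bound (s : seq R) : exists2 N : nat, (0 < N)%N &
  forall x, x \in s -> `|x| <= N%:R /\ (x != 0 -> N%:R^-1 <= `|x|).
Proof.
elim: s => [|y s [N N0 NP]]; first by exists 1.
pose M := (N + (Num.truncn `|y|).+1 + (Num.truncn `|y|^-1).+1)%N.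
have M0 : (0 < M)%N by rewrite /M addnS.
have NM : N%:R <= M%:R :> R by rewrite ler_nat /M -addnA leq_addr.
exists M => // x; rewrite inE => /predU1P[->|xs].
  split.
    apply: (le_trans (ltW (truncnS_gt _))).
    by rewrite ler_nat /M -addnA addnCA leq_addr.
  move=> y0; rewrite invf_ple ?posrE ?normr_gt0 ?ltr0n //.
  apply: (le_trans (ltW (truncnS_gt _))).
  by rewrite ler_nat /M leq_addl.
have [h1 h2] := NP _ xs; split=> [|x0]; first exact: le_trans NM.
by apply: le_trans (h2 x0); rewrite lef_pV2 ?posrE ?ltr0n.
Qed.

(** Finitely many points are separated at some scale. *)
Lemma resolution O : exists2 N : nat, (0 < N)%N & forall p q, p \in O -> q \in O ->
  [/\ `|p.1| <= N%:R, `|p.2| <= N%:R,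
      before p q -> N%:R^-1 <= q.1 - p.1,
      p.2 != q.2 -> N%:R^-1 <= `|p.2 - q.2| &
      p != q -> apart N%:R p q].
Proof.
have [N N0 NP] := large_bound ([seq p.1 | p <- O] ++ [seq p.2 | p <- O] ++
  [seq p.1 - q.1 | p <- O, q <- O] ++ [seq p.2 - q.2 | p <- O, q <- O]).
exists N => // p q pO qO.
have [|b1 _] := NP p.1; first by rewrite mem_cat map_f.
have [|b2 _] := NP p.2; first by rewrite !mem_cat [_ \in map snd O]map_f ?orbT.
have [|_ d1] := NP (p.1 - q.1).
  by rewrite !mem_cat (allpairs_f (fun p q => p.1 - q.1)) ?orbT.
have [|_ d2] := NP (p.2 - q.2).
  by rewrite !mem_cat (allpairs_f (fun p q => p.2 - q.2)) ?orbT.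
rewrite !subr_eq0 in d1 d2; split => //.
  rewrite /before => pq; have := d1; rewrite lt_eqF // => /(_ isT).
  by rewrite distrC ger0_norm // subr_ge0 ltW.
case: p q d1 d2 {b1 b2 pO qO} => [t x] [t' x'] /= d1 d2; rewrite xpair_eqE negb_and.
by case/orP => [/d1|/d2] h; [left|right].
Qed.

(** A tie between two chains is an equation for a vertex of the first one that
    the second one avoids. *)
Lemma tie_of_not_no_ties (w : set (R * R)) : ~ no_ties w ->
  exists N n pat ia ib z, (0 < N)%N /\ exists v q,
    [/\ forall i, (i < n)%N -> w (v i), w q & tie N%:R n pat ia ib z v q].
Proof.
move=> H; apply: contrapT => none; apply: H.
move=> e0 e1 k1 q k2 k z we0 we1 wk1 wk p1 p2 qk bend E; apply: none.
have Ek : rcons (k1 ++ q :: k2) e1 = k1 ++ q :: rcons k2 e1 by rewrite rcons_cat.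
rewrite Ek in p1 E; set a := last e0 k1 in bend; set b := head e1 k2 in bend.
have [l2 l2E] : exists l2, rcons k2 e1 = b :: l2.
  by rewrite /b; case: (k2) => [|y k2']; [exists [::]|exists (rcons k2' e1)].
pose O := undup (e0 :: e1 :: k1 ++ k2 ++ k).
have OP r : r \in O = (r \in e0 :: e1 :: k1 ++ k2 ++ k) by rewrite mem_undup.
have wO r : r \in O -> w r.
  rewrite OP !inE !mem_cat => /or4P[/eqP->|/eqP->|rk1|/orP[rk2|/wk]] //; apply: wk1.
    by rewrite mem_cat rk1.
  by rewrite mem_cat inE rk2 !orbT.
have u1 := path_before_uniq p1.
have qO : q \notin O.
  move: u1; rewrite OP /= mem_cat inE cat_uniq /= !inE !mem_cat !negb_or mem_rcons inE.
  rewrite qk andbT; case/and5P => /and3P[_ + _] _ /andP[qk1 _] + _.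
  by rewrite eq_sym mem_rcons inE negb_or qk1 => -> /andP[-> ->].
have e0O : e0 \in O by rewrite OP mem_head.
have e1O : e1 \in O by rewrite OP !inE eqxx orbT.
have k1O : {subset e0 :: k1 <= O}.
  by move=> r; rewrite OP !inE !mem_cat => /orP[->|->]; rewrite ?orbT.
have kO : {subset e0 :: rcons k e1 <= O}.
  move=> r; rewrite OP !inE !mem_cat mem_rcons inE.
  by case/or3P => ->; rewrite ?orbT.
have k2O : {subset b :: l2 <= O}.
  move=> r; rewrite -l2E OP mem_rcons !inE !mem_cat.
  by case/orP => ->; rewrite ?orbT.
have aO : a \in O by apply: k1O; exact: mem_last.
have bO : b \in O by apply: k2O; exact: mem_head.
move: p1; rewrite l2E cat_path /= -/a => /and4P[pk1 aq qb pl2].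
have [N N0 NP] := resolution (q :: O).
pose pat := chain_pattern false O e0 (rcons k e1) ++
  (chain_pattern true O e0 k1 ++ chain_pattern true O b l2).
have inO r : r \in O -> r \in q :: O by rewrite inE => ->; rewrite orbT.
have qin := mem_head q O.
exists N, (size O), pat, (index a O), (index b O), z; split => //.
exists (nth e0 O), q; split.
- by move=> i iO; apply: wO; exact: mem_nth.
- by apply: wk1; rewrite mem_cat mem_head orbT.
split.
- by move=> i iO; have [] := NP _ q (inO _ (mem_nth e0 iO)) qin.
- by have [] := NP _ _ qin qin.
- move=> i j iO jO ij; have [_ _ _ _] := NP _ _ (inO _ (mem_nth e0 iO)) (inO _ (mem_nth e0 jO)).
  by apply; rewrite nth_uniq ?undup_uniq.
- move=> i iO; have [_ _ _ _] := NP _ _ qin (inO _ (mem_nth e0 iO)); apply.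
  by apply: contraNneq qO => ->; exact: mem_nth.
- move=> c; rewrite !mem_cat => cpat.
  have [r [s [rO sO rs ->]]] : exists r s,
      [/\ r \in O, s \in O, before r s & c.2 = (index r O, index s O)].
    case/or3P: cpat => /chain_pattern_before; [exact: (fun f => f p2 kO)|
      exact: (fun f => f pk1 k1O)|exact: (fun f => f pl2 k2O)].
  rewrite /= !index_mem !nth_index //; split => //.
  by have [_ _ + _ _] := NP _ _ (inO _ rO) (inO _ sO); apply.
- by rewrite !index_mem.
- rewrite !nth_index //; have [_ _ h1 _ _] := NP _ _ (inO _ aO) qin.
  by have [_ _ h2 _ _] := NP _ _ qin (inO _ bO); split; [exact: h1|exact: h2].
- rewrite !nth_index //; have [_ _ _ h1 _] := NP _ _ qin (inO _ aO).
  have [_ _ _ h2 _] := NP _ _ (inO _ bO) qin.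
  case: (eqVneq q.2 a.2) => [qa|/h1]; last by left.
  case: (eqVneq b.2 q.2) => [qb'|/h2]; last by right.
  by case: bend.
rewrite !nth_index // !pattern_sum_cat !pattern_sum_chain // expr0 expr1.
by rewrite -E l2E kinetic_cat /= -/a; ring.
Qed.

End TiesOfChains.

Section NoTies.
Context {d : measure_display} {Omega : measurableType d} {R : realType}.
Variables (P : probability Omega R)
  (m : {finite_measure set (measurableTypeR R) -> \bar R})
  (conf : Omega -> set (R * R)).
Hypothesis PF : poisson_field P (intensity m) conf.

Lemma no_ties_ae : P.-negligible [set w | ~ no_ties (conf w)].
Proof.
pose F k : set Omega :=
  if (choice.unpickle k : option (nat * (nat * (pattern * (nat * (nat * int)))))) is
    Some (N, (n, (pat, (ia, (ib, z))))) then
  if (0 < N)%N then tie_event conf N n pat ia ib z else set0 else set0.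
apply: (@negligibleS _ _ _ _ (\bigcup_k F k)).
  move=> w /= /tie_of_not_no_ties[N [n [pat [ia [ib [z [N0 T]]]]]]].
  exists (choice.pickle (N, (n, (pat, (ia, (ib, z)))))) => //.
  by rewrite /F choice.pickleK N0.
apply: negligible_bigcup => k; rewrite /F.
case: choice.unpickle => [[N [n [pat [ia [ib z]]]]]|]; last exact: negligible_set0.
by case: ifP => [N0|_]; [exact: (tie_event_negligible PF)|exact: negligible_set0].
Qed.

End NoTies.

(** * Choice of the scales and conclusion *)

Section GoodScales.
Context {R : realType}.
Variable m : {finite_measure set (measurableTypeR R) -> \bar R}.

Lemma mass_far_le (a b : R) : a <= b ->
  mass m (far_from_axis b) <= mass m (far_from_axis a).
Proof.
move=> ab; have mF := @measurable_far_from_axis R.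
rewrite -lee_fin; have := massE m (mF a); have := massE m (mF b) => <- <-.
apply: le_measure; [by rewrite inE; exact: mF|by rewrite inE; exact: mF|].
by move=> x; rewrite /far_from_axis /=; exact: le_lt_trans.
Qed.

(** First [L] is taken so large that a cell is rarely missed, then [rad] so large
    that far points are rare in a cell of length [L]. *)
Lemma good_scales : m [set: measurableTypeR R] != 0%E -> exists L x0 rad,
  [/\ 32 <= L, `|x0| + 1 <= rad, 0 < mass m `[x0 - 1, x0 + 1]%classic,
      expR (- (L / 2 * mass m `[x0 - 1, x0 + 1]%classic)) <= 2^-1 ^+ 24 &
      8 * expR 1 * (L * mass m (far_from_axis rad)) <= 2^-1 ^+ 40].
Proof.
move=> /mass_near_pos[x0]; set near := mass m _ => near0.
pose X : R := 2 ^+ 24; have X0 : 0 < X by exact: exprn_gt0.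
pose L := 32 + 2 * X / near.
have XL : 0 < 2 * X / near by rewrite divr_gt0 // mulr_gt0.
have L0 : 0 < L by rewrite /L; lra.
have c0 : 0 < 8 * expR 1 * L :> R by rewrite !mulr_gt0 ?expR_gt0.
have [|n nP] := @mass_far_small R m (2^-1 ^+ 40 / (8 * expR 1 * L)).
  by rewrite divr_gt0 // exprn_gt0.
exists L, x0, (n%:R + (`|x0| + 1)); split => //.
- by rewrite /L lerDl ltW.
- by rewrite lerDr.
- rewrite exprVn -/X expRN lef_pV2 ?posrE ?expR_gt0 //.
  apply: le_trans (expR_ge1Dx _).
  have -> : L / 2 * near = 16 * near + X by rewrite /L; field; rewrite gt_eqF.
  by lra.
rewrite mulrA mulrC -ler_pdivlMr //; apply: le_trans (ltW nP).
by apply: mass_far_le; rewrite lerDl; have := normr_ge0 x0; lra.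
Qed.

End GoodScales.

Theorem theorem8p2 (R : realType) (d : measure_display)
    (Omega : measurableType d) (P : probability Omega R)
    (m : {finite_measure set (measurableTypeR R) -> \bar R})
    (conf : Omega -> set (R * R)) :
  measure_is_complete P ->
  m [set: measurableTypeR R] != 0%E ->
  poisson_field P (@lebesgue_measure R \x m)%E conf ->
  {ae P, forall w,
    exists g : R -> R,
      [/\ global_minimizer (conf w) g /\ recurrent g,
          forall g' : R -> R,
            global_minimizer (conf w) g' -> recurrent g' -> g' = g &
          forall gt : R -> R, one_sided_minimizer (conf w) gt ->
            exists2 tau : R, tau < 0 & forall s, s <= tau -> g s = gt s]}.
Proof.
move=> _ /good_scales[L [x0 [rad [L_ge rad_ge near0 miss outer]]]] PF.
pose J := (Num.truncn (2 * join_cost L x0 rad + 2)).+1.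
have J_ge : 2 * join_cost L x0 rad + 2 <= J%:R by apply: ltW; exact: truncnS_gt.
have PF' : poisson_field P (intensity m) conf by exact: PF.
have good k := good_cells_ae PF' J L_ge rad_ge near0 miss outer k.
have ae_right : {ae P, forall w, forall k : nat, exists n : int,
    k%:Z <= n /\ good_cell L x0 rad J (conf w) n}.
  apply: negligibleS (negligible_bigcup (fun k : nat => (good k%:Z).1)).
  by move=> w /= /existsNP[k kP]; exists k.
have ae_left : {ae P, forall w, forall k : nat, exists n : int,
    n <= - k%:Z /\ good_cell L x0 rad J (conf w) n}.
  apply: negligibleS (negligible_bigcup (fun k : nat => (good (- k%:Z)).2)).
  by move=> w /= /existsNP[k kP]; exists k.
have ae_ties : {ae P, forall w, no_ties (conf w)} by exact: no_ties_ae PF'.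
have := strip_finite_ae PF'.
apply: filterS2 (filterI ae_ties (filterI ae_left ae_right)) => w.
move=> [ties [left right]] fin.
apply: (recurrent_minimizer_of_good_cells L_ge rad_ge J_ge fin ties) => N.
  have [n [kn gn]] := right `|N|%N; exists n; split => //.
  by apply: le_trans kn; exact: lez_abs.
have [n [kn gn]] := left `|N|%N; exists n; split => //.
by apply: (le_trans kn); rewrite lerNl; have := lez_abs (- N); rewrite abszN.
Qed.
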